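(* Let $A_0\in\mathbb{R}^{n\times n}$ be Metzler, $C_0\in\mathbb{R}^{n_y\times n}$, $E_u\in\mathbb{R}^{n\times n_u}$, $F_u\in\mathbb{R}^{n_y\times n_u}$ entrywise nonnegative, $\bar h_1,\ldots,\bar h_N>0$, and $A_i:[-\bar h_i,0]\to\mathbb{R}^{n\times n}$, $C_i:[-\bar h_i,0]\to\mathbb{R}^{n_y\times n}$ integrable functions that are entrywise nonnegative on their domain (so the system below is internally positive). Consider $$\dot x(t)=A_0x(t)+\sum_{i=1}^N\int_{-\bar h_i}^0A_i(\theta)x(t+\theta)d\theta+E_uu(t),\quad y(t)=C_0x(t)+\sum_{i=1}^N\int_{-\bar h_i}^0C_i(\theta)x(t+\theta)d\theta+F_uu(t),$$ and define $\bar A_i:=\int_{-\bar h_i}^0A_i(s)ds$, $\bar C_i:=\int_{-\bar h_i}^0C_i(s)ds$. Then: (i) The system is asymptotically stable and has $L_1$-gain smaller than $\gamma_1$ if and only if there exists $\lambda\in\mathbb{R}^n_{>0}$ such that $$\begin{bmatrix}\lambda\\ \mathbf{1}_{n_y}\end{bmatrix}^T\begin{bmatrix}A_0+\sum_{i=1}^N\bar A_i & E_u\\ C_0+\sum_{i=1}^N\bar C_i & F_u\end{bmatrix}<\begin{bmatrix}0\\ \gamma_1\mathbf{1}_{n_u}\end{bmatrix}^T.$$ (ii) The system is asymptotically stable and has $L_2$-gain smaller than $\gamma_2$ if and only if there exist diagonal positive definite $P,Q_1,\ldots,Q_N\in\mathbb{R}^{n\times n}$ and $R_1,\ldots,R_N\in\mathbb{R}^{n_y\times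 n_y}$ such that $$\begin{bmatrix}A_0^TP+PA_0+\sum_{i=1}^N\bar A_i^TQ_i\bar A_i+\sum_{i=1}^N\bar C_i^TR_i\bar C_i & \mathbf{1}_N^T\otimes P & 0 & PE_u & C_0^T\\ \star & -\mathrm{diag}(Q_1,\ldots,Q_N) & 0 & 0 & 0\\ \star & \star & -\mathrm{diag}(R_1,\ldots,R_N) & 0 & \mathbf{1}_N\otimes I_{n_y}\\ \star & \star & \star & -\gamma_2I_{n_u} & F_u^T\\ \star & \star & \star & \star & -\gamma_2I_{n_y}\end{bmatrix}\prec0.$$ (iii) The system is asymptotically stable and has $L_\infty$-gain smaller than $\gamma_\infty$ if and only if there exists $\lambda\in\mathbb{R}^n_{>0}$ such that $$\begin{bmatrix}A_0+\sum_{i=1}^N\bar A_i & E_u\\ C_0+\sum_{i=1}^N\bar C_i & F_u\end{bmatrix}\begin{bmatrix}\lambda\\ \mathbf{1}_{n_u}\end{bmatrix}<\begin{bmatrix}0\\ \gamma_\infty\mathbf{1}_{n_y}\end{bmatrix}.$$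
   Context: A Metzler matrix has nonnegative off-diagonal entries. $\mathbf{1}_k$ is the vector of ones and $\otimes$ the Kronecker product; vector inequalities are componentwise; $\star$ denotes the transpose of the symmetric block; $\prec0$ means negative definite. Asymptotic stability refers to the unforced system ($u=0$). The $L_p$-gain is the induced gain of $u\mapsto y$ with zero initial conditions, with $\|w\|_{L_p}=(\int_0^\infty\|w(t)\|_p^pdt)^{1/p}$ for $p=1,2$ and $\|w\|_{L_\infty}=\operatorname{ess\,sup}_t\|w(t)\|_\infty$. *)

(* Defs.v *)
From HB Require Import structures.
From mathcomp Require Import all_boot all_order all_algebra.
From mathcomp Require Import all_classical all_reals all_analysis.

Set Implicit Arguments.
Unset Strict Implicit.
Unset Printing Implicit Defensive.

Import Order.TTheory GRing.Theory Num.Theory.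
Import numFieldNormedType.Exports.

Local Open Scope classical_set_scope.
Local Open Scope ring_scope.

Section Defs.
Variable R : realType.

Local Notation mu := (@lebesgue_measure R).

Definition metzler n (A : 'M[R]_n) : Prop :=
  forall i j : 'I_n, i != j -> 0 <= A i j.

Definition nonneg_mx m n (A : 'M[R]_(m, n)) : Prop :=
  forall i j, 0 <= A i j.

Definition negdef k (M : 'M[R]_k) : Prop :=
  forall v : 'cV[R]_k, v != 0 -> (v^T *m M *m v) 0 0 < 0.
Definition posdef k (M : 'M[R]_k) : Prop :=
  forall v : 'cV[R]_k, v != 0 -> 0 < (v^T *m M *m v) 0 0.

Definition diag_posdef k (M : 'M[R]_k) : Prop := is_diag_mx M /\ posdef M.

Definition vnorm1 m (v : 'cV[R]_m) : R := \sum_k `|v k 0|.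
Definition vnorm2 m (v : 'cV[R]_m) : R := Num.sqrt (\sum_k (v k 0) ^+ 2).
Definition vnorminf m (v : 'cV[R]_m) : R := \big[Num.max/0]_k `|v k 0|.

Definition Rplus_set : set R := `[0, +oo[.

Definition L1norm m (w : R -> 'cV[R]_m) : \bar R :=
  (\int[mu]_(t in Rplus_set) (vnorm1 (w t))%:E)%E.
Definition L2norm m (w : R -> 'cV[R]_m) : \bar R :=
  ((\int[mu]_(t in Rplus_set) ((vnorm2 (w t)) ^+ 2)%:E) `^ (2^-1))%E.
Definition Linfnorm m (w : R -> 'cV[R]_m) : \bar R :=
  ereal_inf [set M : \bar R |
     \forall t \ae mu, (0 <= t)%R -> ((vnorminf (w t))%:E <= M)%E].

Definition mx_integral m n (h : R) (A : R -> 'M[R]_(m, n)) : 'M[R]_(m, n) :=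
  \matrix_(k, j) (\int[mu]_(s in `[- h, 0]) A s k j).

Definition entrywise_integrable m n (h : R) (A : R -> 'M[R]_(m, n)) : Prop :=
  forall k j, mu.-integrable `[- h, 0] (fun s => (A s k j)%:E).

Definition entrywise_nonneg_on m n (h : R) (A : R -> 'M[R]_(m, n)) : Prop :=
  forall s, - h <= s <= 0 -> forall k j, 0 <= A s k j.

Definition delay_term m n (h : R) (K : R -> 'M[R]_(m, n))
    (x : R -> 'cV[R]_n) (t : R) : 'cV[R]_m :=
  \col_k (\sum_j \int[mu]_(th in `[- h, 0]) (K th k j * x (t + th) j 0)).

Variables (n ny nu N : nat).

Record system := Sys {
  sA0 : 'M[R]_n;
  sA  : 'I_N -> R -> 'M[R]_n;
  sC0 : 'M[R]_(ny, n);
  sC  : 'I_N -> R -> 'M[R]_(ny, n);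
  sEu : 'M[R]_(n, nu);
  sFu : 'M[R]_(ny, nu);
  sh  : 'I_N -> R }.

Variable S : system.

Definition hmax : R := \big[Num.max/0]_(i < N) sh S i.

Definition state_rhs (x : R -> 'cV[R]_n) (u : R -> 'cV[R]_nu) (t : R)
  : 'cV[R]_n :=
  sA0 S *m x t + \sum_(i < N) delay_term (sh S i) (sA S i) x t + sEu S *m u t.

Definition output (x : R -> 'cV[R]_n) (u : R -> 'cV[R]_nu) (t : R)
  : 'cV[R]_ny :=
  sC0 S *m x t + \sum_(i < N) delay_term (sh S i) (sC S i) x t + sFu S *m u t.

Definition init_ok (phi : R -> 'cV[R]_n) : Prop :=
  forall k, {within `[- hmax, 0], continuous (fun t => phi t k 0)}.

Definition solution (phi : R -> 'cV[R]_n) (u : R -> 'cV[R]_nu)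
    (x : R -> 'cV[R]_n) : Prop :=
  [/\ forall t, - hmax <= t <= 0 -> x t = phi t,
      forall k, {within Rplus_set, continuous (fun t => x t k 0)} &
      forall t, 0 <= t ->
        x t = x 0 + \col_k (\int[mu]_(s in `[0, t]) (state_rhs x u s k 0))].

Definition asymp_stable : Prop :=
  (forall eps : R, 0 < eps -> exists2 delta : R, 0 < delta &
     forall phi x, init_ok phi ->
       (forall t, - hmax <= t <= 0 -> vnorminf (phi t) < delta) ->
       solution phi (fun _ => 0) x ->
       forall t, 0 <= t -> vnorminf (x t) < eps) /\
  (forall phi x, init_ok phi -> solution phi (fun _ => 0) x ->
     forall eps : R, 0 < eps -> exists T : R,
       forall t, T <= t -> vnorminf (x t) < eps).

Definition input_ok (Np : (R -> 'cV[R]_nu) -> \bar R) (u : R -> 'cV[R]_nu)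
  : Prop :=
  (forall k, measurable_fun Rplus_set (fun t => u t k 0)) /\
  (Np u < +oo)%E.

Definition gain_lt (Nin : (R -> 'cV[R]_nu) -> \bar R)
    (Nout : (R -> 'cV[R]_ny) -> \bar R) (gamma : R) : Prop :=
  exists2 g : R, g < gamma &
    forall u x, input_ok Nin u -> solution (fun _ => 0) u x ->
      (Nout (output x u) <= g%:E * Nin u)%E.

Definition Abar (i : 'I_N) : 'M[R]_n := mx_integral (sh S i) (sA S i).
Definition Cbar (i : 'I_N) : 'M[R]_(ny, n) := mx_integral (sh S i) (sC S i).

Definition Mbig : 'M[R]_(n + ny, n + nu) :=
  block_mx (sA0 S + \sum_(i < N) Abar i) (sEu S)
           (sC0 S + \sum_(i < N) Cbar i) (sFu S).

Definition L1_cond (lambda : 'cV[R]_n) (g : R) : Prop :=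
  forall j, ((col_mx lambda (const_mx 1 : 'cV[R]_ny))^T *m Mbig) 0 j
            < (row_mx (0 : 'rV[R]_n) (const_mx g : 'rV[R]_nu)) 0 j.

Definition Linf_cond (lambda : 'cV[R]_n) (g : R) : Prop :=
  forall k, (Mbig *m col_mx lambda (const_mx 1 : 'cV[R]_nu)) k 0
            < (col_mx (0 : 'cV[R]_n) (const_mx g : 'cV[R]_ny)) k 0.

Definition L2_mx (P : 'M[R]_n) (Q : 'I_N -> 'M[R]_n)
    (Rm : 'I_N -> 'M[R]_ny) (g : R) :
    'M[R]_(n + (\sum_(i < N) n + (\sum_(i < N) ny + (nu + ny)))) :=
  let M11 := (sA0 S)^T *m P + P *m sA0 S
             + \sum_(i < N) ((Abar i)^T *m Q i *m Abar i)
             + \sum_(i < N) ((Cbar i)^T *m Rm i *m Cbar i) in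
  let PP : 'M[R]_(n, \sum_(i < N) n) := \mxrow_(i < N) P in
  let DQ : 'M[R]_(\sum_(i < N) n) := \mxdiag_(i < N) Q i in
  let DR : 'M[R]_(\sum_(i < N) ny) := \mxdiag_(i < N) Rm i in
  let IC : 'M[R]_(\sum_(i < N) ny, ny) := \mxcol_(i < N) (1%:M : 'M[R]_ny) in
  let PE := P *m sEu S in
  col_mx
    (row_mx M11 (row_mx PP (row_mx 0 (row_mx PE (sC0 S)^T))))
  (col_mx
    (row_mx PP^T (row_mx (- DQ) (row_mx 0 (row_mx 0 0))))
  (col_mx
    (row_mx 0 (row_mx 0 (row_mx (- DR) (row_mx 0 IC))))
  (col_mx
    (row_mx PE^T (row_mx 0 (row_mx 0 (row_mx (- (g%:M)) (sFu S)^T))))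
    (row_mx (sC0 S) (row_mx 0 (row_mx IC^T (row_mx (sFu S) (- (g%:M))))))))).

End Defs.

(* Main.v *)
(* A positive system is governed by its static part.  Put M = A0 + sum Abar_i,
   G = C0 + sum Cbar_i and H = F - G M^-1 E.  Exchanging the time and delay
   integrals turns the state equation, integrated over [0, T], into an inequality
   for the Metzler matrix M.  This shows that the system is asymptotically stable
   iff M lam < 0 for some lam > 0, that int_0^T y <= H int_0^T u for u >= 0, and
   that y <= H w whenever 0 <= u <= w; constant inputs switched off at T show that
   these bounds are sharp as T grows.  Signed inputs are dominated by |u|, so the
   L_1- and L_oo-gains are the maximal column and row sums of H.  For L_2, let
   u0, y0 > 0 satisfy H u0 <= g y0 and H^T y0 <= g u0 (a Perron pair).
   Cauchy-Schwarz for the positive map u |-> y, applied to u = (u / sqrt u0) *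
   sqrt u0, bounds y^2 by the response to u^2 / u0 times the response to u0, and
   the L_1 and L_oo bounds give the gain g.  All conditions in the statement are
   thus conditions on (M, E, G, F), related by the theory of Metzler matrices: a
   symmetric Metzler matrix is negative definite iff it maps some positive vector
   to a negative one. *)

Require Import Defs.
From HB Require Import structures.
From mathcomp Require Import all_boot all_order all_algebra.
From mathcomp Require Import all_classical all_reals all_analysis measurable_realfun.
From mathcomp Require Import ring lra.
Import Order.TTheory GRing.Theory Num.Theory.
Import numFieldNormedType.Exports.
Set Implicit Arguments.
Unset Strict Implicit.
Unset Printing Implicit Defensive.
Local Open Scope classical_set_scope.
Local Open Scope ring_scope.

(** * Integrals over delay intervals *)

(** All arguments stay in the time domain: integrals over [0, T] and comparison of trajectories take
    the place of transfer functions. The obstacle is that a delay moves part of the window [0, T]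
    into the past, so the integrated equation only gives inequalities, and in the lower bounds a
    boundary error remains. This error is bounded independently of T, hence negligible after
    division by T. Comparison also presupposes that the trajectories exist: |u|, u^2 / u0 and the
    pulses need responses, whence the Picard iteration. The input enters the state equation only
    through its primitive. A constant or a decaying exponential is thus a trajectory for a suitable
    forcing, and if that forcing is monotone it can be used as a supersolution. The Perron pair is
    obtained as a positive solution of strict inequalities, not as a pair of eigenvectors, so that a
    reducible H is covered as well. *)

Section IntervalIntegral.
Variable R : realType.
Local Notation mu := (@lebesgue_measure R).
Implicit Types (a b c : R) (f g : R -> R).

Definition intble a b f := mu.-integrable `[a, b] (EFin \o f).
(** For [b < a] the interval is empty and the value is 0, not minus the integral over [b, a]. *)
Definition integ a b f : R := \int[mu]_(s in `[a, b]) f s.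

Lemma eq_intble a b f g : (forall s, a <= s <= b -> f s = g s) ->
  intble a b f -> intble a b g.
Proof.
move=> fg; apply: eq_integrable => //= s /set_mem /=.
by rewrite in_itv /= => /fg ->.
Qed.

Lemma eq_integ a b f g : (forall s, a <= s <= b -> f s = g s) ->
  integ a b f = integ a b g.
Proof.
move=> fg; apply: eq_Rintegral => s /set_mem /=.
by rewrite in_itv /= => /fg ->.
Qed.

Lemma intbleD a b f g : intble a b f -> intble a b g ->
  intble a b (fun s => f s + g s).
Proof. by move=> fi gi; apply: (integrableD _ fi gi). Qed.

Lemma intbleZ a b k f : intble a b f -> intble a b (fun s => k * f s).
Proof. by move=> fi; apply: (integrableZl _ k fi). Qed.

Lemma intbleB a b f g : intble a b f -> intble a b g ->
  intble a b (fun s => f s - g s).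
Proof. by move=> fi gi; apply: (integrableB _ fi gi). Qed.

Lemma intble_norm a b f : intble a b f -> intble a b (fun s => `|f s|).
Proof. exact: integrable_norm. Qed.

Lemma intble_cst a b k : intble a b (fun=> k).
Proof.
apply: measurable_bounded_integrable => //=.
  by rewrite lebesgue_measure_itv /=; case: ifP => // _; rewrite -EFinB ltry.
exists `|k|; split; first exact: num_real.
by move=> x kx s _; exact: ltW.
Qed.

Lemma intble_sum a b (I : Type) (r : seq I) (F : I -> R -> R) :
  (forall i, intble a b (F i)) -> intble a b (fun s => \sum_(i <- r) F i s).
Proof.
move=> Fi; elim: r => [|i r IH].
  by apply: (@eq_intble _ _ (fun=> 0)) => [s _|]; rewrite ?big_nil //; exact: intble_cst.
apply: (@eq_intble _ _ (fun s => F i s + \sum_(i <- r) F i s)) => [s _|].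
  by rewrite big_cons.
exact: intbleD.
Qed.

Lemma integD a b f g : intble a b f -> intble a b g ->
  integ a b (fun s => f s + g s) = integ a b f + integ a b g.
Proof. exact: RintegralD. Qed.

Lemma integB a b f g : intble a b f -> intble a b g ->
  integ a b (fun s => f s - g s) = integ a b f - integ a b g.
Proof. exact: RintegralB. Qed.

Lemma integZ a b k f : intble a b f ->
  integ a b (fun s => k * f s) = k * integ a b f.
Proof. exact: RintegralZl. Qed.

Lemma integ_cst a b k : a <= b -> integ a b (fun=> k) = k * (b - a).
Proof.
move=> ab; rewrite /integ Rintegral_cst //= lebesgue_measure_itv /= lte_fin.
case: ltgtP ab => //= -> _; by rewrite subrr.
Qed.

Lemma integ0 a b : integ a b (fun=> 0) = 0.
Proof. by rewrite /integ Rintegral_cst // mul0r. Qed.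

Lemma integ_sum a b (I : Type) (r : seq I) (F : I -> R -> R) :
  (forall i, intble a b (F i)) ->
  integ a b (fun s => \sum_(i <- r) F i s) = \sum_(i <- r) integ a b (F i).
Proof.
move=> Fi; elim: r => [|i r IH].
  rewrite big_nil -[RHS](integ0 a b).
  by apply: eq_integ => s _; rewrite big_nil.
rewrite big_cons -IH -integD //; last exact: intble_sum.
by apply: eq_integ => s _; rewrite big_cons.
Qed.

Lemma le_integ a b f g : intble a b f -> intble a b g ->
  (forall s, a <= s <= b -> f s <= g s) -> integ a b f <= integ a b g.
Proof.
move=> fi gi fg; by apply: le_Rintegral => // s /=; rewrite in_itv /=; apply: fg.
Qed.

Lemma integ_ge0 a b f : (forall s, a <= s <= b -> 0 <= f s) -> 0 <= integ a b f.
Proof.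
by move=> f0; apply: Rintegral_ge0 => s /=; rewrite in_itv /= => /f0.
Qed.

Lemma integ_norm a b f : intble a b f ->
  `|integ a b f| <= integ a b (fun s => `|f s|).
Proof. exact: le_normr_Rintegral. Qed.

Lemma intble_sub a b c d f : c <= a -> b <= d -> intble c d f -> intble a b f.
Proof.
move=> ca bd; apply: integrableS => //.
by apply: subset_itv; rewrite bnd_simp.
Qed.

Lemma integ_cat a b c f : a <= b -> b <= c -> intble a c f ->
  integ a c f = integ a b f + integ b c f.
Proof.
move=> ab bc fi.
have := @Rintegral_itvB R f (BLeft a) (BRight c) b fi.
rewrite !bnd_simp => /(_ ab bc).
rewrite Rintegral_itv_obnd_cbnd; last first.
  by apply: integrableS fi => //; apply: subset_itv; rewrite bnd_simp.
by move=> /eqP; rewrite subr_eq addrC => /eqP.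
Qed.

Lemma integ_pt a f : integ a a f = 0.
Proof. by rewrite /integ set_itv1 Rintegral_set1. Qed.

Lemma intble_continuous a b f : {within `[a, b], continuous f} -> intble a b f.
Proof.
by move=> cf; apply: continuous_compact_integrable => //; exact: segment_compact.
Qed.

Lemma continuous_integ a b f : a <= b -> intble a b f ->
  {within `[a, b], continuous (fun t => integ a t f)}.
Proof. exact: parameterized_integral_continuous. Qed.

Lemma intble_measurable a b f : intble a b f -> measurable_fun `[a, b] f.
Proof. by move=> /measurable_int /measurable_EFinP. Qed.

Lemma le_intble a b f g : measurable_fun `[a, b] f ->
  (forall s, a <= s <= b -> `|f s| <= g s) -> intble a b g -> intble a b f.
Proof.
move=> mf fg; apply: le_integrable => //; first exact/measurable_EFinP.
move=> s /=; rewrite in_itv /= => sab; rewrite lee_fin.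
apply: (le_trans (fg _ sab)); exact: ler_norm.
Qed.

Lemma continuous_bounded a b f : {within `[a, b], continuous f} ->
  exists B, forall s, a <= s <= b -> `|f s| <= B.
Proof.
move=> cf; have /compact_bounded[M [_ Mf]] :=
  continuous_compact cf (@segment_compact R a b).
exists (`|M| + 1) => s sab; apply: (Mf (`|M| + 1)).
  by rewrite ltr_pwDr // ler_norm.
by exists s => //=; rewrite in_itv.
Qed.

(** The substitution theorem is applied to a continuous integrand; this is one reason why responses
    are later required to be continuous on their past too. *)
Lemma integ_shift a b k f : a <= b -> {within `[a + k, b + k], continuous f} ->
  integ a b (fun s => f (s + k)) = integ (a + k) (b + k) f.
Proof.
move=> ab cf; rewrite /integ /Rintegral; congr fine.
have dE : (shift k : R -> R)^`()%classic = cst 1.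
  by apply/funext => x; rewrite derive1E (@derive_val _ _ _ _ _ _ _ (is_derive_shift x 1 k)).
transitivity (\int[mu]_(s in `[a, b]) (((f \o shift k) * (shift k : R -> R)^`()%classic) s)%:E)%E.
  by apply: eq_integral => s _; rewrite dE /= mulr1.
apply/esym; apply: (@integration_by_substitution_increasing R (shift k) f a b) => //.
- by move=> x y _ _ /=; rewrite ltrD2r.
- by rewrite dE => x _; exact: cst_continuous.
- by rewrite dE; exact: is_cvg_cst.
- by rewrite dE; exact: is_cvg_cst.
- split => [x _| |].
  + exact: (@ex_derive _ _ _ _ _ _ _ (is_derive_shift x 1 k)).
  + apply: cvg_at_right_filter; apply: cvgD; [exact: cvg_id|exact: cvg_cst].
  + apply: cvg_at_left_filter; apply: cvgD; [exact: cvg_id|exact: cvg_cst].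
Qed.

Lemma intbleE a b f : intble a b f <-> mu.-integrable setT (EFin \o (f \_ `[a, b])).
Proof.
rewrite /intble integrable_mkcond //.
by rewrite restrict_EFin.
Qed.

Lemma intbleMb a b f g B : intble a b f -> measurable_fun `[a, b] g ->
  (forall s, a <= s <= b -> `|g s| <= B) -> intble a b (fun s => f s * g s).
Proof.
move=> fi mg gB.
apply: (@le_intble _ _ _ (fun s => B * `|f s|)) => [|s sab|].
- by apply: measurable_funM => //; exact: intble_measurable.
- by rewrite normrM mulrC ler_wpM2r // gB.
- exact/intbleZ/intble_norm.
Qed.

Lemma measurable_shift a b c d k f : measurable_fun `[a, b] f ->
  a <= c + k -> d + k <= b -> measurable_fun `[c, d] (fun s => f (s + k)).
Proof.
move=> mf ac db; apply: (measurable_comp _ _ mf) => //.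
- move=> _ /= [s + <-]; rewrite !in_itv /= => /andP[cs sd]; lra.
- by apply: measurable_funD => //.
Qed.

Lemma delay_intble h T (K x : R -> R) B s : intble (- h) 0 K ->
  measurable_fun `[- h, T] x -> (forall t, - h <= t <= T -> `|x t| <= B) ->
  0 <= s <= T -> intble (- h) 0 (fun th => K th * x (s + th)).
Proof.
move=> Ki mx xB sT; apply: (@intbleMb _ _ _ _ B) => //.
- under [X in measurable_fun _ X]funext do rewrite addrC.
  by apply: (measurable_shift mx); lra.
- by move=> th hth; apply: xB; lra.
Qed.

(** * Exchange of the time and delay integrals *)

Section DelayFubini.
Variables (h T : R) (K x : R -> R) (B : R).
Hypotheses (h0 : 0 <= h) (T0 : 0 <= T) (Ki : intble (- h) 0 K).
Hypotheses (mx : measurable_fun `[- h, T] x).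
Hypothesis xB : forall t, - h <= t <= T -> `|x t| <= B.

(** Extension by zero makes [F] a single function on the plane, to which Fubini applies. Truncating
    [x] is harmless: s in [0, T] and th in [- h, 0] force s + th into [- h, T]. *)
Let K' : R -> R := K \_ `[- h, 0].
Let x' : R -> R := x \_ `[- h, T].
Let c : R -> R := \1_(`[0, T]).
Let F (z : R * R) : \bar R := (c z.1 * (K' z.2 * x' (z.1 + z.2)))%:E.

Let B0 : 0 <= B.
Proof. by apply: le_trans (normr_ge0 (x 0)) _; apply: xB; rewrite oppr_le0 h0 T0. Qed.

Let mK' : measurable_fun setT K'.
Proof. by apply/(measurable_restrictT _ _).1 => //; exact: intble_measurable. Qed.

Let mx' : measurable_fun setT x'.
Proof. by apply/(measurable_restrictT _ _).1. Qed.

Let mF : measurable_fun setT F.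
Proof.
apply/measurable_EFinP; apply: measurable_funM.
  by apply: measurableT_comp => //; exact: measurable_indic.
apply: measurable_funM; first exact: measurableT_comp.
by apply: (measurableT_comp mx'); exact: measurable_funD.
Qed.

Let x'B s : `|x' s| <= B.
Proof.
rewrite /x' patchE; case: ifPn => [/set_mem /=|_]; last by rewrite normr0.
by rewrite in_itv /=; exact: xB.
Qed.

Let K'i : mu.-integrable setT (EFin \o K').
Proof. exact/intbleE. Qed.

Let FE1 s : (\int[mu]_th F (s, th) = (c s * integ (- h) 0 (fun th => K th * x (s + th)))%:E)%E.
Proof.
rewrite /F /=; have [sT|sT] := boolP (s \in (`[0, T]%classic : set R)); last first.
  rewrite /c indicE (negbTE sT) mul0r.
  under eq_integral do rewrite mul0r.
  by rewrite integral0.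
rewrite /c indicE sT mul1r.
have {}sT : 0 <= s <= T by move: sT => /set_mem /=; rewrite in_itv.
under eq_integral do rewrite mul1r.
rewrite /integ /Rintegral fineK; last first.
  by apply: integrable_fin_num => //; exact: (delay_intble Ki mx xB sT).
rewrite [RHS]integral_mkcond; apply: eq_integral => th _.
rewrite /K' /x' !patchE; case: ifPn => [/set_mem /=|_]; last by rewrite mul0r.
rewrite in_itv /= => hth.
by rewrite mem_set //= in_itv /=; lra.
Qed.

Let FE2 th : (\int[mu]_s F (s, th) = (K' th * integ 0 T (fun s => x (s + th)))%:E)%E.
Proof.
rewrite /F /=; have [hth|hth] := boolP (th \in (`[- h, 0]%classic : set R)); last first.
  rewrite /K' patchE (negbTE hth) mul0r.
  under eq_integral do rewrite mul0r mulr0.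
  by rewrite integral0.
rewrite /K' patchE hth.
have {}hth : - h <= th <= 0 by move: hth => /set_mem /=; rewrite in_itv.
have ix : intble 0 T (fun s => x (s + th)).
  apply: (@le_intble _ _ _ (fun=> B)); last exact: intble_cst.
  - by apply: (measurable_shift mx); lra.
  - by move=> s sT; apply: xB; lra.
rewrite EFinM /integ /Rintegral fineK; last exact: integrable_fin_num.
rewrite -integralZl //.
rewrite [RHS]integral_mkcond; apply: eq_integral => s _.
rewrite /c indicE [in RHS]patchE; case: ifPn => [/set_mem /=|_]; last by rewrite mul0r.
rewrite in_itv /= => sT; rewrite mul1r /x' patchE mem_set //= in_itv /=; lra.
Qed.

(** Tonelli: with [C] the L_1 norm of the kernel, the inner integral of |F| is at most
    [B * C * c s], which is integrable because [c] is the indicator of a bounded interval. *)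
Let iF : (mu \x mu)%E.-integrable setT F.
Proof.
apply/integrable12ltyP => //.
have iK' : mu.-integrable setT (fun th => `|K' th|%:E).
  exact: (integrable_norm K'i).
pose C : R := fine (\int[mu]_th `|K' th|%:E)%E.
apply: (@le_lt_trans _ _ (\int[mu]_s ((B * C * c s)%:E))%E).
  apply: ge0_le_integral => //=.
  - by move=> s _; exact: integral_ge0.
  - apply: (@measurable_fun_fubini_tonelli_F _ _ _ _ R mu (abse \o F)) => //=.
    exact: measurableT_comp.
  - apply/measurable_EFinP; apply: measurable_funM => //; exact: measurable_indic.
  move=> s _; rewrite mulrAC EFinM /C fineK; last exact: integrable_fin_num.
  rewrite -integralZl //; apply: ge0_le_integral => //=.
  - apply/measurable_EFinP; apply: measurableT_comp => //.
    apply: measurable_funM => //; apply: measurable_funM => //.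
    by apply: (measurableT_comp mx'); exact: measurable_funD.
  - apply/measurable_EFinP; apply: measurable_funM => //.
    exact: measurableT_comp.
  move=> th _; rewrite lee_fin !normrM [`|c s|]ger0_norm; last by rewrite /c indicE.
  rewrite [B * c s]mulrC -mulrA; apply: ler_wpM2l; first by rewrite /c indicE.
  by rewrite mulrC ler_wpM2r.
have -> : (\int[mu]_s ((B * C * c s)%:E) = (B * C)%:E * \int[mu]_s (c s)%:E)%E.
  rewrite -integralZl //; exact: integrable_indic_itv.
rewrite -[X in (_ * X)%E]fineK -?EFinM ?ltry //.
by apply: integrable_fin_num => //; exact: integrable_indic_itv.
Qed.

Lemma delay_fubini :
  [/\ intble 0 T (fun s => integ (- h) 0 (fun th => K th * x (s + th))),
   intble (- h) 0 (fun th => K th * integ 0 T (fun s => x (s + th))) &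
   integ 0 T (fun s => integ (- h) 0 (fun th => K th * x (s + th))) =
   integ (- h) 0 (fun th => K th * integ 0 T (fun s => x (s + th)))].
Proof.
have i1 : intble 0 T (fun s => integ (- h) 0 (fun th => K th * x (s + th))).
  apply/intbleE; apply: eq_integrable (integrable_fubini_F iF) => // s _.
  rewrite /fubini_F FE1 /= /c indicE patchE.
  by case: ifP; rewrite ?mul1r ?mul0r.
have i2 : intble (- h) 0 (fun th => K th * integ 0 T (fun s => x (s + th))).
  apply: (@le_intble _ _ _ (fun th => (B * T) * `|K th|)).
  - apply/(measurable_restrictT _ _).2 => //; apply/measurable_EFinP.
    apply: eq_measurable_fun (measurable_fubini_G iF) => th _.
    rewrite /fubini_G FE2 /= /K' !patchE.
    by case: ifP; rewrite ?mul0r.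
  - move=> th hth; rewrite normrM mulrC ler_wpM2r //.
    have ix : intble 0 T (fun s => x (s + th)).
      apply: (@le_intble _ _ _ (fun=> B)); last exact: intble_cst.
      + by apply: (measurable_shift mx); lra.
      + by move=> s sT; apply: xB; lra.
    apply: le_trans (integ_norm ix) _.
    rewrite -[X in B * X]subr0 -integ_cst //; apply: le_integ.
    + exact: intble_norm.
    + exact: intble_cst.
    + by move=> s sT; apply: xB; lra.
  - exact/intbleZ/intble_norm.
split => //.
have := Fubini iF.
under eq_integral do rewrite FE1.
under [X in _ = X -> _]eq_integral do rewrite FE2.
rewrite /integ /Rintegral => E.
rewrite integral_mkcond [in RHS]integral_mkcond; congr fine.
transitivity (\int[mu]_s (c s * fine (\int[mu]_(th in `[(- h), 0]) (K th * x (s + th))%:E))%:E)%E.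
  apply: eq_integral => s _; rewrite patchE /c indicE.
  by case: ifP; rewrite ?mul1r ?mul0r.
rewrite E; apply: eq_integral => th _; rewrite /K' !patchE.
by case: ifP; rewrite ?mul0r.
Qed.

End DelayFubini.

End IntervalIntegral.

(** * Continuity on the half-line and integrals of exponentials *)

Section ContinuousFunctions.
Variable R : realType.

Lemma within_continuousP (D : set R) (f : R -> R) : {within D, continuous f} ->
  forall t, D t -> forall eps, 0 < eps -> exists2 delta, 0 < delta &
  forall s, D s -> `|s - t| < delta -> `|f s - f t| < eps.
Proof.
move=> /subspace_continuousP cf t Dt eps eps0.
have /cvgrPdist_lt /(_ _ eps0) := cf t Dt.
rewrite near_withinE => -[d /= d0 df].
exists d => // s Ds st; rewrite distrC; apply: df => //=.
by rewrite distrC.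
Qed.

Lemma within_continuous_eps (D : set R) (f : R -> R) :
  (forall t, D t -> forall eps, 0 < eps -> exists2 delta, 0 < delta &
  forall s, D s -> `|s - t| < delta -> `|f s - f t| < eps) ->
  {within D, continuous f}.
Proof.
move=> cf; apply/subspace_continuousP => t Dt; apply/cvgrPdist_lt => eps eps0.
have [d d0 df] := cf t Dt eps eps0; rewrite near_withinE; exists d => //= s.
move=> st Ds; rewrite /from_subspace distrC; apply: df => //.
by rewrite distrC.
Qed.

Lemma within_continuousy (f : R -> R) :
  (forall T, 0 <= T -> {within `[0, T], continuous f}) ->
  {within `[0, +oo[, continuous f}.
Proof.
move=> cf; apply: within_continuous_eps => t /=; rewrite in_itv /= andbT => t0 eps eps0.
have T0 : 0 <= t + 1 by lra.
have tin : (`[0, t + 1]%classic : set R) t by rewrite /= in_itv /= t0; lra.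
have [d d0 df] := within_continuousP (cf _ T0) tin eps0.
exists (Num.min 1 d); first by rewrite lt_min ltr01.
move=> s /=; rewrite in_itv /= andbT lt_min => s0 /andP[s1 sd].
apply: df => //=; rewrite in_itv /= s0 /=; move: s1; rewrite ltr_norml => /andP[_].
lra.
Qed.

Lemma within_continuous_ge0 (t : R) (f : R -> R) : {within `[0, +oo[, continuous f} ->
  0 < t -> (forall s, 0 <= s < t -> 0 <= f s) -> 0 <= f t.
Proof.
move=> cf t0 f0; rewrite leNgt; apply/negP => ft.
have [d d0 df] : exists2 delta, 0 < delta &
    forall s, `[0, +oo[%classic s -> `|s - t| < delta -> `|f s - f t| < - f t.
  by apply: within_continuousP => //=; rewrite ?in_itv /= ?andbT ?oppr_gt0 ?ltW.
pose s := Num.max 0 (t - d / 2).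
have s0 : 0 <= s by rewrite le_max lexx.
have st : s < t by rewrite gt_max t0 /=; lra.
have := df s; rewrite /= in_itv /= andbT s0 => /(_ erefl).
have sd : `|s - t| < d.
  rewrite ltr0_norm ?subr_lt0 // opprB ltrBlDl -ltrBlDr.
  by rewrite lt_max; apply/orP; right; lra.
move=> /(_ sd); rewrite ltr_norml => /andP[_].
by have := f0 s; rewrite s0 st => /(_ erefl); lra.
Qed.

(** The factor [c] stays under the integral, so that [c = 0] is included and nothing is divided. *)
Lemma exp_integ (c a b : R) : a <= b ->
  integ a b (fun s => c * expR (c * s)) = expR (c * b) - expR (c * a).
Proof.
rewrite le_eqVlt => /predU1P[->|ab]; first by rewrite integ_pt subrr.
have dexp (s : R) : is_derive s (1 : R) (expR \o (c *: id)) (expR (c * s) * c).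
  apply: is_derive1_comp; rewrite -[X in is_derive _ _ _ X]mulr1.
  exact: is_deriveZ.
have cexp : continuous (expR \o (c *: id) : R -> R).
  by move=> s; apply/differentiable_continuous/derivable1_diffP; case: (dexp s).
rewrite /integ /Rintegral (@continuous_FTC2 _ _ (expR \o (c *: id))) //.
- apply: continuous_subspaceT => s; apply: cvgM; first exact: cvg_cst.
  exact: cexp.
- split=> [s _| |].
  + by case: (dexp s).
  + exact/cvg_at_right_filter/cexp.
  + exact/cvg_at_left_filter/cexp.
- by move=> s _; rewrite derive1E (@derive_val _ _ _ _ _ _ _ (dexp s)) mulrC.
Qed.

End ContinuousFunctions.

(** * Trajectories of the delay equation *)

Section DelayOperator.
Variables (R : realType) (N : nat) (h : 'I_N -> R).
Local Notation mu := (@lebesgue_measure R).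
Hypothesis h_gt0 : forall i, 0 < h i.
Let H : R := \big[Num.max/0]_i h i.

Lemma delay_le_max i : h i <= H.
Proof. by rewrite /H; apply: le_bigmax_cond. Qed.

Lemma max_delay_ge0 : 0 <= H.
Proof. by rewrite /H; apply: bigmax_ge_id. Qed.

Definition kernel_intble m n (B : 'I_N -> R -> 'M[R]_(m, n)) :=
  forall i k j, intble (- h i) 0 (fun s => B i s k j).

Definition kernel_ge0 m n (B : 'I_N -> R -> 'M[R]_(m, n)) :=
  forall i s, - h i <= s <= 0 -> forall k j, 0 <= B i s k j.

(** One operator for both equations: the state right-hand side and the output are instances of it
    plus a direct input term. *)
Definition lin m n (B0 : 'M[R]_(m, n)) (B : 'I_N -> R -> 'M[R]_(m, n))
    (x : R -> 'I_n -> R) (t : R) (k : 'I_m) : R :=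
  \sum_j B0 k j * x t j +
  \sum_i \sum_j integ (- h i) 0 (fun th => B i th k j * x (t + th) j).

(** Enough for the delay integrals and Fubini, and stable under the limit of the Picard iterates,
    whose continuity is only deduced afterwards from the integral equation. *)
Definition tame n (x : R -> 'I_n -> R) := forall T j,
  measurable_fun `[- H, T] (x^~ j) /\
  exists B, forall s, - H <= s <= T -> `|x s j| <= B.

Lemma tame_intble n (x : R -> 'I_n -> R) a b j : tame x -> - H <= a ->
  intble a b (x^~ j).
Proof.
move=> tx Ha; have [mx [B xB]] := tx b j.
apply: (intble_sub (c := - H) (d := b)) => //.
by apply: (@le_intble _ _ _ _ (fun=> B)) => //; exact: intble_cst.
Qed.

Lemma tameD n (x y : R -> 'I_n -> R) : tame x -> tame y ->
  tame (fun s j => x s j + y s j).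
Proof.
move=> tx ty T j; have [mx [B xB]] := tx T j; have [my [C yC]] := ty T j.
split; first exact: measurable_funD.
exists (B + C) => s sT; apply: le_trans (ler_normD _ _) _.
by apply: lerD; [exact: xB|exact: yC].
Qed.

Lemma tameZ n c (x : R -> 'I_n -> R) : tame x -> tame (fun s j => c * x s j).
Proof.
move=> tx T j; have [mx [B xB]] := tx T j; split.
  by apply: measurable_funM.
exists (`|c| * B) => s sT; rewrite normrM ler_wpM2l //; exact: xB.
Qed.

Lemma tame_measurable n (x : R -> 'I_n -> R) i t j : tame x ->
  measurable_fun `[- h i, t] (x^~ j).
Proof.
move=> tx; have [mx _] := tx t j; apply: measurable_funS mx => //.
by apply: subset_itv; rewrite bnd_simp // lerN2 delay_le_max.
Qed.

Section Kernel.
Variables (m n : nat) (B0 : 'M[R]_(m, n)) (B : 'I_N -> R -> 'M[R]_(m, n)).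
Hypothesis Bi : kernel_intble B.
Implicit Types x y : R -> 'I_n -> R.

Lemma tame_delay_intble x i k j t : tame x -> 0 <= t ->
  intble (- h i) 0 (fun th => B i th k j * x (t + th) j).
Proof.
move=> tx t0; have [_ [C xC]] := tx t j.
apply: (@delay_intble _ _ t _ (x^~ j) C) => //.
- exact: tame_measurable.
- move=> s /andP[hs st]; apply: xC; rewrite st andbT.
  by apply: le_trans hs; rewrite lerN2 delay_le_max.
- by rewrite t0 lexx.
Qed.

Lemma tame_delay_fubini x i k j T : tame x -> 0 <= T ->
  [/\ intble 0 T (fun s => integ (- h i) 0 (fun th => B i th k j * x (s + th) j)),
   intble (- h i) 0 (fun th => B i th k j * integ 0 T (fun s => x (s + th) j)) &
   integ 0 T (fun s => integ (- h i) 0 (fun th => B i th k j * x (s + th) j)) =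
   integ (- h i) 0 (fun th => B i th k j * integ 0 T (fun s => x (s + th) j))].
Proof.
move=> tx T0; have [_ [C xC]] := tx T j.
apply: (@delay_fubini _ _ _ _ (x^~ j) C) => //.
- exact: ltW.
- exact: tame_measurable.
- move=> s /andP[hs st]; apply: xC; rewrite st andbT.
  by apply: le_trans hs; rewrite lerN2 delay_le_max.
Qed.

Lemma lin_intble x k T : tame x -> 0 <= T -> intble 0 T (fun s => lin B0 B x s k).
Proof.
move=> tx T0; apply: intbleD.
  apply: intble_sum => j; apply: intbleZ; apply: tame_intble => //.
  by rewrite oppr_le0 max_delay_ge0.
by apply: intble_sum => i; apply: intble_sum => j; have [] := tame_delay_fubini i k j tx T0.
Qed.

Lemma lin_integ x k T : tame x -> 0 <= T ->
  integ 0 T (fun s => lin B0 B x s k) =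
  \sum_j B0 k j * integ 0 T (x^~ j) +
  \sum_i \sum_j integ (- h i) 0 (fun th => B i th k j * integ 0 T (fun s => x (s + th) j)).
Proof.
move=> tx T0.
have ix j : intble 0 T (x^~ j).
  by apply: tame_intble => //; rewrite oppr_le0 max_delay_ge0.
have id i j := tame_delay_fubini i k j tx T0.
rewrite integD; last 2 first.
- by apply: intble_sum => j; apply: intbleZ.
- by apply: intble_sum => i; apply: intble_sum => j; case: (id i j).
rewrite integ_sum; last by move=> j; apply: intbleZ.
rewrite integ_sum; last by move=> i; apply: intble_sum => j; case: (id i j).
congr (_ + _); first by apply: eq_bigr => j _; rewrite integZ.
apply: eq_bigr => i _; rewrite integ_sum; last by move=> j; case: (id i j).
by apply: eq_bigr => j _; case: (id i j).
Qed.

Lemma linD x y t k : tame x -> tame y -> 0 <= t ->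
  lin B0 B (fun s j => x s j + y s j) t k = lin B0 B x t k + lin B0 B y t k.
Proof.
move=> tx ty t0; rewrite /lin addrACA; congr (_ + _).
  by rewrite -big_split /=; apply: eq_bigr => j _; rewrite mulrDr.
rewrite -big_split /=; apply: eq_bigr => i _; rewrite -big_split /=; apply: eq_bigr => j _.
rewrite -integD; [|exact: tame_delay_intble|exact: tame_delay_intble].
by apply: eq_integ => th _; rewrite mulrDr.
Qed.

Lemma linZ c x t k : tame x -> 0 <= t ->
  lin B0 B (fun s j => c * x s j) t k = c * lin B0 B x t k.
Proof.
move=> tx t0; rewrite /lin mulrDr; congr (_ + _).
  by rewrite mulr_sumr; apply: eq_bigr => j _; rewrite mulrCA.
rewrite mulr_sumr; apply: eq_bigr => i _; rewrite mulr_sumr; apply: eq_bigr => j _.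
rewrite -integZ; last exact: tame_delay_intble.
by apply: eq_integ => th _; rewrite mulrCA.
Qed.

Lemma eq_lin x y t k : (forall s j, - H <= s <= t -> x s j = y s j) -> 0 <= t ->
  lin B0 B x t k = lin B0 B y t k.
Proof.
move=> xy t0; have H0 := max_delay_ge0; congr (_ + _).
  by apply: eq_bigr => j _; rewrite xy // lexx andbT; lra.
apply: eq_bigr => i _; apply: eq_bigr => j _; apply: eq_integ => th hth.
by have hi := delay_le_max i; rewrite xy //; lra.
Qed.

(** A Lipschitz constant of [lin] for the sup norm over the past; summing over the rows gives one
    constant that serves every row. *)
Definition lin_bound : R := \sum_k (\sum_j `|B0 k j| +
  \sum_i \sum_j integ (- h i) 0 (fun th => `|B i th k j|)).

Lemma lin_bound_ge0 : 0 <= lin_bound.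
Proof.
apply: sumr_ge0 => k _; apply: addr_ge0; apply: sumr_ge0 => // i _.
by apply: sumr_ge0 => j _; apply: integ_ge0.
Qed.

Lemma lin_norm x t k rho : tame x -> 0 <= t ->
  (forall s j, - H <= s <= t -> `|x s j| <= rho) ->
  `|lin B0 B x t k| <= lin_bound * rho.
Proof.
move=> tx t0 xr; have H0 := max_delay_ge0.
(* For [n = 0] the bound on [x] is vacuous and [rho] may be negative; the claim then holds because
   [lin_bound] vanishes. *)
have [n0|[j0]] : ('I_n -> False) \/ inhabited 'I_n.
  by case: (pselect (inhabited 'I_n)) => [|P]; [right|left => j; apply: P].
  rewrite /lin big1; last by move=> j; case: (n0 j).
  rewrite add0r big1 => [|i _]; last by rewrite big1 // => j; case: (n0 j).
  rewrite normr0 (_ : lin_bound = 0) ?mul0r //.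
  rewrite /lin_bound big1 // => k' _; rewrite big1; last by move=> j; case: (n0 j).
  by rewrite add0r big1 // => i _; rewrite big1 // => j; case: (n0 j).
have rho0 : 0 <= rho.
  by apply: le_trans (normr_ge0 (x 0 j0)) _; apply: xr; rewrite oppr_le0 H0 t0.
apply: le_trans (_ : (\sum_j `|B0 k j| +
  \sum_i \sum_j integ (- h i) 0 (fun th => `|B i th k j|)) * rho <= _); last first.
  apply: ler_wpM2r => //; rewrite /lin_bound (bigD1 k) //= lerDl.
  apply: sumr_ge0 => k' _; apply: addr_ge0; apply: sumr_ge0 => // i _.
  by apply: sumr_ge0 => j _; apply: integ_ge0.
rewrite mulrDl /lin; apply: le_trans (ler_normD _ _) _; apply: lerD.
  rewrite mulr_suml; apply: le_trans (ler_norm_sum _ _ _) _; apply: ler_sum => j _.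
  by rewrite normrM ler_wpM2l // xr // lexx andbT; lra.
rewrite mulr_suml; apply: le_trans (ler_norm_sum _ _ _) _; apply: ler_sum => i _.
rewrite mulr_suml; apply: le_trans (ler_norm_sum _ _ _) _; apply: ler_sum => j _.
have ii := tame_delay_intble i k j tx t0.
apply: le_trans (integ_norm ii) _.
rewrite [leRHS]mulrC -integZ; last exact/intble_norm.
apply: le_integ; [exact: intble_norm|exact/intbleZ/intble_norm|].
move=> th hth; rewrite normrM mulrC ler_wpM2r // xr //.
by have := delay_le_max i; lra.
Qed.

Lemma delay_sum_ge0 x t k : kernel_ge0 B -> 0 <= t ->
  (forall s j, - H <= s <= t -> 0 <= x s j) ->
  0 <= \sum_i \sum_j integ (- h i) 0 (fun th => B i th k j * x (t + th) j).
Proof.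
move=> B_ge0 t0 x0; apply: sumr_ge0 => i _; apply: sumr_ge0 => j _.
apply: integ_ge0 => th hth; apply: mulr_ge0; first exact: B_ge0.
by apply: x0; have := delay_le_max i; lra.
Qed.

End Kernel.

Section Trajectory.
Variables (n : nat) (A0 : 'M[R]_n) (A : 'I_N -> R -> 'M[R]_n).
Hypothesis Ai : kernel_intble A.
Implicit Types x y F G : R -> 'I_n -> R.

(* [F] is the primitive of the forcing term of the state equation. *)
Definition traj F x := tame x /\
  forall (t : R) k, 0 <= t -> x t k = x 0 k + integ 0 t (fun s => lin A0 A x s k) + F t k.

Lemma trajD F G x y : traj F x -> traj G y ->
  traj (fun t k => F t k + G t k) (fun t k => x t k + y t k).
Proof.
move=> [tx xE] [ty yE]; split; first exact: tameD.
move=> t k t0; rewrite (xE t k t0) (yE t k t0).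
rewrite [X in _ = _ + X + _](@eq_integ _ _ _ _ (fun s => lin A0 A x s k + lin A0 A y s k)); last first.
  by move=> s /andP[s0 _]; rewrite linD.
rewrite integD; [ring|exact: lin_intble|exact: lin_intble].
Qed.

Lemma trajZ c F x : traj F x -> traj (fun t k => c * F t k) (fun t k => c * x t k).
Proof.
move=> [tx xE]; split; first exact: tameZ.
move=> t k t0; rewrite (xE t k t0).
rewrite [X in _ = _ + X + _](@eq_integ _ _ _ _ (fun s => c * lin A0 A x s k)); last first.
  by move=> s /andP[s0 _]; rewrite linZ.
rewrite integZ; [ring|exact: lin_intble].
Qed.

End Trajectory.
End DelayOperator.

(** * Positivity of trajectories *)

Section Solutions.
Variables (R : realType) (N : nat) (h : 'I_N -> R).
Hypothesis h_gt0 : forall i, 0 < h i.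
Let H : R := \big[Num.max/0]_i h i.
Variables (n : nat) (A0 : 'M[R]_n) (A : 'I_N -> R -> 'M[R]_n).
Hypothesis Ai : kernel_intble h A.
Implicit Types x y F G : R -> 'I_n -> R.
Let L := lin_bound h A0 A.
Let L0 : 0 <= L := lin_bound_ge0 h A0 A.

Let H0 : 0 <= H.
Proof. exact: max_delay_ge0. Qed.

Lemma tame_cst (v : 'I_n -> R) : tame h (fun=> v).
Proof.
move=> T j; split; first exact: measurable_cst.
by exists `|v j|.
Qed.

Lemma continuous_Zexp (a c : R) : continuous (fun s : R => a * expR (c * s)).
Proof.
move=> s; apply: cvgM; first exact: cvg_cst.
apply: continuous_comp; last exact: continuous_expR.
by apply: cvgM; [exact: cvg_cst|exact: cvg_id].
Qed.

Lemma intble_Zexp (a c b d : R) : intble b d (fun s => a * expR (c * s)).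
Proof. exact/intble_continuous/continuous_subspaceT/continuous_Zexp. Qed.

Lemma tame_exp (c : R) (v : 'I_n -> R) : tame h (fun s j => v j * expR (c * s)).
Proof.
move=> T j; split; first exact: (intble_measurable (intble_Zexp _ _ _ _)).
apply: continuous_bounded; exact/continuous_subspaceT/continuous_Zexp.
Qed.

Lemma lin_exp_le c t k : 0 <= c -> 0 <= t ->
  `|lin h A0 A (fun s _ => 1 * expR (c * s)) t k| <= L * expR (c * t).
Proof.
move=> c0 t0; apply: lin_norm => //; first exact: (tame_exp c (fun=> 1)).
move=> s j /andP[_ st]; rewrite mul1r ger0_norm ?expR_ge0 // ler_expR.
exact: ler_wpM2l.
Qed.

(** On a nonnegative past only the diagonal entry [A0 k k] can contribute a negative term. *)
Lemma lin_metzler_ge x t k : metzler A0 -> kernel_ge0 h A -> 0 <= t ->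
  (forall s j, - H <= s <= t -> 0 <= x s j) ->
  A0 k k * x t k <= lin h A0 A x t k.
Proof.
move=> mA0 A_ge0 t0 x0; rewrite /lin (bigD1 k) //= -addrA lerDl addr_ge0 //.
  apply: sumr_ge0 => j jk; apply: mulr_ge0; first by apply: mA0; rewrite eq_sym.
  by apply: x0; rewrite lexx andbT; have := H0; lra.
exact: delay_sum_ge0.
Qed.

(* Adding [eps * exp (c t)] with [c] larger than all row sums makes the
   trajectory strictly positive up to a first zero, where its component would
   have to be increasing. *)
Lemma traj_gt0 F x eps : metzler A0 -> kernel_ge0 h A -> traj h A0 A F x ->
  (forall k, {within `[0, +oo[, continuous (x^~ k)}) ->
  (forall k a b, 0 <= a -> a <= b -> F a k <= F b k) ->
  (forall s k, - H <= s <= 0 -> 0 <= x s k) -> 0 < eps ->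
  forall t k, 0 <= t -> 0 < x t k + eps * expR ((L + 1) * t).
Proof.
move=> mA0 A_ge0 [tx xE] cx Fmono x0 eps0.
(* The part [L] of [c] absorbs the action of the operator on the exponential; the spare 1 leaves at
   least [eps] to compensate the diagonal term of [w]. *)
set c := L + 1; pose w t k := x t k + eps * expR (c * t).
have c0 : 0 <= c by rewrite /c addr_ge0.
have cw k : {within `[0, +oo[, continuous (w^~ k)}.
  have ce : {within `[0, +oo[, continuous (fun s => eps * expR (c * s))}.
    exact/continuous_subspaceT/continuous_Zexp.
  by move=> s; apply: cvgD; [exact: cx|exact: ce].
have w_neg s k : - H <= s <= 0 -> 0 < w s k.
  by move=> sH; apply: ltr_wpDl; [exact: x0|rewrite mulr_gt0 ?expR_gt0].
have w00 k : 0 < w 0 k by apply: w_neg; rewrite lexx andbT; have := H0; lra.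
suff wpos t : 0 <= t -> forall k, 0 < w t k by move=> t k t0; exact: wpos.
move=> t0; apply: contrapT => /existsNP[k1 /negP]; rewrite -leNgt => wt1.
pose S := [set s : R | 0 <= s /\ exists k, w s k <= 0].
have S_inf : has_inf S.
  by split; [exists t; split=> //; exists k1|exists 0 => s [s0 _]].
pose ts := inf S.
have ts0 : 0 <= ts by apply: lb_le_inf; [case: S_inf|move=> s []].
have before s k : 0 <= s < ts -> 0 < w s k.
  move=> /andP[s0 sts]; rewrite ltNge; apply/negP => wsk.
  have : ts <= s by apply: ge_inf; [case: S_inf|split=> //; exists k].
  by rewrite leNgt sts.
(* The infimum is attained: otherwise all components would stay positive for a common time [dm]
   beyond [ts]. *)
have [k wk] : exists k, w ts k <= 0.
  apply: contrapT => /forallNP wts.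
  have {}wts k : 0 < w ts k by rewrite ltNge; apply/negP/wts.
  have tsin : (`[0, +oo[%classic : set R) ts by rewrite /= in_itv /= ts0.
  have : forall k, exists d : R, 0 < d /\ forall s, 0 <= s -> `|s - ts| < d -> 0 < w s k.
    move=> k; have [d d0 dw] := within_continuousP (cw k) tsin (wts k).
    exists d; split=> // s s0 sd; have := dw s; rewrite /= in_itv /= s0 => /(_ erefl sd).
    by rewrite ltr_norml => /andP[+ _]; lra.
  move=> /fin_all_exists[d /all_and2[d0 dw]].
  pose dm := \big[Num.min/1]_k d k.
  have dm0 : 0 < dm by apply: lt_bigmin => // k _.
  have : ts + dm <= ts.
    rewrite {2}/ts; apply: lb_le_inf; first by case: S_inf.
    move=> s [s0 [k wsk]]; rewrite leNgt; apply/negP => sts.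
    have tss : ts <= s by apply: ge_inf; [case: S_inf|split=> //; exists k].
    have : 0 < w s k.
      apply: dw => //; rewrite ger0_norm ?subr_ge0 //.
      have : dm <= d k by exact: bigmin_le_cond.
      by lra.
    by rewrite ltNge wsk.
  by lra.
have ts_gt0 : 0 < ts.
  rewrite lt_neqAle ts0 andbT; apply/eqP => E.
  by move: wk; rewrite -E leNgt w00.
have wts_ge0 j : 0 <= w ts j.
  apply: (within_continuous_ge0 (cw j)) => // s sts; exact/ltW/before.
have w_ge0 s j : - H <= s <= ts -> 0 <= w s j.
  move=> /andP[Hs sts]; have [s0|s0] := leP s 0; first by rewrite ltW // w_neg // Hs.
  move: sts; rewrite le_eqVlt => /predU1P[->|sts]; first exact: wts_ge0.
  by rewrite ltW // before // ltW.
(* Chosen so that [|A0 k k| * eta <= eps]: while [w r k] lies in [0, eta], the diagonal term is at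
   least - eps. *)
pose eta := eps / (`|A0 k k| + 1).
have a1 : 0 < `|A0 k k| + 1 by rewrite ltr_wpDl.
have eta0 : 0 < eta by rewrite divr_gt0.
have tsin : (`[0, +oo[%classic : set R) ts by rewrite /= in_itv /= ts0.
have [d d0 dw] := within_continuousP (cw k) tsin eta0.
pose s := Num.max 0 (ts - d / 2).
have s0 : 0 <= s by rewrite le_max lexx.
have sts : s < ts by rewrite gt_max ts_gt0 /=; lra.
have sd : ts - s < d by rewrite ltrBlDr -ltrBlDl lt_max; apply/orP; right; lra.
have w_small r : s <= r <= ts -> w r k <= eta.
  move=> /andP[sr rts]; have := dw r; rewrite /= in_itv /= (le_trans s0 sr) => /(_ erefl).
  have rd : `|r - ts| < d by rewrite ler0_norm ?subr_le0 //; lra.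
  by move=> /(_ rd); rewrite ltr_norml => /andP[_]; lra.
pose e := fun (s : R) (_ : 'I_n) => 1 * expR (c * s).
have te : tame h e by exact: (tame_exp c (fun=> 1)).
(* Up to the nondecreasing forcing, this is the rate of change of component [k] of [w]. It is
   nonnegative on [s, ts], so [w] cannot fall from [w s k > 0] to [w ts k <= 0]. *)
have lb r : s <= r <= ts -> 0 <= lin h A0 A x r k + eps * (c * expR (c * r)).
  move=> /andP[sr rts]; have r0 := le_trans s0 sr.
  have linw : lin h A0 A w r k = lin h A0 A x r k + eps * lin h A0 A e r k.
    rewrite -linZ // -linD //; last exact: tameZ.
    by apply: eq_lin => // s' j _; rewrite /w /e mul1r.
  have le : lin h A0 A e r k <= L * expR (c * r).
    by apply: le_trans (lin_exp_le _ c0 r0); exact: ler_norm.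
  have lw : A0 k k * w r k <= lin h A0 A w r k.
    apply: lin_metzler_ge => // s' j /andP[Hs sr']; apply: w_ge0.
    by rewrite Hs (le_trans sr').
  have aw : - eps <= A0 k k * w r k.
    rewrite lerNl -mulNr.
    apply: (@le_trans _ _ (`|A0 k k| * eta)).
      have w0 : 0 <= w r k by apply: w_ge0; rewrite rts andbT; have := H0; lra.
      apply: (@le_trans _ _ (`|A0 k k| * w r k)).
        by rewrite ler_wpM2r // -normrN ler_norm.
      by rewrite ler_wpM2l // w_small // sr.
    rewrite /eta mulrCA ler_piMr ?(ltW eps0) // ler_pdivrMr // mul1r.
    by rewrite lerDl.
  have e1 : 1 <= expR (c * r).
    by rewrite -expR0 ler_expR mulr_ge0.
  have el : eps * lin h A0 A e r k <= eps * (L * expR (c * r)).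
    by rewrite ler_wpM2l // ltW.
  have ee : eps <= eps * expR (c * r) by rewrite ler_peMr // ltW.
  have -> : eps * (c * expR (c * r)) = eps * (L * expR (c * r)) + eps * expR (c * r).
    by rewrite /c; ring.
  by move: lw aw el ee; rewrite linw; lra.
have ilin b : 0 <= b -> intble 0 b (fun s => lin h A0 A x s k) by exact: lin_intble.
have : 0 <= integ s ts (fun r => lin h A0 A x r k + eps * (c * expR (c * r))).
  exact: integ_ge0.
have ilin' : intble s ts (fun s => lin h A0 A x s k).
  exact: (intble_sub _ _ (ilin ts ts0)).
rewrite integD //; last exact/intbleZ/intble_Zexp.
rewrite integZ; last exact: intble_Zexp.
rewrite exp_integ; last exact: ltW.
have wsk : 0 < w s k by apply: before; rewrite s0.
have := Fmono k s ts s0 (ltW sts).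
move: wsk wk; rewrite /w (xE s k s0) (xE ts k ts0) (@integ_cat _ 0 s ts) //; last 2 first.
- exact: ltW.
- exact: ilin.
rewrite mulrBr; move: (integ s ts _) (integ 0 s _) (eps * expR (c * s)) (eps * expR (c * ts)) => *; lra.
Qed.

Lemma traj_ge0 F x : metzler A0 -> kernel_ge0 h A -> traj h A0 A F x ->
  (forall k, {within `[0, +oo[, continuous (x^~ k)}) ->
  (forall k a b, 0 <= a -> a <= b -> F a k <= F b k) ->
  (forall s k, - H <= s <= 0 -> 0 <= x s k) ->
  forall t k, 0 <= t -> 0 <= x t k.
Proof.
move=> mA0 A_ge0 tx cx Fmono x0 t k t0; rewrite leNgt; apply/negP => xneg.
(* For this [eps] the sum that [traj_gt0] declares positive would be exactly 0. *)
have e0 : 0 < - x t k / expR ((L + 1) * t) by rewrite divr_gt0 ?expR_gt0 ?oppr_gt0.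
have := traj_gt0 mA0 A_ge0 tx cx Fmono x0 e0 k t0.
by rewrite divfK ?gt_eqF ?expR_gt0 // addrN ltxx.
Qed.

End Solutions.

(** * Existence of trajectories by Picard iteration *)

Section GeometricSequences.
Variable R : realType.

Lemma le0_geometric (a C : R) : (forall m : nat, a <= C / 2 ^+ m) -> a <= 0.
Proof.
move=> aC; rewrite leNgt; apply/negP => a0.
have C0 : 0 < C by have := aC 0%N; rewrite expr0 divr1; lra.
have [m Cm] : exists m : nat, C / a < m%:R.
  by exists (Num.bound (C / a)); apply: archi_boundP; rewrite divr_ge0 ?ltW.
have := aC m; rewrite leNgt => /negP; apply.
have m2 : m%:R < (2 : R) ^+ m by rewrite -natrX ltr_nat ltn_expl.
rewrite ltr_pdivrMr ?exprn_gt0 // mulrC -ltr_pdivrMr //.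
exact: lt_trans m2.
Qed.

(** Nested intervals: the radius 2 E / 2^m is the tail of the geometric series and shrinks by E /
    2^m at step m, as much as [a] can move. So the lower ends increase, the upper ends decrease, and
    the limit lies in all the intervals. *)
Lemma geometric_cvg (a : nat -> R) (E : R) :
  (forall m, `|a m.+1 - a m| <= E / 2 ^+ m) ->
  cvgn a /\ forall m, `|a m - limn a| <= 2 * E / 2 ^+ m.
Proof.
move=> aE.
pose lo m := a m - 2 * E / 2 ^+ m; pose up m := a m + 2 * E / 2 ^+ m.
have half m : 2 * E / 2 ^+ m.+1 = E / 2 ^+ m.
  by rewrite exprS; field; rewrite expf_neq0.
have dbl m : 2 * E / 2 ^+ m = 2 * (E / 2 ^+ m) by rewrite mulrA.
have lo_nd : nondecreasing_seq lo.
  apply/nondecreasing_seqP => m; rewrite /lo half dbl.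
  by have := aE m; rewrite ler_norml => /andP[]; lra.
have up_ni : nonincreasing_seq up.
  apply/nonincreasing_seqP => m; rewrite /up half dbl.
  by have := aE m; rewrite ler_norml => /andP[]; lra.
have E0 m : 0 <= 2 * E / 2 ^+ m.
  by rewrite dbl mulr_ge0 //; apply: le_trans (aE m).
have lo_up m p : lo m <= up p.
  apply: le_trans (lo_nd _ _ (leq_maxl m p)) _.
  apply: le_trans (up_ni _ _ (leq_maxr m p)).
  by rewrite /lo /up; have := E0 (maxn m p); lra.
have clo : cvgn lo.
  apply: nondecreasing_is_cvgn => //; exists (up 0%N) => _ [m _ <-]; exact: lo_up.
have le_lim m : lo m <= limn lo by apply: nondecreasing_cvgn_le.
have lim_le m : limn lo <= up m by apply: limr_le => //; apply: nearW => p; exact: lo_up.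
have bnd m : `|a m - limn lo| <= 2 * E / 2 ^+ m.
  by rewrite ler_norml; have := le_lim m; have := lim_le m; rewrite /lo /up; lra.
have c0 : (fun m => 2 * E / 2 ^+ m) @ \oo --> (0 : R).
  rewrite -(mulr0 (2 * E)); apply: cvgM; first exact: cvg_cst.
  under eq_fun do rewrite -exprVn.
  by apply: cvg_expr; rewrite ger0_norm ?invr_ge0 // invf_lt1 // ltr1n.
have ca : a @ \oo --> limn lo.
  apply/cvgrPdist_le => e e0; near=> m.
  rewrite distrC; apply: le_trans (bnd m) _.
  apply: le_trans (ler_norm _) _; rewrite -[X in `|X|]subr0 distrC.
  by near: m; move/cvgrPdist_le : c0; apply.
by split; [apply/cvg_ex; exists (limn lo)|move=> m; rewrite (cvg_lim _ ca)].
Unshelve. all: by end_near. Qed.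

End GeometricSequences.

Section Existence.
Variables (R : realType) (N : nat) (h : 'I_N -> R).
Hypothesis h_gt0 : forall i, 0 < h i.
Let H : R := \big[Num.max/0]_i h i.
Variables (n : nat) (A0 : 'M[R]_n) (A : 'I_N -> R -> 'M[R]_n).
Hypothesis Ai : kernel_intble h A.
Implicit Types x y : R -> 'I_n -> R.
Let L := lin_bound h A0 A.
Let L0 : 0 <= L := lin_bound_ge0 h A0 A.
Let H0 : 0 <= H.
Proof. exact: max_delay_ge0. Qed.

Lemma continuous_forcing_traj (F : R -> 'I_n -> R) x k : traj h A0 A F x ->
  {within `[0, +oo[, continuous (F^~ k)} -> {within `[0, +oo[, continuous (x^~ k)}.
Proof.
move=> [tx xE] cF; apply: within_continuousy => T T0.
have cF' : {within `[0, T], continuous (F^~ k)}.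
  apply: continuous_subspaceW cF => s /=; rewrite !in_itv /= => /andP[-> //].
have ci := continuous_integ T0 (lin_intble h_gt0 A0 Ai k tx T0).
apply: (@subspace_eq_continuous _ _ _ (fun t => x 0 k + integ 0 t (fun s => lin h A0 A x s k) + F t k)).
  by move=> s /set_mem /=; rewrite in_itv /= => /andP[s0 _]; rewrite /from_subspace -xE.
move=> s; apply: cvgD; last exact: cF'.
by apply: cvgD; [exact: cvg_cst|exact: ci].
Qed.

Lemma tame_glue y v : (forall s k, s <= 0 -> y s k = v k) ->
  (forall k, {within `[0, +oo[, continuous (y^~ k)}) -> tame h y.
Proof.
move=> y0 cy T k.
have [T0|T0] := leP T 0.
  split.
    apply: (@eq_measurable_fun _ _ _ _ _ (fun=> v k)); last exact: measurable_cst.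
    by move=> s /set_mem /=; rewrite in_itv /= => /andP[_ sT]; rewrite y0 // (le_trans sT).
  by exists `|v k| => s /andP[_ sT]; rewrite y0 // (le_trans sT).
have cT : {within `[0, T], continuous (y^~ k)}.
  have cky : {within `[0, +oo[, continuous (y^~ k)} := cy k.
  apply: continuous_subspaceW cky => s /=; rewrite !in_itv /= => /andP[-> //].
split.
  rewrite (_ : `[- H, T]%classic = (`[- H, 0] `|` `[0, T])%classic); last first.
    apply/seteqP; split=> s /=; rewrite !in_itv /=; last by have := H0; move=> ? [|] /andP[]; lra.
    by move=> /andP[Hs sT]; case: (leP s 0) => s0; [left|right]; rewrite ?Hs ?s0 ?sT ?ltW.
  apply/measurable_funU => //; split.
    apply: (@eq_measurable_fun _ _ _ _ _ (fun=> v k)); last exact: measurable_cst.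
    by move=> s /set_mem /=; rewrite in_itv /= => /andP[_ sT]; rewrite y0.
  exact: (intble_measurable (intble_continuous cT)).
have [B yB] := continuous_bounded cT.
exists (`|v k| + `|B|) => s /andP[_ sT]; have [s0|s0] := leP s 0.
  by rewrite y0 // lerDl.
apply: (@le_trans _ _ B); first by apply: yB; rewrite sT ltW.
by apply: le_trans (ler_norm _) _; rewrite lerDr.
Qed.

Section Picard.
Variables (F : R -> 'I_n -> R) (v : 'I_n -> R).
Hypothesis cF : forall k, {within `[0, +oo[, continuous (F^~ k)}.
Hypothesis F0 : forall k, F 0 k = 0.

(** The past is frozen at the constant [v]; the proof builds solutions only from the initial values
    0 (gains) and 1 (stability). *)
Fixpoint picard m : R -> 'I_n -> R := if m is m'.+1 then
    fun t k => if t <= 0 then v k else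
      v k + integ 0 t (fun s => lin h A0 A (picard m') s k) + F t k
  else fun _ k => v k.

Lemma picardS m t k : 0 <= t -> picard m.+1 t k =
  v k + integ 0 t (fun s => lin h A0 A (picard m) s k) + F t k.
Proof.
rewrite le_eqVlt => /predU1P[<-|t0] /=; last by rewrite leNgt t0.
by rewrite lexx integ_pt F0 !addr0.
Qed.

Lemma picard_past m t k : t <= 0 -> picard m t k = v k.
Proof. by case: m => //= m ->. Qed.

Lemma tame_picard m : tame h (picard m).
Proof.
elim: m => [|m IH]; first exact: tame_cst.
apply: (@tame_glue _ v) => [s k|k]; first exact: picard_past.
apply: within_continuousy => T T0.
have ci := continuous_integ T0 (lin_intble h_gt0 A0 Ai k IH T0).
have cF' : {within `[0, T], continuous (F^~ k)}.
  have ckF : {within `[0, +oo[, continuous (F^~ k)} := @cF k.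
  apply: continuous_subspaceW ckF => s /=; rewrite !in_itv /= => /andP[-> //].
apply: (@subspace_eq_continuous _ _ _
    (fun t => v k + integ 0 t (fun s => lin h A0 A (picard m) s k) + F t k)).
  move=> s /set_mem sT; have s0 : 0 <= s by move: sT; rewrite /= in_itv /= => /andP[].
  by rewrite /from_subspace picardS.
move=> s; apply: cvgD; last exact: cF'.
by apply: cvgD; [exact: cvg_cst|exact: ci].
Qed.

(** In the sup norm weighted by exp(- c t), one Picard step contracts by L / c <= 1 / 2, whatever
    the horizon [T]. *)
Let c : R := 2 * L + 1.

Lemma picard_step T : exists2 D, 0 <= D & forall m t k, 0 <= t <= T ->
  `|picard m.+1 t k - picard m t k| <= D / 2 ^+ m * expR (c * t).
Proof.
have c0 : 0 < c by rewrite /c; have := L0; lra.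
have td m : tame h (fun s k => picard m.+1 s k + -1 * picard m s k).
  by apply: tameD; [exact: tame_picard|by apply: tameZ; exact: tame_picard].
have [D D0 bD] : exists2 D, 0 <= D & forall t k, 0 <= t <= T ->
    `|picard 1 t k - picard 0 t k| <= D.
  have /fin_all_exists[b bP] : forall k, exists b : R, forall t, 0 <= t <= T ->
      `|picard 1 t k - picard 0 t k| <= b.
    move=> k; have [_ [b bP]] := td 0%N T k; exists b => t /andP[t0 tT].
    have := bP t; rewrite mulN1r; apply; rewrite tT andbT (le_trans _ t0) // oppr_le0; exact: H0.
  exists (\sum_k `|b k|); first exact: sumr_ge0.
  move=> t k tT; apply: le_trans (bP k t tT) _; apply: le_trans (ler_norm _) _.
  by rewrite (bigD1 k) //= lerDl sumr_ge0.
exists D => //; elim=> [|m IH] t k /andP[t0 tT].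
  rewrite expr0 divr1; apply: le_trans (bD t k _) _; first by rewrite t0.
  by rewrite ler_peMr // -expR0 ler_expR mulr_ge0 // ltW.
rewrite (picardS m.+1 k t0) (picardS m k t0).
have tm := tame_picard m; have tm1 := tame_picard m.+1.
have im := lin_intble h_gt0 A0 Ai k tm t0.
have im1 := lin_intble h_gt0 A0 Ai k tm1 t0.
have {1}-> (a b c' d : R) : a + b + d - (a + c' + d) = b - c' by ring.
rewrite -integB //; apply: le_trans (integ_norm (intbleB im1 im)) _.
pose K := D / 2 ^+ m.+1.
have K0 : 0 <= K by rewrite divr_ge0 // exprn_ge0.
apply: (@le_trans _ _ (integ 0 t (fun s => K * (c * expR (c * s))))).
  apply: le_integ.
  - exact/intble_norm/intbleB.
  - exact/intbleZ/intble_Zexp.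
  move=> s /andP[s0 st].
  have -> : lin h A0 A (picard m.+1) s k - lin h A0 A (picard m) s k =
      lin h A0 A (fun s k => picard m.+1 s k + -1 * picard m s k) s k.
    by rewrite linD // ?linZ ?mulN1r //; exact: tameZ.
  apply: (@le_trans _ _ (L * (D / 2 ^+ m * expR (c * s)))).
    apply: lin_norm => // r j /andP[Hr rs]; rewrite mulN1r; have [r0|r0] := leP r 0.
      by rewrite !picard_past // subrr normr0 !mulr_ge0 ?expR_ge0 ?invr_ge0 ?exprn_ge0.
    apply: le_trans (IH r j _) _; first by rewrite ltW //= (le_trans rs) // (le_trans st).
    by rewrite ler_wpM2l ?divr_ge0 ?exprn_ge0 // ler_expR ler_wpM2l // ltW.
  have -> : D / 2 ^+ m = 2 * K by rewrite /K exprS; field; rewrite expf_neq0.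
  rewrite -/L mulrA [L * _]mulrCA mulrA -mulrA; move: (expR_ge0 (c * s)) K0.
  move: (expR (c * s)) => e e0 K0; rewrite /c; have := L0; nra.
rewrite integZ ?exp_integ //; last exact: intble_Zexp.
by rewrite ler_wpM2l // mulr0 expR0 gerBl.
Qed.

Lemma traj_exists : exists2 x, traj h A0 A F x & forall s k, s <= 0 -> x s k = v k.
Proof.
pose x t k := limn (fun m => picard m t k).
have x_past s k : s <= 0 -> x s k = v k.
  move=> s0; rewrite /x (_ : (fun m => _) = (fun=> v k)) ?lim_cst //.
  by apply/funext => m; rewrite picard_past.
have cvx t k : cvgn (fun m => picard m t k).
  have [t0|t0] := leP t 0.
    rewrite (_ : (fun m => _) = (fun=> v k)); first exact: is_cvg_cst.
    by apply/funext => m; rewrite picard_past.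
  have [D D0 bD] := picard_step t.
  apply: (proj1 (@geometric_cvg _ _ (D * expR (c * t)) _)) => m.
  by rewrite mulrAC; apply: bD; rewrite ltW //=.
have xB T : exists2 D, 0 <= D & forall m t k, t <= T -> `|picard m t k - x t k| <= D / 2 ^+ m.
  have [D D0 bD] := picard_step T.
  exists (2 * (D * expR (c * T))); first by rewrite !mulr_ge0 ?expR_ge0.
  move=> m t k tT; have [t0|t0] := leP t 0.
    by rewrite picard_past // x_past // subrr normr0 divr_ge0 ?exprn_ge0 // !mulr_ge0 ?expR_ge0.
  apply: (proj2 (@geometric_cvg _ (fun m => picard m t k) (D * expR (c * T)) _)) => p.
  apply: le_trans (bD p t k _) _; first by rewrite ltW.
  rewrite mulrAC ler_wpM2r ?invr_ge0 ?exprn_ge0 // ler_wpM2l // ler_expR ler_wpM2l ?(ltW t0) //.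
  by rewrite /c; have := L0; lra.
have tx : tame h x.
  move=> T k; split.
    apply: (@measurable_fun_cvg _ _ _ _ (fun m => (picard m)^~ k)).
      by move=> m; have [] := tame_picard m T k.
    by move=> s _; exact: cvx.
  have [D D0 DP] := xB T; exists (`|v k| + D) => s /andP[_ sT].
  have := DP 0%N s k sT; rewrite expr0 divr1 /= distrC => xv.
  by rewrite -[x s k](subrK (v k)) addrC; apply: le_trans (ler_normD _ _) _; rewrite lerD2l.
exists x => //; split=> // t k t0; rewrite (x_past 0) //.
have [D D0 DP] := xB t.
apply/eqP; rewrite -subr_eq0 -normr_le0.
apply: (@le0_geometric _ _ (D + t * (L * D))) => m.
(* The defect of the limit splits into the distance to iterate m + 1 and the integrated effect of
   the distance to iterate m; both are of order 2^-m. *)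
pose r := v k + integ 0 t (fun s => lin h A0 A x s k) + F t k.
have -> : x t k - r = (x t k - picard m.+1 t k) +
   integ 0 t (fun s => lin h A0 A (picard m) s k - lin h A0 A x s k).
  rewrite integB; [|by apply: lin_intble => //; exact: tame_picard|exact: lin_intble].
  by rewrite picardS // /r; ring.
apply: le_trans (ler_normD _ _) _; rewrite mulrDl; apply: lerD.
  rewrite distrC; apply: le_trans (DP m.+1 t k (lexx t)) _.
  rewrite ler_wpM2l // lef_pV2 ?posrE ?exprn_gt0 // exprS ler_peMl ?exprn_ge0 //.
  by rewrite ler1n.
have im := lin_intble h_gt0 A0 Ai k (tame_picard m) t0.
have ix := lin_intble h_gt0 A0 Ai k tx t0.
apply: le_trans (integ_norm (intbleB im ix)) _.
have td : tame h (fun s k => picard m s k + -1 * x s k).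
  by apply: tameD; [exact: tame_picard|exact/tameZ].
apply: (@le_trans _ _ (integ 0 t (fun=> L * (D / 2 ^+ m)))).
  apply: le_integ; [exact/intble_norm/intbleB|exact: intble_cst|].
  move=> s /andP[s0 st].
  have -> : lin h A0 A (picard m) s k - lin h A0 A x s k =
      lin h A0 A (fun s k => picard m s k + -1 * x s k) s k.
    by rewrite linD // ?linZ ?mulN1r //; [exact: tame_picard|exact: tameZ].
  apply: lin_norm => // r' j /andP[Hr rs]; rewrite mulN1r; apply: DP; exact: le_trans st.
by rewrite integ_cst // subr0 mulrC !mulrA.
Qed.

End Picard.
End Existence.

(** * The static gain *)

Section ShiftBounds.
Variable R : realType.
Implicit Types (f : R -> R).

Lemma integ_sub_le a b c d f : a <= b -> b <= c -> c <= d -> intble a d f ->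
  (forall s, a <= s <= d -> 0 <= f s) -> integ b c f <= integ a d f.
Proof.
move=> ab bc cd fi f0.
rewrite (@integ_cat _ a b d) //; last exact: le_trans cd.
rewrite (@integ_cat _ b c d) //; last exact: intble_sub fi.
have := @integ_ge0 _ a b f; have := @integ_ge0 _ c d f.
move=> H1 H2.
have {}H1 : 0 <= integ c d f by apply: H1 => s /andP[? ?]; apply: f0; lra.
have {}H2 : 0 <= integ a b f by apply: H2 => s /andP[? ?]; apply: f0; lra.
by lra.
Qed.

(** The window becomes [th, T + th]: nothing is gained before 0, where [f] vanishes, and what is
    lost near T is nonnegative. *)
Lemma integ_shift_le h T th f : 0 <= T -> - h <= th <= 0 ->
  {within `[- h, T], continuous f} ->
  (forall s, - h <= s <= T -> 0 <= f s) -> (forall s, - h <= s <= 0 -> f s = 0) ->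
  integ 0 T (fun s => f (s + th)) <= integ 0 T f.
Proof.
move=> T0 /andP[hth th0] cf f0 fz.
have fi : intble (- h) T f by exact: intble_continuous.
rewrite integ_shift //; last first.
  by apply: continuous_subspaceW cf; apply: subset_itv; rewrite bnd_simp; lra.
apply: (@le_trans _ _ (integ th T f)).
  apply: integ_sub_le; rewrite ?add0r ?gerDl ?lerDr //.
    exact: intble_sub fi.
  by move=> s /andP[? ?]; apply: f0; lra.
rewrite (@integ_cat _ th 0 T) //; last exact: intble_sub fi.
rewrite (@eq_integ _ th 0 _ (fun=> 0)) ?integ0 ?add0r //.
by move=> s /andP[? ?]; apply: fz; lra.
Qed.

(** The lost piece [T + th, T] has length at most [h] and carries values at most [delta]; the piece
    gained before 0 only helps. *)
Lemma integ_shift_ge h T th f delta : 0 <= T -> - h <= th <= 0 -> 0 <= delta ->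
  {within `[- h, T], continuous f} ->
  (forall s, - h <= s <= T -> 0 <= f s) ->
  (forall s, T - h <= s <= T -> f s <= delta) ->
  integ 0 T f - h * delta <= integ 0 T (fun s => f (s + th)).
Proof.
move=> T0 /andP[hth th0] d0 cf f0 fd.
have fi : intble (- h) T f by exact: intble_continuous.
rewrite integ_shift //; last first.
  by apply: continuous_subspaceW cf; apply: subset_itv; rewrite bnd_simp; lra.
have fiT : intble th T f by exact: intble_sub fi.
have : integ 0 T f <= integ th T f.
  by apply: integ_sub_le => // s /andP[? ?]; apply: f0; lra.
rewrite (@integ_cat _ th (T + th) T) ?gerDl ?lerDr //.
have fiT' : intble (T + th) T f by apply: intble_sub fi; lra.
have : integ (T + th) T f <= integ (T + th) T (fun=> delta).
  apply: le_integ => //; first exact: intble_cst.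
  by move=> s /andP[? ?]; apply: fd; lra.
rewrite integ_cst ?gerDl // add0r; nra.
Qed.

End ShiftBounds.

Section StaticGain.
Variables (R : realType) (N : nat) (h : 'I_N -> R).
Hypothesis h_gt0 : forall i, 0 < h i.
Let H : R := \big[Num.max/0]_i h i.
Let H0 : 0 <= H.
Proof. exact: max_delay_ge0. Qed.
Variables (m n : nat) (B0 : 'M[R]_(m, n)) (B : 'I_N -> R -> 'M[R]_(m, n)).
Hypotheses (Bi : kernel_intble h B) (B_ge0 : kernel_ge0 h B).
Implicit Types x : R -> 'I_n -> R.

(** The action of [lin] on constant functions, see [lin_cst]; for the kernels [sA] and [sC] it gives
    the matrices M and G. *)
Definition static : 'M[R]_(m, n) := B0 + \sum_i mx_integral (h i) (B i).

Lemma staticE k j : static k j = B0 k j + \sum_i integ (- h i) 0 (fun s => B i s k j).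
Proof. by rewrite mxE summxE; congr (_ + _); apply: eq_bigr => i _; rewrite mxE. Qed.

Lemma lin_cst (v : 'I_n -> R) t k : lin h B0 B (fun=> v) t k = \sum_j static k j * v j.
Proof.
rewrite /lin exchange_big -big_split /=; apply: eq_bigr => j _.
rewrite staticE mulrDl mulr_suml; congr (_ + _); apply: eq_bigr => i _.
rewrite mulrC -integZ //; by apply: eq_integ => s _; rewrite mulrC.
Qed.

Lemma lin_exp_cst (v : 'I_n -> R) a t k : a <= 0 -> 
  lin h B0 B (fun s j => v j * expR (a * s)) t k =
  expR (a * t) * (\sum_j B0 k j * v j +
    \sum_i \sum_j v j * integ (- h i) 0 (fun th => B i th k j * expR (a * th))).
Proof.
move=> a0; rewrite mulrDr /lin; congr (_ + _).
  by rewrite mulr_sumr; apply: eq_bigr => j _; rewrite mulrA mulrC.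
rewrite mulr_sumr; apply: eq_bigr => i _; rewrite mulr_sumr; apply: eq_bigr => j _.
have be : intble (- h i) 0 (fun th => B i th k j * expR (a * th)).
  have ce : {within `[- h i, 0], continuous (fun th : R => 1 * expR (a * th))}.
    exact/continuous_subspaceT/continuous_Zexp.
  have [C CP] := continuous_bounded ce.
  apply: (@intbleMb _ _ _ _ _ C) => // [|s sh].
    apply: (intble_measurable (eq_intble _ (intble_Zexp 1 a _ _))) => s _.
    by rewrite mul1r.
  by have := CP s sh; rewrite mul1r.
rewrite mulrA -integZ //; apply: eq_integ => th _.
by rewrite mulrDr expRD; ring.
Qed.

Lemma lin_ge0 x t k : nonneg_mx B0 -> 0 <= t ->
  (forall s j, - H <= s <= t -> 0 <= x s j) -> 0 <= lin h B0 B x t k.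
Proof.
move=> B0_ge0 t0 x0; apply: addr_ge0; last exact: delay_sum_ge0.
apply: sumr_ge0 => j _; apply: mulr_ge0; first exact: B0_ge0.
by apply: x0; rewrite lexx andbT (le_trans _ t0) // oppr_le0.
Qed.

(** After Fubini, each delayed integral of a nonnegative function at rest in the past is at most the
    undelayed one, and the kernel weights are nonnegative. *)
Lemma lin_integ_le x T k : tame h x -> 0 <= T ->
  (forall j, {within `[- H, T], continuous (x^~ j)}) ->
  (forall s j, - H <= s <= T -> 0 <= x s j) ->
  (forall s j, - H <= s <= 0 -> x s j = 0) ->
  integ 0 T (fun s => lin h B0 B x s k) <= \sum_j static k j * integ 0 T (x^~ j).
Proof.
move=> tx T0 cx x0 xz; rewrite (lin_integ h_gt0) //.
under [leRHS]eq_bigr do rewrite staticE mulrDl mulr_suml.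
rewrite big_split lerD2l /= [leRHS]exchange_big /=.
apply: ler_sum => i _; apply: ler_sum => j _.
have hi := delay_le_max h i.
have sub T' : subset (`[- h i, T']%classic : set R) `[- H, T']%classic.
  by apply: subset_itv; rewrite bnd_simp // lerN2.
rewrite mulrC -integZ //; apply: le_integ.
- by have [] := tame_delay_fubini h_gt0 Bi i k j tx T0.
- exact: intbleZ.
move=> th hth; rewrite [leRHS]mulrC; apply: ler_wpM2l; first exact: B_ge0.
apply: (@integ_shift_le _ (h i) T th (x^~ j)) => //.
- by have cxj : {within `[- H, T], continuous (x^~ j)} := cx j; apply: continuous_subspaceW cxj.
- by move=> s /andP[? ?]; apply: x0; rewrite -/H in hi; lra.
- by move=> s /andP[? ?]; apply: xz; rewrite -/H in hi; lra.
Qed.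

(** The loss in [lin_integ_ge] per unit of [delta]: windows of length [h i] that leave [0, T],
    weighted by the total mass of the kernel. *)
Definition delay_mass k : R :=
  \sum_i \sum_j h i * integ (- h i) 0 (fun s => B i s k j).

Lemma delay_mass_ge0 k : 0 <= delay_mass k.
Proof.
apply: sumr_ge0 => i _; apply: sumr_ge0 => j _; apply: mulr_ge0; first exact: ltW.
by apply: integ_ge0 => s hs; exact: B_ge0.
Qed.

(** A nonnegative past can only increase the integral, so the bound serves both the pulses, which
    start at rest, and the solution with initial value 1. *)
Lemma lin_integ_ge x T k delta : tame h x -> 0 <= T -> 0 <= delta ->
  (forall j, {within `[- H, T], continuous (x^~ j)}) ->
  (forall s j, - H <= s <= T -> 0 <= x s j) ->
  (forall s j, T - H <= s <= T -> x s j <= delta) ->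
  \sum_j static k j * integ 0 T (x^~ j) - delay_mass k * delta <=
  integ 0 T (fun s => lin h B0 B x s k).
Proof.
move=> tx T0 d0 cx x0 xd; rewrite (lin_integ h_gt0) //.
under eq_bigr do rewrite staticE mulrDl mulr_suml.
rewrite big_split /= -addrA lerD2l exchange_big /= /delay_mass mulr_suml -sumrB.
apply: ler_sum => i _; rewrite mulr_suml -sumrB; apply: ler_sum => j _.
have hi := delay_le_max h i.
have sub T' : subset (`[- h i, T']%classic : set R) `[- H, T']%classic.
  by apply: subset_itv; rewrite bnd_simp // lerN2.
rewrite (_ : _ - _ = (integ 0 T (x^~ j) - h i * delta) * integ (- h i) 0 (fun s => B i s k j)); last by ring.
rewrite -integZ //; apply: le_integ.
- exact: intbleZ.
- by have [] := tame_delay_fubini h_gt0 Bi i k j tx T0.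
move=> th hth; rewrite mulrC; apply: ler_wpM2l; first exact: B_ge0.
apply: (@integ_shift_ge _ (h i) T th (x^~ j)) => //.
- by have cxj : {within `[- H, T], continuous (x^~ j)} := cx j; apply: continuous_subspaceW cxj.
- by move=> s /andP[? ?]; apply: x0; rewrite -/H in hi; lra.
- by move=> s /andP[? ?]; apply: xd; rewrite -/H in hi; lra.
Qed.

End StaticGain.

(** * Metzler matrices *)

Section MetzlerMatrices.
Variable R : realType.

Lemma unitmx_inj n (M : 'M[R]_n) : (forall x : 'cV_n, M *m x = 0 -> x = 0) -> M \in unitmx.
Proof.
move=> injM; rewrite -unitmx_tr -row_free_unit -kermx_eq0.
apply/rowV0P => v /sub_kermxP vM; apply: trmx_inj; rewrite trmx0; apply: injM.
by apply: trmx_inj; rewrite trmx_mul trmxK vM trmx0.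
Qed.

Lemma metzler_tr n (M : 'M[R]_n) : metzler M -> metzler M^T.
Proof. by move=> mM i j ij; rewrite mxE; apply: mM; rewrite eq_sym. Qed.

Lemma mulmx_ge0 m n p (A : 'M[R]_(m, n)) (B : 'M[R]_(n, p)) :
  nonneg_mx A -> nonneg_mx B -> nonneg_mx (A *m B).
Proof. by move=> A0 B0 i j; rewrite mxE sumr_ge0 // => k _; rewrite mulr_ge0. Qed.

(** A minimum principle: let r < 0 be the least ratio x_i / lam_i, attained at k0. Then x - r lam is
    nonnegative and vanishes at k0, so row k0 of M, nonnegative off the diagonal, sends it to
    something nonnegative; adding r (M lam) > 0 contradicts M x <= 0. *)
Lemma metzler_le0_ge0 n (M : 'M[R]_n) (lam : 'cV_n) : metzler M ->
  (forall k, 0 < lam k 0) -> (forall k, (M *m lam) k 0 < 0) ->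
  forall x : 'cV_n, (forall k, (M *m x) k 0 <= 0) -> forall k, 0 <= x k 0.
Proof.
move=> mM lam0 Mlam x Mx k; rewrite leNgt; apply/negP => xk.
pose r i := x i 0 / lam i 0.
have [k0 _ rmin] := @Order.TotalTheory.arg_minP _ _ _ k xpredT r erefl.
have r0 : r k0 < 0.
  by apply: le_lt_trans (rmin k erefl) _; rewrite /r pmulr_llt0 ?invr_gt0.
have := Mx k0; rewrite leNgt => /negP; apply.
have -> : x = r k0 *: lam + (x - r k0 *: lam) by rewrite addrC subrK.
rewrite mulmxDr mxE -scalemxAr [X in X + _]mxE.
apply: ltr_wpDr; last by rewrite nmulr_lgt0.
rewrite mxE sumr_ge0 // => j _; rewrite !mxE.
have [->|jk0] := eqVneq j k0.
  by rewrite /r divfK ?subrr ?mulr0 // gt_eqF.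
by rewrite mulr_ge0 ?mM 1?eq_sym // subr_ge0 -ler_pdivlMr //; exact: rmin.
Qed.

(** If x_k were 0, row k would meet only off-diagonal entries and (M x)_k would be nonnegative. *)
Lemma metzler_lt0_gt0 n (M : 'M[R]_n) (x : 'cV_n) : metzler M ->
  (forall k, 0 <= x k 0) -> (forall k, (M *m x) k 0 < 0) -> forall k, 0 < x k 0.
Proof.
move=> mM x0 Mx k; rewrite lt_neqAle x0 andbT; apply/eqP => xk.
have := Mx k; rewrite ltNge => /negP; apply.
rewrite mxE sumr_ge0 // => j _; have [->|jk] := eqVneq j k; first by rewrite -xk mulr0.
by rewrite mulr_ge0 ?mM // eq_sym.
Qed.

Lemma metzler_unit n (M : 'M[R]_n) (lam : 'cV_n) : metzler M ->
  (forall k, 0 < lam k 0) -> (forall k, (M *m lam) k 0 < 0) -> M \in unitmx.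
Proof.
move=> mM lam0 Mlam; apply: unitmx_inj => x Mx; apply/colP => k; apply/eqP.
rewrite mxE eq_le -oppr_ge0; apply/andP; split.
  have := @metzler_le0_ge0 _ M lam mM lam0 Mlam (- x) _ k; rewrite mxE; apply.
  by move=> k'; rewrite mulmxN Mx !mxE oppr0.
by apply: (metzler_le0_ge0 mM lam0 Mlam) => k'; rewrite Mx mxE.
Qed.

Lemma metzler_inv_ge0 n (M : 'M[R]_n) (lam : 'cV_n) : metzler M ->
  (forall k, 0 < lam k 0) -> (forall k, (M *m lam) k 0 < 0) -> nonneg_mx (- invmx M).
Proof.
move=> mM lam0 Mlam i j; have uM := metzler_unit mM lam0 Mlam.
have := @metzler_le0_ge0 _ M lam mM lam0 Mlam (col j (- invmx M)) _ i.
rewrite mxE; apply => k; rewrite colE mulmxA mulmxN mulmxV // mulNmx mul1mx !mxE.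
by rewrite oppr_le0 ler0n.
Qed.

Lemma metzler_lt0_tr n (M : 'M[R]_n) (lam : 'cV_n) : metzler M ->
  (forall k, 0 < lam k 0) -> (forall k, (M *m lam) k 0 < 0) ->
  exists mu : 'cV_n, (forall k, 0 < mu k 0) /\ (forall k, (M^T *m mu) k 0 < 0).
Proof.
move=> mM lam0 Mlam; have uM := metzler_unit mM lam0 Mlam.
have N0 := metzler_inv_ge0 mM lam0 Mlam.
(* The solution of M^T mu = - 1, which is nonnegative because - M^-1 is. *)
pose mu : 'cV_n := (- invmx M)^T *m const_mx 1.
have Mmu k : (M^T *m mu) k 0 < 0.
  by rewrite /mu mulmxA -trmx_mul mulNmx mulVmx // raddfN /= trmx1 mulNmx mul1mx !mxE oppr_lt0.
exists mu; split=> //; apply: (metzler_lt0_gt0 (metzler_tr mM)) => // k.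
apply: mulmx_ge0; first by move=> i j; rewrite mxE; exact: N0.
by move=> i j; rewrite mxE.
Qed.

Lemma quad_form n (S : 'M[R]_n) (v w : 'cV_n) :
  (v^T *m S *m w) 0 0 = \sum_i \sum_j v i 0 * S i j * w j 0.
Proof.
rewrite mxE exchange_big; apply: eq_bigr => j _ /=; rewrite mxE mulr_suml.
by apply: eq_bigr => i _; rewrite mxE.
Qed.

(* For v = - S^-1 1 the negative part w of v satisfies w^T S w >= 0, so w = 0. *)
Lemma metzler_negdef_lt0 n (S : 'M[R]_n) : metzler S -> negdef S ->
  exists v : 'cV_n, (forall k, 0 < v k 0) /\ (forall k, (S *m v) k 0 < 0).
Proof.
move=> mS nS.
have uS : S \in unitmx.
  apply: unitmx_inj => x Sx; apply/eqP; apply: contraT => /nS.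
  by rewrite -mulmxA Sx mulmx0 mxE ltxx.
have [v Sv] : exists v : 'cV_n, S *m v = - const_mx 1.
  by exists (invmx S *m - const_mx 1); rewrite mulmxA mulmxV // mul1mx.
pose w : 'cV_n := \col_k Num.max 0 (- v k 0).
pose p : 'cV_n := \col_k Num.max 0 (v k 0).
have w_ge0 k : 0 <= w k 0 by rewrite mxE le_max lexx.
have p_ge0 k : 0 <= p k 0 by rewrite mxE le_max lexx.
have vpw : v = p - w.
  apply/colP => k; rewrite !mxE; have [v0|v0] := leP 0 (v k 0).
    by rewrite max_l ?oppr_le0 // subr0.
  by rewrite max_r ?oppr_ge0 ?ltW // opprK add0r.
have wp k : w k 0 * p k 0 = 0.
  rewrite !mxE; have [v0|v0] := leP 0 (v k 0); last by rewrite mulr0.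
  by rewrite max_l ?oppr_le0 // mul0r.
have w0 : w = 0.
  apply/eqP/negPn/negP => /nS; rewrite ltNge => /negP; apply.
  have -> : w = p - v by rewrite vpw opprB addrC subrK.
  rewrite mulmxBr mxE; have -> : p - v = w by rewrite vpw opprB addrC subrK.
  apply: addr_ge0.
    rewrite quad_form; apply: sumr_ge0 => i _; apply: sumr_ge0 => j _.
    have [->|ij] := eqVneq j i; first by rewrite mulrAC wp mul0r.
    by rewrite !mulr_ge0 // mS // eq_sym.
  rewrite -mulmxA Sv mulmxN !mxE opprK sumr_ge0 // => i _.
  by rewrite mxE [const_mx _ _ _]mxE mulr1.
exists v; have Sv' k : (S *m v) k 0 < 0 by rewrite Sv !mxE oppr_lt0.
split=> //; apply: (metzler_lt0_gt0 mS) => // k.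
by rewrite vpw w0 subr0.
Qed.

(** With x_i = v_i r_i, the estimate 2 r_i r_j <= r_i^2 + r_j^2 is allowed off the diagonal, where S
    is nonnegative, and is an equality on it. By symmetry x^T S x <= sum_i r_i^2 v_i (S v)_i. *)
Lemma metzler_lt0_negdef n (S : 'M[R]_n) (v : 'cV_n) : metzler S -> S^T = S ->
  (forall k, 0 < v k 0) -> (forall k, (S *m v) k 0 < 0) -> negdef S.
Proof.
move=> mS sS v0 Sv x x0.
have Sij i j : S i j = S j i by rewrite -[in LHS]sS mxE.
pose r i := x i 0 / v i 0.
have xr i : x i 0 = v i 0 * r i by rewrite /r mulrC divfK // gt_eqF.
apply: (@le_lt_trans _ _ (\sum_i r i ^+ 2 * v i 0 * (S *m v) i 0)).
  rewrite quad_form.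
  apply: (@le_trans _ _ (\sum_i \sum_j v i 0 * S i j * v j 0 * ((r i ^+ 2 + r j ^+ 2) / 2))).
    apply: ler_sum => i _; apply: ler_sum => j _; rewrite !xr.
    have [->|ij] := eqVneq i j; first by rewrite le_eqVlt; apply/orP; left; apply/eqP; field.
    have -> : v i 0 * r i * S i j * (v j 0 * r j) = v i 0 * S i j * v j 0 * (r i * r j) by ring.
    apply: ler_wpM2l; first by rewrite !mulr_ge0 ?mS // ltW.
    by have := sqr_ge0 (r i - r j); nra.
  have -> : \sum_i \sum_j v i 0 * S i j * v j 0 * ((r i ^+ 2 + r j ^+ 2) / 2) =
      \sum_i \sum_j v i 0 * S i j * v j 0 * (r i ^+ 2 / 2) +
      \sum_i \sum_j v i 0 * S i j * v j 0 * (r j ^+ 2 / 2).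
    rewrite -big_split /=; apply: eq_bigr => i _; rewrite -big_split /=.
    by apply: eq_bigr => j _; rewrite mulrDl mulrDr.
  rewrite [X in _ + X]exchange_big /= -big_split /=; apply: ler_sum => i _.
  rewrite mxE mulr_sumr -big_split /=; apply: ler_sum => j _.
  by rewrite [S j i]Sij le_eqVlt; apply/orP; left; apply/eqP; field.
have [k xk] : exists k, x k 0 != 0.
  by apply/cV0Pn.
rewrite (bigD1 k) //= ltr_wnDr //.
  rewrite sumr_le0 // => i _; rewrite mulr_ge0_le0 ?(ltW (Sv i)) //.
  by rewrite mulr_ge0 ?sqr_ge0 // ltW.
rewrite pmulr_rlt0 // mulr_gt0 // exprn_even_gt0 //=.
by rewrite /r mulf_neq0 // invr_neq0 // gt_eqF.
Qed.

(** Finitely many strict inequalities tolerate a common perturbation. The bound holds for all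
    smaller [e], so thresholds from several systems can be merged by a minimum. *)
Lemma strict_perturb (I : finType) (a b c : I -> R) : (forall i, a i < c i) ->
  exists2 eps, 0 < eps & forall e i, 0 < e <= eps -> a i + e * b i < c i.
Proof.
move=> ac.
have /fin_all_exists[d dP] : forall i, exists d : R, 0 < d /\
    forall e, 0 < e -> e <= d -> a i + e * b i < c i.
  move=> i; exists ((c i - a i) / (2 * (`|b i| + 1))).
  have b1 : 0 < `|b i| + 1 by rewrite ltr_wpDl.
  have ca : 0 < c i - a i by rewrite subr_gt0.
  split=> [|e e0]; first by rewrite divr_gt0 // mulr_gt0.
  rewrite ler_pdivlMr ?mulr_gt0 // => ed.
  have := ler_norm (b i); nra.
exists (\big[Num.min/1]_i d i); first by apply: lt_bigmin => // i _; have [] := dP i.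
move=> e i /andP[e0 ed]; have [d0 dd] := dP i; apply: dd => //.
by apply: le_trans ed _; exact: bigmin_le_cond.
Qed.

(** [gain_lt] asks for one constant strictly below [gamma]. The cap at [gamma / 2] on the decrement
    keeps it positive, also when [I] is empty. *)
Lemma exists_lt_max (I : finType) (a : I -> R) (gamma : R) : 0 < gamma ->
  (forall i, a i < gamma) -> exists g, [/\ 0 < g, g < gamma & forall i, a i <= g].
Proof.
move=> gamma0 ag.
have [e e0 ae] := @strict_perturb I a (fun=> 1) (fun=> gamma) ag.
pose e' := Num.min e (gamma / 2); exists (gamma - e').
have e'0 : 0 < e' by rewrite lt_min e0 divr_gt0.
have e'1 : e' <= gamma / 2 by rewrite ge_min lexx orbT.
split; [lra|lra|move=> i].
have e'e : e' <= e by rewrite ge_min lexx.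
by have := ae e i; rewrite e0 lexx => /(_ erefl); lra.
Qed.

(** * The static gain matrix and its strict supersolutions *)

Section StaticGainMatrix.
Variables (n ny nu : nat) (M : 'M[R]_n) (E : 'M[R]_(n, nu)) (G : 'M[R]_(ny, n)).
Variables (F : 'M[R]_(ny, nu)).

(** The matrix H, the transfer function at frequency 0, written with [- invmx M] because this factor
    is entrywise nonnegative. *)
Definition dc_gain : 'M[R]_(ny, nu) := F + G *m (- invmx M) *m E.

Lemma dc_gain_mulmx (v : 'cV[R]_nu) k : (dc_gain *m v) k 0 =
  (F *m v) k 0 + (G *m (- invmx M *m (E *m v))) k 0.
Proof. by rewrite /dc_gain mulmxDl -!mulmxA mxE. Qed.

(** For a Metzler [M] this is equivalent to all eigenvalues having negative real part. *)
Definition hurwitz : Prop :=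
  exists lam : 'cV[R]_n, (forall k, 0 < lam k 0) /\ (forall k, (M *m lam) k 0 < 0).

Hypotheses (mM : metzler M) (E0 : nonneg_mx E) (G0 : nonneg_mx G) (F0 : nonneg_mx F).

Lemma dc_gain_ge0 : hurwitz -> nonneg_mx dc_gain.
Proof.
move=> [lam [lam0 Mlam]] i j; rewrite mxE addr_ge0 //.
by do 2![apply: mulmx_ge0 => //]; exact: metzler_inv_ge0 Mlam.
Qed.

Lemma dc_gain_supersolution (u : 'cV[R]_nu) (c : 'I_ny -> R) : hurwitz -> nonneg_mx u ->
  (forall k, (dc_gain *m u) k 0 < c k) ->
  exists2 l : 'cV[R]_n, (forall k, 0 < l k 0) &
    (forall k, (M *m l + E *m u) k 0 < 0) /\ (forall k, (G *m l + F *m u) k 0 < c k).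
Proof.
move=> [lam [lam0 Mlam]] u0 Hc; have uM := metzler_unit mM lam0 Mlam.
have N0 := metzler_inv_ge0 mM lam0 Mlam.
have [e e0 He] := @strict_perturb _ _ (fun k => (G *m lam) k 0) c Hc.
(* [l0] is the equilibrium for the input [u]: M l0 + E u = 0. Adding [e *: lam] makes this strictly
   negative, with [e] small enough for the output to stay below [c]. *)
pose l0 : 'cV_n := - invmx M *m (E *m u).
exists (l0 + e *: lam) => [k|].
  rewrite mxE ltr_wpDl // ?[X in _ < X]mxE ?mulr_gt0 //.
  by do 2![apply: mulmx_ge0 => //].
split=> k.
  rewrite mulmxDr -scalemxAr mulmxA mulmxN mulmxV // mulNmx mul1mx.
  move: (E *m u) (M *m lam) (Mlam k) => v w wk; rewrite !mxE.
  by rewrite addrAC addNr add0r pmulr_rlt0.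
have {}He := He e k; rewrite e0 lexx in He.
apply: le_lt_trans (He erefl); rewrite dc_gain_mulmx mulmxDr -scalemxAr.
move: (G *m l0) (G *m lam) (F *m u) => v w z; rewrite !mxE.
by rewrite addrAC [v k 0 + _]addrC.
Qed.

Let one : 'cV[R]_nu := const_mx 1.

Lemma sum_dc_gain k : \sum_j dc_gain k j =
  (G *m (- invmx M *m (E *m one))) k 0 + \sum_j F k j.
Proof.
have sum1 (A : 'M[R]_(ny, nu)) : \sum_j A k j = (A *m one) k 0.
  by rewrite mxE; apply: eq_bigr => j _; rewrite mxE mulr1.
by rewrite !sum1 /dc_gain mulmxDl mxE addrC -!mulmxA.
Qed.

(** A feasible [lam] dominates the equilibrium - M^-1 E 1 because - M^-1 is nonnegative; conversely
    a perturbed equilibrium is feasible. Used directly for the L_oo condition and, after transposing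
    all data, for the L_1 condition. *)
Lemma row_cond_dc_gain (gamma : R) :
  (exists2 lam : 'cV[R]_n, (forall k, 0 < lam k 0) &
     (forall k, (M *m lam) k 0 + \sum_j E k j < 0) /\
     (forall k, (G *m lam) k 0 + \sum_j F k j < gamma)) <->
  hurwitz /\ forall k, \sum_j dc_gain k j < gamma.
Proof.
have sum1 k : \sum_j E k j = (E *m one) k 0.
  by rewrite mxE; apply: eq_bigr => j _; rewrite mxE mulr1.
have E1 : nonneg_mx (E *m one) by apply: mulmx_ge0 => // i j; rewrite mxE.
split=> [[lam lam0 [Mlam Glam]]|[[lam [lam0 Mlam]] Hg]].
  have Mlam' k : (M *m lam) k 0 < 0.
    by apply: le_lt_trans (Mlam k); rewrite lerDl sum1.
  split; first by exists lam.
  have uM := metzler_unit mM lam0 Mlam'.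
  have N0 := metzler_inv_ge0 mM lam0 Mlam'.
  move=> k; apply: le_lt_trans (Glam k); rewrite sum_dc_gain lerD2r -subr_ge0.
  have key : - invmx M *m (- (M *m lam + E *m one)) = lam - (- invmx M *m (E *m one)).
    by rewrite mulNmx mulmxN opprK mulmxDr mulmxA mulVmx // mul1mx mulNmx opprK.
  have -> : (G *m lam) k 0 - (G *m (- invmx M *m (E *m one))) k 0 =
     (G *m (- invmx M *m (- (M *m lam + E *m one)))) k 0.
    by rewrite key mulmxBr [RHS]mxE [X in _ = _ + X]mxE.
  apply: mulmx_ge0 => //; apply: mulmx_ge0 => // i j.
  by rewrite mxE oppr_ge0 mxE [j]ord1 -sum1 ltW.
have one0 : nonneg_mx one by move=> i j; rewrite mxE.
have [||l l0 [Ml Gl]] := @dc_gain_supersolution one (fun=> gamma) _ one0.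
- by exists lam.
- move=> k; apply: le_lt_trans (Hg k); rewrite mxE; apply: ler_sum => j _.
  by rewrite [one _ _]mxE mulr1.
exists l => //; split=> k; last first.
  apply: le_lt_trans (Gl k); rewrite [leRHS]mxE lerD2l [leRHS]mxE.
  by apply: ler_sum => j _; rewrite [one _ _]mxE mulr1.
by rewrite sum1; have := Ml k; rewrite mxE.
Qed.

End StaticGainMatrix.

Lemma dc_gain_tr n ny nu (M : 'M[R]_n) (E : 'M[R]_(n, nu)) (G : 'M[R]_(ny, n))
    (F : 'M[R]_(ny, nu)) : dc_gain M^T G^T E^T F^T = (dc_gain M E G F)^T.
Proof.
have NT : (- invmx M)^T = - invmx M^T by rewrite raddfN /= trmx_inv.
by rewrite /dc_gain raddfD /= !trmx_mul NT mulmxA.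
Qed.

Lemma hurwitz_tr n (M : 'M[R]_n) : metzler M -> hurwitz M^T <-> hurwitz M.
Proof.
move=> mM; split=> -[lam [lam0 Mlam]]; last exact: (metzler_lt0_tr mM lam0 Mlam).
by have := metzler_lt0_tr (metzler_tr mM) lam0 Mlam; rewrite trmxK.
Qed.

End MetzlerMatrices.

Lemma within_continuous_sum (R : realType) (I : Type) (r : seq I) (f : I -> R -> R)
    (D : set R) : (forall i, {within D, continuous (f i)}) ->
  {within D, continuous (fun x => \sum_(i <- r) f i x)}.
Proof.
move=> cf; elim: r => [|i r IH].
  rewrite (_ : (fun x => _) = fun=> 0); last by apply/funext => x; rewrite big_nil.
  by apply: continuous_subspaceT => x; exact: cvg_cst.
rewrite (_ : (fun x => _) = fun x => f i x + \sum_(i <- r) f i x); last first.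
  by apply/funext => x; rewrite big_cons.
have cfi : {within D, continuous (f i)} := cf i.
by move=> x; apply: cvgD; [exact: cfi|exact: IH].
Qed.

(** * Stability and gains of the positive system *)

Section HalfLine.
Variable R : realType.
Local Notation mu := (@lebesgue_measure R).
Implicit Type f : R -> R.

Lemma halflineE : @Rplus_set R = \bigcup_i `[0, i%:R]%classic.
Proof.
apply/seteqP; split=> s.
  rewrite /Rplus_set /= in_itv /= andbT => s0; exists (Num.bound s) => //=.
  by rewrite in_itv /= s0 /=; apply/ltW/archi_boundP.
by move=> [i _]; rewrite /Rplus_set /= !in_itv /= => /andP[-> _].
Qed.

Lemma measurable_halfline : measurable (@Rplus_set R : set (measurableTypeR R)).
Proof. exact: measurable_itv. Qed.

Lemma halfline_measurable f : (forall T, 0 <= T -> intble 0 T f) ->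
  measurable_fun (@Rplus_set R) f.
Proof.
move=> fi; rewrite halflineE; apply/measurable_fun_bigcup => // i.
exact: (intble_measurable (fi _ (ler0n _ _))).
Qed.

Lemma integ_EFin a b f : intble a b f ->
  (\int[mu]_(s in `[a, b]) (f s)%:E)%E = (integ a b f)%:E.
Proof. by move=> fi; rewrite /integ /Rintegral fineK //; exact: integrable_fin_num. Qed.

Lemma le_halfline f (C : R) : (forall T, 0 <= T -> intble 0 T f) ->
  (forall t, 0 <= t -> 0 <= f t) -> (forall T, 0 <= T -> integ 0 T f <= C) ->
  (\int[mu]_(t in @Rplus_set R) (f t)%:E <= C%:E)%E.
Proof.
move=> fi f0 fC; rewrite halflineE.
have cv : (\int[mu]_(x in `[0%R, i%:R]) (f x)%:E)%E @[i --> \oo] -->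
    (\int[mu]_(x in \bigcup_i `[0%R, i%:R]%classic) (f x)%:E)%E.
  apply: ge0_nondecreasing_set_cvg_integral => //.
  - move=> i j ij; apply/subsetPset; apply: subset_itv; rewrite bnd_simp //.
    by rewrite ler_nat.
  - by move=> i; apply/measurable_EFinP; exact: (intble_measurable (fi _ (ler0n _ _))).
  - by move=> i t /=; rewrite in_itv /= lee_fin => /andP[t0 _]; exact: f0.
rewrite -(cvg_lim _ cv) //; apply: lime_le.
  by apply/cvg_ex; eexists; exact: cv.
apply: nearW => i; have i0 : 0 <= i%:R :> R by exact: ler0n.
by rewrite integ_EFin ?lee_fin; [exact: fC|exact: fi].
Qed.

Lemma ge_halfline f (T : R) : 0 <= T -> (forall T, 0 <= T -> intble 0 T f) ->
  (forall t, 0 <= t -> 0 <= f t) ->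
  ((integ 0 T f)%:E <= \int[mu]_(t in @Rplus_set R) (f t)%:E)%E.
Proof.
move=> T0 fi f0; rewrite -integ_EFin; last exact: fi.
apply: ge0_subset_integral => //.
- exact: measurable_itv.
- by apply/measurable_EFinP; exact: halfline_measurable.
- by move=> t; rewrite /Rplus_set /= in_itv /= andbT lee_fin; exact: f0.
- by move=> t; rewrite /Rplus_set /= !in_itv /= => /andP[->].
Qed.

Lemma halfline_intble f g : measurable_fun (@Rplus_set R) f ->
  measurable_fun (@Rplus_set R) g -> (forall t, 0 <= t -> `|f t| <= g t) ->
  (\int[mu]_(t in @Rplus_set R) (g t)%:E < +oo)%E -> forall T, intble 0 T f.
Proof.
move=> mf mg fg gfin T.
have gi : mu.-integrable (@Rplus_set R) (EFin \o g).
  apply/integrableP; split; first exact/measurable_EFinP.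
  apply: le_lt_trans gfin; rewrite le_eqVlt; apply/orP; left; apply/eqP.
  apply: eq_integral => t /set_mem; rewrite /Rplus_set /= in_itv /= andbT => t0.
  by rewrite ger0_norm // (le_trans _ (fg t t0)).
have fi : mu.-integrable (@Rplus_set R) (EFin \o f).
  apply: le_integrable gi => //; [exact: measurable_itv|exact/measurable_EFinP|].
  move=> t; rewrite /Rplus_set /= in_itv /= andbT => t0; rewrite lee_fin.
  by apply: le_trans (fg t t0) _; exact: ler_norm.
apply: integrableS fi => //; first exact: measurable_halfline.
by move=> t; rewrite /Rplus_set /= !in_itv /= => /andP[->].
Qed.

Lemma pulse_halfline (c T : R) : 0 <= T ->
  (\int[mu]_(t in @Rplus_set R) (if t <= T then c else 0)%:E = (T * c)%:E)%E.
Proof.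
move=> T0.
transitivity (\int[mu]_(t in `[0%R, T]) (c%:E))%E.
  rewrite integral_mkcond [RHS]integral_mkcond; apply: eq_integral => t _.
  have R1 : (t \in @Rplus_set R) = (0 <= t).
    by apply/idP/idP => [/set_mem|t0]; [|apply/mem_set]; rewrite /Rplus_set /= in_itv /= andbT.
  have R2 : (t \in (`[0, T]%classic : set R)) = (0 <= t <= T).
    by apply/idP/idP => [/set_mem|t0]; [|apply/mem_set]; rewrite /= in_itv.
  by rewrite !patchE R1 R2; case: (0 <= t) => //=; case: ifP.
have := integ_EFin (intble_cst 0 T c) => /= ->.
by rewrite integ_cst // subr0 mulrC.
Qed.

(** This discards the boundary error [K] of the pulse estimates, which does not depend on [T]. *)
Lemma le_of_linear (a b K : R) : (forall T, 0 < T -> T * a - K <= T * b) -> a <= b.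
Proof.
move=> H; rewrite leNgt; apply/negP => ba.
have ab : 0 < a - b by rewrite subr_gt0.
pose T := (`|K| + 1) / (a - b).
have T0 : 0 < T by rewrite divr_gt0 // ltr_wpDl.
have := H T T0; have : T * (a - b) = `|K| + 1 by rewrite divfK // gt_eqF.
by have := ler_norm K; lra.
Qed.

Lemma ae_mono (P Q : R -> Prop) : (forall t, P t -> Q t) ->
  (\forall t \ae mu, P t) -> \forall t \ae mu, Q t.
Proof.
move=> PQ [A [mA A0 PA]]; exists A; split=> // t /= nQ; apply: PA => /= Pt.
exact/nQ/PQ.
Qed.

Lemma ae_le_halfline (a b m : R) f : 0 <= a -> measurable_fun `[a, b] f ->
  (\forall t \ae mu, 0 <= t -> `|f t| <= m) ->
  (\int[mu]_(t in `[a, b]) `|f t|%:E <= \int[mu]_(t in `[a, b]) (`|m|%:E))%E.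
Proof.
move=> a0 mf fm; apply: ae_ge0_le_integral => //.
- by apply/measurable_EFinP; exact: measurableT_comp.
- apply: ae_mono fm => t ft; rewrite /= in_itv /= => /andP[at_ _].
  rewrite lee_fin; apply: le_trans (ler_norm m); apply: ft; exact: le_trans at_.
Qed.

Lemma ae_bounded_intble (m T : R) f : measurable_fun (@Rplus_set R) f ->
  (\forall t \ae mu, 0 <= t -> `|f t| <= m) -> intble 0 T f.
Proof.
move=> mf fm.
have mfT : measurable_fun `[0, T] f.
  apply: measurable_funS mf => //; first exact: measurable_halfline.
  by move=> t; rewrite /Rplus_set /= !in_itv /= => /andP[->].
apply/integrableP; split; first exact/measurable_EFinP.
apply: le_lt_trans (ae_le_halfline (lexx 0) mfT fm) _.
by rewrite integ_EFin ?ltry //; exact: intble_cst.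
Qed.

Lemma ae_bounded_integ (m a b : R) f : 0 <= a -> a <= b -> intble 0 b f ->
  (\forall t \ae mu, 0 <= t -> `|f t| <= m) -> `|integ a b f| <= (b - a) * m.
Proof.
move=> a0 ab fi fm.
have fab : intble a b f by exact: intble_sub fi.
(* For [m < 0] the bound fails at every point of [a, b], which would then be a null set. *)
have m0 : a < b -> 0 <= m.
  move=> a_lt_b; rewrite leNgt; apply/negP => m_lt0.
  case: fm => A [mA A0 fA].
  have : (mu `[a, b] <= 0)%E.
    rewrite -A0; apply: le_measure; rewrite ?inE //= => t; rewrite /= in_itv /= => /andP[at_ _].
    apply: fA => /= H; have := H (le_trans a0 at_).
    by rewrite leNgt (lt_le_trans m_lt0).
  by rewrite lebesgue_measure_itv /= lte_fin a_lt_b -EFinB lee_fin leNgt subr_gt0 a_lt_b.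
move: ab; rewrite le_eqVlt => /predU1P[E|a_lt_b].
  by rewrite E integ_pt normr0 subrr mul0r.
apply: le_trans (integ_norm fab) _.
rewrite mulrC -integ_cst; last exact: ltW.
rewrite -lee_fin -!integ_EFin; [|exact: intble_cst|exact: intble_norm].
have := ae_le_halfline a0 (intble_measurable fab) fm.
by rewrite ger0_norm ?m0.
Qed.

(** [Linfnorm] is an infimum over all extended reals; it is nonnegative because [0, 1] is not a null
    set. *)
Lemma ae_halfline_ge0 (f : R -> R) (M : \bar R) :
  (\forall t \ae mu, (0 <= t)%R -> ((f t)%:E <= M)%E) -> (forall t, 0 <= f t) -> (0 <= M)%E.
Proof.
move=> [A [mA A0 fA]] f0; rewrite leNgt; apply/negP => M0.
have : (mu `[0%R, 1%R] <= 0)%E.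
  rewrite -A0; apply: le_measure; rewrite ?inE //= => t; rewrite /= in_itv /= => /andP[t0 _].
  apply: fA => /= H; have := H t0; apply/negP; rewrite -ltNge.
  by apply: lt_le_trans M0 _; rewrite lee_fin.
by rewrite lebesgue_measure_itv /= lte_fin ltr01 -EFinB lee_fin subr0 ler10.
Qed.

End HalfLine.

(** * Responses of the positive system to inputs *)

Section Responses.
Variables (R : realType) (n ny nu N : nat) (S : system R n ny nu N).
Hypotheses (mA0 : metzler (sA0 S)) (E_ge0 : nonneg_mx (sEu S)).
Hypotheses (F_ge0 : nonneg_mx (sFu S)) (C0_ge0 : nonneg_mx (sC0 S)).
Hypothesis h_gt0 : forall i, 0 < sh S i.
Hypotheses (Ai : forall i, entrywise_integrable (sh S i) (sA S i))
           (Ci : forall i, entrywise_integrable (sh S i) (sC S i))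
           (A_ge0 : forall i, entrywise_nonneg_on (sh S i) (sA S i))
           (C_ge0 : forall i, entrywise_nonneg_on (sh S i) (sC S i)).
Local Notation h := (sh S).
Local Notation H := (hmax S).
Local Notation mu := (@lebesgue_measure R).

Let Ai' : kernel_intble h (sA S). Proof. exact: Ai. Qed.
Let Ci' : kernel_intble h (sC S). Proof. exact: Ci. Qed.
Let A_ge0' : kernel_ge0 h (sA S). Proof. exact: A_ge0. Qed.
Let C_ge0' : kernel_ge0 h (sC S). Proof. exact: C_ge0. Qed.

Let H0 : 0 <= H.
Proof. exact: max_delay_ge0. Qed.

Definition coords m (x : R -> 'cV[R]_m) : R -> 'I_m -> R := fun t j => x t j 0.

Definition loc_intble (u : R -> 'I_nu -> R) := forall T j, intble 0 T (u^~ j).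

Definition forcing (u : R -> 'I_nu -> R) (t : R) (k : 'I_n) : R :=
  \sum_j sEu S k j * integ 0 t (u^~ j).

(** The initial function is left free, so that responses can be added and scaled; continuity reaches
    back to [- H] because delay windows are shifted into the past. *)
Definition response (u : R -> 'I_nu -> R) (x : R -> 'I_n -> R) :=
  traj h (sA0 S) (sA S) (forcing u) x /\
  forall j, {within `[- H, +oo[, continuous (x^~ j)}.

Definition out (u : R -> 'I_nu -> R) (x : R -> 'I_n -> R) (t : R) (k : 'I_ny) : R :=
  lin h (sC0 S) (sC S) x t k + \sum_j sFu S k j * u t j.

Lemma state_rhsE x u t k : state_rhs S x u t k 0 =
  lin h (sA0 S) (sA S) (coords x) t k + \sum_j sEu S k j * u t j 0.
Proof.
rewrite /state_rhs !mxE summxE; congr (_ + _ + _).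
by apply: eq_bigr => i _; rewrite mxE.
Qed.

Lemma outputE x u t k : output S x u t k 0 = out (coords u) (coords x) t k.
Proof.
rewrite /output !mxE summxE; congr (_ + _ + _).
by apply: eq_bigr => i _; rewrite mxE.
Qed.

Lemma coords_rhs_integ x u t k : tame h (coords x) -> loc_intble (coords u) -> 0 <= t ->
  integ 0 t (fun s => state_rhs S x u s k 0) =
  integ 0 t (fun s => lin h (sA0 S) (sA S) (coords x) s k) + forcing (coords u) t k.
Proof.
move=> tx lu t0; rewrite (@eq_integ _ _ _ _ (fun s =>
    lin h (sA0 S) (sA S) (coords x) s k + \sum_j sEu S k j * coords u s j)); last first.
  by move=> s _; rewrite state_rhsE.
rewrite integD; last 2 first.
- exact: lin_intble.
- by apply: intble_sum => j; apply: intbleZ.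
congr (_ + _); rewrite integ_sum; last by move=> j; apply: intbleZ.
by apply: eq_bigr => j _; rewrite integZ.
Qed.

Lemma tame_continuous (x : R -> 'I_n -> R) :
  (forall j, {within `[- H, +oo[, continuous (x^~ j)}) -> tame h x.
Proof.
move=> cx T j.
have cxj : {within `[- H, +oo[, continuous (x^~ j)} := cx j.
have cT : {within `[- H, T], continuous (x^~ j)}.
  by apply: continuous_subspaceW cxj => s /=; rewrite !in_itv /= andbT => /andP[].
split; last exact: continuous_bounded.
exact: (intble_measurable (intble_continuous cT)).
Qed.

Lemma within_continuous_glue (f : R -> R) : {within `[- H, 0], continuous f} ->
  {within `[0, +oo[, continuous f} -> {within `[- H, +oo[, continuous f}.
Proof.
move=> c1 c2; rewrite (_ : `[- H, +oo[%classic = (`[- H, 0] `|` `[0, +oo[)%classic).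
  by apply: withinU_continuous => //; exact: interval_closed.
apply/seteqP; split=> s /=; rewrite !in_itv /= !andbT.
  by move=> Hs; case: (leP s 0) => s0; [left|right]; rewrite ?Hs ?s0 // ltW.
by case=> [/andP[]//|s0]; apply: le_trans s0; rewrite oppr_le0.
Qed.

Lemma response_of_solution phi u x : init_ok S phi -> loc_intble (coords u) ->
  solution S phi u x -> response (coords u) (coords x).
Proof.
move=> iphi lu [xphi cx xE].
have cxH j : {within `[- H, +oo[, continuous ((coords x)^~ j)}.
  apply: within_continuous_glue; last exact: cx.
  apply: (@subspace_eq_continuous _ _ _ (fun t => phi t j 0)) => [s /set_mem sH|].
    move: sH; rewrite /= in_itv /= => sH.
    by rewrite /from_subspace /coords xphi.
  exact: iphi.
have tx : tame h (coords x) by exact: tame_continuous.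
split=> //; split=> // t k t0.
by rewrite /coords (xE t t0) !mxE -addrA -coords_rhs_integ.
Qed.

Lemma solution_of_response u y (v : 'cV[R]_n) : loc_intble (coords u) -> response (coords u) y ->
  (forall s k, s <= 0 -> y s k = v k 0) ->
  solution S (fun=> v) u (fun t => \col_k y t k).
Proof.
move=> lu [[ty yE] cy] yv; split.
- by move=> t /andP[_ t0]; apply/colP => k; rewrite mxE yv.
- move=> k; have cyk : {within `[- H, +oo[, continuous (y^~ k)} := cy k.
  have cyk0 : {within @Rplus_set R, continuous (y^~ k)}.
    apply: continuous_subspaceW cyk => s; rewrite /Rplus_set /= !in_itv /= !andbT.
    by apply: le_trans; rewrite oppr_le0.
  apply: (@subspace_eq_continuous _ _ _ (y^~ k)) => // s _.
  by rewrite /from_subspace mxE.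
- have cy' : coords (fun t => \col_k y t k) = y.
    by apply/funext => t; apply/funext => k; rewrite /coords mxE.
  move=> t t0; apply/colP => k; rewrite !mxE yE //.
  rewrite -[\int[mu]_(s in _) _]/(integ 0 t _) coords_rhs_integ ?cy' //.
  by rewrite addrA.
Qed.

Lemma responseD u v x y : loc_intble u -> loc_intble v -> response u x -> response v y ->
  response (fun t j => u t j + v t j) (fun t k => x t k + y t k).
Proof.
move=> lu lv [tx cx] [ty cy]; split; last by move=> j s; apply: cvgD; [exact: cx|exact: cy].
have [t E] := trajD h_gt0 Ai' tx ty; split=> // s k s0; rewrite E //; congr (_ + _).
rewrite /forcing -big_split /=; apply: eq_bigr => j _.
by rewrite integD // mulrDr.
Qed.

Lemma responseZ c u x : loc_intble u -> response u x ->
  response (fun t j => c * u t j) (fun t k => c * x t k).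
Proof.
move=> lu [tx cx]; split; last by move=> j s; apply: cvgM; [exact: cvg_cst|exact: cx].
have [t E] := trajZ h_gt0 Ai' c tx; split=> // s k s0; rewrite E //; congr (_ + _).
rewrite /forcing mulr_sumr; apply: eq_bigr => j _.
by rewrite integZ // mulrCA.
Qed.

Lemma outD u v x y t k : 0 <= t -> response u x -> response v y ->
  out (fun t j => u t j + v t j) (fun t k => x t k + y t k) t k = out u x t k + out v y t k.
Proof.
move=> t0 [[tx _] _] [[ty _] _]; rewrite /out linD //.
by under eq_bigr do rewrite mulrDr; rewrite big_split /=; ring.
Qed.

Lemma outZ c u x t k : 0 <= t -> response u x ->
  out (fun t j => c * u t j) (fun t k => c * x t k) t k = c * out u x t k.
Proof.
move=> t0 [[tx _] _]; rewrite /out linZ //.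
by under eq_bigr do rewrite mulrCA; rewrite -mulr_sumr; ring.
Qed.

Lemma traj_ge0H G (y : R -> 'I_n -> R) : traj h (sA0 S) (sA S) G y ->
  (forall j, {within `[- H, +oo[, continuous (y^~ j)}) ->
  (forall k a b, 0 <= a -> a <= b -> G a k <= G b k) ->
  (forall s k, - H <= s <= 0 -> 0 <= y s k) ->
  forall t k, - H <= t -> 0 <= y t k.
Proof.
move=> ty cy Gmono y0 t k Ht; have [t0|t0] := leP t 0; first by rewrite y0 // Ht.
apply: (traj_ge0 h_gt0 Ai' mA0 A_ge0' ty _ Gmono y0); last exact: ltW.
move=> j; have cyj : {within `[- H, +oo[, continuous (y^~ j)} := cy j.
apply: continuous_subspaceW cyj => s /=; rewrite !in_itv /= !andbT.
by apply: le_trans; rewrite oppr_le0.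
Qed.

(** The state sees [u] only through its primitive, so nonnegative integrals of [u] make the forcing
    nondecreasing. *)
Lemma response_ge0 u x : loc_intble u -> response u x ->
  (forall j a b, 0 <= a -> a <= b -> 0 <= integ a b (u^~ j)) ->
  (forall s k, - H <= s <= 0 -> 0 <= x s k) ->
  forall t k, - H <= t -> 0 <= x t k.
Proof.
move=> lu [tx cx] u0 x0; apply: (traj_ge0H tx cx) => // k a b a0 ab.
apply: ler_sum => j _; apply: ler_wpM2l => //.
by rewrite (@integ_cat _ 0 a b) // lerDl u0.
Qed.

Lemma out_ge0 u x t k : 0 <= t -> (forall j, 0 <= u t j) ->
  (forall s j, - H <= s -> 0 <= x s j) -> 0 <= out u x t k.
Proof.
move=> t0 u0 x0; apply: addr_ge0.
  by apply: lin_ge0 => // s j /andP[Hs _]; exact: x0.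
by apply: sumr_ge0 => j _; apply: mulr_ge0.
Qed.

Lemma out_intble u x T k : loc_intble u -> response u x -> 0 <= T ->
  intble 0 T (fun t => out u x t k).
Proof.
move=> lu [[tx _] _] T0; apply: intbleD; first exact: lin_intble.
by apply: intble_sum => j; apply: intbleZ.
Qed.

Lemma out_integ u x T k : loc_intble u -> response u x -> 0 <= T ->
  integ 0 T (fun t => out u x t k) =
  integ 0 T (fun t => lin h (sC0 S) (sC S) x t k) + \sum_j sFu S k j * integ 0 T (u^~ j).
Proof.
move=> lu [[tx _] _] T0; rewrite integD; last 2 first.
- exact: lin_intble.
- by apply: intble_sum => j; apply: intbleZ.
rewrite integ_sum; last by move=> j; apply: intbleZ.
by congr (_ + _); apply: eq_bigr => j _; rewrite integZ.
Qed.

Lemma response_exists u (v : 'I_n -> R) : loc_intble u ->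
  exists2 x, response u x & forall s k, s <= 0 -> x s k = v k.
Proof.
move=> lu.
have cF k : {within `[0, +oo[, continuous ((forcing u)^~ k)}.
  apply: within_continuousy => T T0.
  apply: (@within_continuous_sum _ _ _ (fun j t => sEu S k j * integ 0 t (u^~ j))) => j.
  have cj : {within `[0, T], continuous (fun t => integ 0 t (u^~ j))}.
    exact: continuous_integ.
  by move=> s; apply: cvgM; [exact: cvg_cst|exact: cj].
have F00 k : forcing u 0 k = 0.
  by rewrite /forcing big1 // => j _; rewrite integ_pt mulr0.
have [x tx xv] := traj_exists h_gt0 (sA0 S) Ai' v cF F00.
exists x => //; split=> // j; apply: within_continuous_glue.
  apply: (@subspace_eq_continuous _ _ _ (fun=> v j)) => [s /set_mem sH|].
    by move: sH; rewrite /= in_itv /= => /andP[_ s0]; rewrite /from_subspace xv.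
  by apply: continuous_subspaceT => s; exact: cvg_cst.
have cFj : {within `[0, +oo[, continuous ((forcing u)^~ j)} := cF j.
exact: (continuous_forcing_traj h_gt0 Ai' tx cFj).
Qed.

Local Notation M := (static h (sA0 S) (sA S)).
Local Notation G := (static h (sC0 S) (sC S)).
Local Notation Nm := (- invmx M).
Local Notation DC := (dc_gain M (sEu S) G (sFu S)).

Lemma static_metzler : metzler M.
Proof.
move=> i j ij; rewrite staticE addr_ge0 ?mA0 // sumr_ge0 // => k _.
by apply: integ_ge0 => s hs; apply: A_ge0.
Qed.

Lemma static_out_ge0 : nonneg_mx G.
Proof.
move=> i j; rewrite staticE addr_ge0 ?C0_ge0 // sumr_ge0 // => k _.
by apply: integ_ge0 => s hs; apply: C_ge0.
Qed.

Lemma response_rest u x k t : response u x -> (forall s j, - H <= s <= 0 -> x s j = 0) ->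
  0 <= t -> x t k = integ 0 t (fun s => lin h (sA0 S) (sA S) x s k) + forcing u t k.
Proof.
move=> [[_ xE] _] x0 t0; rewrite xE // x0 ?add0r // lexx andbT oppr_le0; exact: H0.
Qed.

Lemma continuous_past (x : R -> 'I_n -> R) T j : (forall j, {within `[- H, +oo[, continuous (x^~ j)}) ->
  {within `[- H, T], continuous (x^~ j : R -> R)}.
Proof.
move=> cx; have cxj : {within `[- H, +oo[, continuous (x^~ j)} := cx j.
by apply: continuous_subspaceW cxj => s /=; rewrite !in_itv /= andbT => /andP[].
Qed.

Lemma colE_mulmx m p (A : 'M[R]_(m, p)) (f : 'I_p -> R) k :
  \sum_j A k j * f j = (A *m \col_j f j) k 0.
Proof. by rewrite mxE; apply: eq_bigr => j _; rewrite mxE. Qed.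

(** If M v <= 0 this forcing is nondecreasing, so [v] becomes a supersolution of the unforced
    equation. *)
Lemma traj_cst (v : 'cV[R]_n) :
  traj h (sA0 S) (sA S) (fun t k => - (t * (M *m v) k 0)) (fun _ k => v k 0).
Proof.
split; first exact: tame_cst.
move=> t k t0; rewrite (@eq_integ _ _ _ _ (fun=> (M *m v) k 0)) ?integ_cst //; last first.
  by move=> s _; rewrite lin_cst // mxE.
by rewrite subr0 mulrC addrK.
Qed.

Section Hurwitz.
Hypothesis hur : hurwitz M.

Let N_ge0 : nonneg_mx Nm.
Proof. by have [lam [lam0 Mlam]] := hur; exact: (metzler_inv_ge0 static_metzler lam0 Mlam). Qed.

Let uM : M \in unitmx.
Proof. by have [lam [lam0 Mlam]] := hur; exact: (metzler_unit static_metzler lam0 Mlam). Qed.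

Let M_le0 (x : 'cV[R]_n) : (forall k, (M *m x) k 0 <= 0) -> forall k, 0 <= x k 0.
Proof. by have [lam [lam0 Mlam]] := hur; exact: (metzler_le0_ge0 static_metzler lam0 Mlam). Qed.

Let M_le (x y : 'cV[R]_n) : (forall k, (M *m y) k 0 <= (M *m x) k 0) ->
  forall k, x k 0 <= y k 0.
Proof.
move=> Mxy k.
have sub (a b : 'cV[R]_n) i : (a - b) i 0 = a i 0 - b i 0 by rewrite !mxE.
by rewrite -subr_ge0 -sub; apply: M_le0 => i; rewrite mulmxBr sub subr_le0.
Qed.

(* Integrating the state equation over [0, T] gives M X + E U >= x(T) >= 0 for
   the integrals X, U of x, u; hence X <= - M^-1 E U. *)
Lemma out_integ_le u x T k : loc_intble u -> (forall j t, 0 <= t -> 0 <= u t j) ->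
  response u x -> (forall s j, - H <= s <= 0 -> x s j = 0) -> 0 <= T ->
  integ 0 T (fun t => out u x t k) <= \sum_j DC k j * integ 0 T (u^~ j).
Proof.
move=> lu u0 rx xz T0.
have x_ge0 : forall s j, - H <= s -> 0 <= x s j.
  apply: (response_ge0 lu rx) => [j a b a0 ab|s j sH]; last by rewrite xz.
  by apply: integ_ge0 => s /andP[as_ _]; apply: u0; exact: le_trans as_.
have [[tx _] cx] := rx.
have cxT j := @continuous_past x T j cx.
have x_ge0' s j : - H <= s <= T -> 0 <= x s j by move=> /andP[Hs _]; exact: x_ge0.
pose X : 'cV[R]_n := \col_j integ 0 T (x^~ j).
pose U : 'cV[R]_nu := \col_j integ 0 T (u^~ j).
have XU j : X j 0 <= (Nm *m (sEu S *m U)) j 0.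
  apply: M_le j => i; rewrite mulmxA mulmxN mulmxV // mulNmx mul1mx [leLHS]mxE.
  have := lin_integ_le h_gt0 (sA0 S) Ai' A_ge0' i tx T0 cxT x_ge0' xz.
  have := response_rest i rx xz T0; rewrite /forcing !colE_mulmx -/X -/U.
  have : 0 <= x T i by apply: x_ge0; apply: le_trans T0; rewrite oppr_le0.
  by lra.
rewrite out_integ // !colE_mulmx -/U dc_gain_mulmx addrC lerD2l.
apply: le_trans (lin_integ_le h_gt0 (sC0 S) Ci' C_ge0' k tx T0 cxT x_ge0' xz) _.
rewrite colE_mulmx -/X mxE [leRHS]mxE; apply: ler_sum => j _.
by apply: ler_wpM2l; [exact: static_out_ge0|exact: XU].
Qed.

(* The constant l = - M^-1 E w is the equilibrium for the input w, so l - x is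
   a trajectory with nondecreasing forcing. *)
Lemma response_le u x (w : 'cV[R]_nu) : loc_intble u -> nonneg_mx w ->
  (forall j a b, 0 <= a -> a <= b -> integ a b (u^~ j) <= (b - a) * w j 0) ->
  response u x -> (forall s j, - H <= s <= 0 -> x s j = 0) ->
  forall t k, - H <= t -> x t k <= (Nm *m (sEu S *m w)) k 0.
Proof.
move=> lu w0 uw rx xz t k Ht; have [tx cx] := rx.
pose l := Nm *m (sEu S *m w).
have l_ge0 : nonneg_mx l by do 2![apply: mulmx_ge0 => //].
have Ml : M *m l = - (sEu S *m w) by rewrite /l mulmxA mulmxN mulmxV // mulNmx mul1mx.
have tl := trajD h_gt0 Ai' (traj_cst l) (trajZ h_gt0 Ai' (-1) tx).
suff : 0 <= l k 0 + -1 * x t k by rewrite /l; lra.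
apply: (traj_ge0H tl) Ht.
- move=> j s; have cxj : {within `[- H, +oo[, continuous (x^~ j)} := cx j.
  by apply: cvgD; [exact: cvg_cst|apply: cvgM; [exact: cvg_cst|exact: cxj]].
- move=> i a b a0 ab; rewrite Ml mxE !mulrN !opprK !mulN1r.
  rewrite -subr_ge0.
  have -> : b * (sEu S *m w) i 0 - forcing u b i - (a * (sEu S *m w) i 0 - forcing u a i) =
     (b - a) * (sEu S *m w) i 0 - (forcing u b i - forcing u a i) by ring.
  rewrite subr_ge0 /forcing -sumrB mxE mulr_sumr; apply: ler_sum => j _.
  rewrite -mulrBr mulrCA; apply: ler_wpM2l => //.
  by rewrite (@integ_cat _ 0 a b) // addrAC subrr add0r uw.
- by move=> s j sH; rewrite xz // mulr0 addr0.
Qed.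

Definition pulse (w : 'cV[R]_nu) (T : R) : R -> 'I_nu -> R :=
  fun t j => if t <= T then w j 0 else 0.

Lemma pulse_loc_intble w T : loc_intble (pulse w T).
Proof.
move=> T' j.
have [TT'|TT'] := leP T' T.
  apply: (@eq_intble _ _ _ (fun=> w j 0)); last exact: intble_cst.
  by move=> s /andP[_ sT']; rewrite /pulse (le_trans sT').
have mp : measurable_fun setT ((pulse w T)^~ j).
  apply: measurable_fun_if => //; try exact: measurable_cst.
  exact: measurable_fun_ler.
apply: (@le_intble _ _ _ _ (fun=> `|w j 0|)); last exact: intble_cst.
  exact: measurable_funS mp.
by move=> s _; rewrite /pulse; case: ifP; rewrite ?normr0.
Qed.

Lemma pulse_integ w T j : 0 <= T -> integ 0 T ((pulse w T)^~ j) = T * w j 0.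
Proof.
move=> T0; rewrite (@eq_integ _ _ _ _ (fun=> w j 0)) ?integ_cst // ?subr0 1?mulrC //.
by move=> s /andP[_ sT]; rewrite /pulse sT.
Qed.

(* K absorbs the parts of the delay windows which leave [0, T]; they are
   bounded independently of T because x stays below the equilibrium l. *)
Lemma pulse_out_ge (w : 'cV[R]_nu) : nonneg_mx w -> exists K : 'I_ny -> R,
  forall T, 0 < T -> exists x, [/\ response (pulse w T) x,
    (forall s k, s <= 0 -> x s k = 0),
    (forall t k, 0 <= t -> 0 <= out (pulse w T) x t k) &
    forall k, T * (DC *m w) k 0 - K k <= integ 0 T (fun t => out (pulse w T) x t k)].
Proof.
move=> w0; pose l := Nm *m (sEu S *m w).
have l_ge0 : nonneg_mx l by do 2![apply: mulmx_ge0 => //].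
pose d := \sum_k l k 0.
have d0 : 0 <= d by apply: sumr_ge0 => k _; exact: l_ge0.
have ld k : l k 0 <= d by rewrite /d (bigD1 k) //= lerDl sumr_ge0.
(* [b] bounds the final state x(T) <= l plus the window loss of the state equation, so that M X <= -
   T E w + b. Since - M^-1 is nonnegative, X >= T l + M^-1 b. *)
pose b : 'cV[R]_n := \col_k (l k 0 + delay_mass h (sA S) k * d).
pose K k := (G *m (Nm *m b)) k 0 + delay_mass h (sC S) k * d.
exists K => T T0.
have lp := pulse_loc_intble w T.
have [x rx xz] := response_exists (fun=> 0) lp.
have p_ge0 t j : 0 <= pulse w T t j by rewrite /pulse; case: ifP.
have x_ge0 : forall s j, - H <= s -> 0 <= x s j.
  apply: (response_ge0 lp rx) => [j a b' a0 ab|s j /andP[_ s0]]; last by rewrite xz.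
  by apply: integ_ge0 => s _.
have xz' s j : - H <= s <= 0 -> x s j = 0 by move=> /andP[_ s0]; rewrite xz.
have xl : forall t k, - H <= t -> x t k <= l k 0.
  apply: (response_le lp) => // j a b' a0 ab.
  rewrite mulrC -integ_cst //; apply: le_integ => //.
  - exact: intble_sub (lp b' j).
  - exact: intble_cst.
  - by move=> s _; rewrite /pulse; case: ifP.
exists x; split=> //; first by move=> t k t0; exact: out_ge0.
move=> k; have [[tx _] cx] := rx.
have cxT j := @continuous_past x T j cx.
have x_ge0' s j : - H <= s <= T -> 0 <= x s j by move=> /andP[Hs _]; exact: x_ge0.
have xd s j : T - H <= s <= T -> x s j <= d.
  move=> /andP[Ts _]; apply: le_trans (ld j); apply: xl.
  by apply: le_trans Ts; rewrite lerDr ltW.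
pose X : 'cV[R]_n := \col_j integ 0 T (x^~ j).
have pE : (\col_j integ 0 T ((pulse w T)^~ j)) = T *: w.
  by apply/colP => j; rewrite !mxE pulse_integ // ltW.
have T0' := ltW T0.
have XU j : (T *: l - Nm *m b) j 0 <= X j 0.
  apply: M_le j => i.
  rewrite mulmxBr -scalemxAr /l mulmxA mulmxN mulmxV // mulNmx mul1mx mulmxA mulmxN mulmxV // mulNmx mul1mx opprK.
  have := lin_integ_ge h_gt0 (sA0 S) Ai' A_ge0' i tx T0' d0 cxT x_ge0' xd.
  have := response_rest i rx xz' T0'.
  rewrite /forcing !colE_mulmx pE -scalemxAr -/X.
  have := xl T i; rewrite (le_trans _ T0') ?oppr_le0 // => /(_ erefl).
  rewrite /b.
  move: (sEu S *m w) (M *m X) => Ew MX; rewrite !mxE; lra.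
rewrite out_integ // !colE_mulmx pE -scalemxAr.
have := lin_integ_ge h_gt0 (sC0 S) Ci' C_ge0' k tx T0' d0 cxT x_ge0' xd.
rewrite colE_mulmx -/X /K.
have : (G *m (T *: l - Nm *m b)) k 0 <= (G *m X) k 0.
  rewrite mxE [leRHS]mxE; apply: ler_sum => j _; apply: ler_wpM2l; last exact: XU.
  exact: static_out_ge0.
rewrite mulmxBr -scalemxAr dc_gain_mulmx -/l.
move: (G *m l) (G *m (Nm *m b)) (G *m X) (sFu S *m w) => a1 a2 a3 a4.
by rewrite !mxE; lra.
Qed.

End Hurwitz.

(** * Asymptotic stability and the static matrix *)

Lemma vnorminf_lt m (v : 'cV[R]_m) e : 0 < e -> (forall k, `|v k 0| < e) -> vnorminf v < e.
Proof. by move=> e0 ve; apply: bigmax_lt => // k _; exact: ve. Qed.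

Lemma le_vnorminf m (v : 'cV[R]_m) k : `|v k 0| <= vnorminf v.
Proof. exact: le_bigmax_cond. Qed.

Lemma loc_intble0 : loc_intble (coords (fun=> 0)).
Proof.
move=> T j; apply: (@eq_intble _ _ _ (fun=> 0)); last exact: intble_cst.
by move=> s _; rewrite /coords mxE.
Qed.

Lemma forcing0 t k : forcing (coords (fun=> 0)) t k = 0.
Proof.
rewrite /forcing big1 // => j _; rewrite (@eq_integ _ _ _ _ (fun=> 0)) ?integ0 ?mulr0 //.
by move=> s _; rewrite /coords mxE.
Qed.

(** Positivity is applied to z + y and z - y, which have the forcing of [z] and start
    nonnegative. *)
Lemma response0_le y z Gz : response (coords (fun=> 0)) y ->
  traj h (sA0 S) (sA S) Gz z ->
  (forall j, {within `[- H, +oo[, continuous (z^~ j)}) ->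
  (forall k a b, 0 <= a -> a <= b -> Gz a k <= Gz b k) ->
  (forall s k, - H <= s <= 0 -> `|y s k| <= z s k) ->
  forall t k, - H <= t -> `|y t k| <= z t k.
Proof.
move=> [ty cy] tz cz Gmono yz t k Ht.
have side c : c = 1 \/ c = -1 -> 0 <= z t k + c * y t k.
  move=> c1; have tc := trajD h_gt0 Ai' tz (trajZ h_gt0 Ai' c ty).
  apply: (traj_ge0H tc) Ht.
  - move=> j s; have cyj : {within `[- H, +oo[, continuous (y^~ j)} := cy j.
    have czj : {within `[- H, +oo[, continuous (z^~ j)} := cz j.
    by apply: cvgD; [exact: czj|apply: cvgM; [exact: cvg_cst|exact: cyj]].
  - by move=> i a b a0 ab; rewrite !forcing0 mulr0 !addr0; exact: Gmono.
  - move=> s j sH; have := yz s j sH; rewrite ler_norml => /andP[].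
    by case: c1 => ->; lra.
have := side 1 (or_introl erefl); have := side (-1) (or_intror erefl).
by rewrite ler_norml; lra.
Qed.

(* For M lam < 0, the functions kap * lam and kap * exp (- al t) * lam are
   supersolutions, hence dominate |x| as soon as they dominate it initially. *)
Lemma hurwitz_asymp_stable : hurwitz M -> asymp_stable S.
Proof.
move=> [lam [lam0 Mlam]]; split.
  move=> eps eps0.
  pose sl := \sum_k lam k 0.
  have sl0 : 0 <= sl by apply: sumr_ge0 => k _; exact: ltW.
  have lsl k : lam k 0 <= sl by rewrite /sl (bigD1 k) //= lerDl sumr_ge0 // => j _; exact: ltW.
  pose kap := eps / (sl + 1).
  have sl1 : 0 < sl + 1 by lra.
  have kap0 : 0 < kap by rewrite divr_gt0.
  (* Initial data below this minimum lie below [kap *: lam], all of whose components are less than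
     [eps]. *)
  exists (\big[Num.min/1]_k (kap * lam k 0)).
    by apply: lt_bigmin => // k _; rewrite mulr_gt0.
  move=> phi x iphi phid sx t t0.
  have rx := response_of_solution iphi loc_intble0 sx.
  have [xphi _ _] := sx.
  apply: vnorminf_lt => // k.
  have : `|coords x t k| <= (kap *: lam) k 0.
    apply: (response0_le rx (traj_cst (kap *: lam))).
    - by move=> j; apply: continuous_subspaceT => s; exact: cvg_cst.
    - move=> i a b a0 ab; rewrite -scalemxAr mxE lerN2; apply: ler_wnM2r => //.
      by rewrite pmulr_rle0 // ltW.
    - move=> s j sH; rewrite /coords xphi // mxE.
      apply: le_trans (le_vnorminf _ j) _; apply: le_trans (ltW (phid s sH)) _.
      exact: bigmin_le_cond.
    - by apply: le_trans t0; rewrite oppr_le0.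
  move=> xk; apply: le_lt_trans xk _; rewrite mxE /kap mulrAC ltr_pdivrMr // ltr_pM2l //.
  by have := lsl k; lra.
move=> phi x iphi sx eps eps0.
have rx := response_of_solution iphi loc_intble0 sx.
pose Ab k := \sum_j \sum_i integ (- h i) 0 (fun s => sA S i s k j) * lam j 0.
have Ab0 k : 0 <= Ab k.
  apply: sumr_ge0 => j _; apply: sumr_ge0 => i _; apply: mulr_ge0; last exact: ltW.
  by apply: integ_ge0 => s hs; apply: A_ge0.
have MlamE k : (M *m lam) k 0 = \sum_j sA0 S k j * lam j 0 + Ab k.
  rewrite mxE /Ab -big_split /=; apply: eq_bigr => j _.
  by rewrite staticE mulrDl mulr_suml.
(* The perturbation pays for a decay rate [al]: [lam k 0] for the derivative of the exponential and
   [2 * H * Ab k] for the delayed terms, which grow by at most exp(al H) <= 1 + 2 al H. *)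
have [al' al'0 Hal] := @strict_perturb _ _ (fun k => (M *m lam) k 0)
  (fun k => lam k 0 + 2 * H * Ab k) (fun=> 0) Mlam.
pose al := Num.min al' (1 / (2 * (H + 1))).
have H1 : 0 < H + 1 by have := H0; lra.
have al0 : 0 < al by rewrite lt_min al'0 divr_gt0 // mulr_gt0.
have alH : al * H <= 1 / 2.
  have : al <= 1 / (2 * (H + 1)) by rewrite ge_min lexx orbT.
  rewrite ler_pdivlMr ?mulr_gt0 //; have := H0; nra.
(* From exp(- a) >= 1 - a one gets exp a <= 1 / (1 - a) <= 1 + 2 a for 0 <= a <= 1 / 2, here with a
   = al H. *)
have expb th : - H <= th <= 0 -> expR (- al * th) <= 1 + 2 * (al * H).
  move=> /andP[Hth th0]; apply: (@le_trans _ _ (expR (al * H))).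
    by rewrite ler_expR mulNr -mulrN; apply: ler_wpM2l; [exact: ltW|lra].
  have := expR_ge1Dx (- (al * H)); rewrite expRN.
  have e0 := expR_gt0 (al * H).
  rewrite -[X in _ <= X]mul1r ler_pdivlMr // => He.
  have aH0 : 0 <= al * H by rewrite mulr_ge0 // ltW.
  by nra.
pose cc k := \sum_j sA0 S k j * lam j 0 +
  \sum_i \sum_j lam j 0 * integ (- h i) 0 (fun th => sA S i th k j * expR (- al * th)).
have ccal k : cc k <= - al * lam k 0.
  have al1 : 0 < al <= al' by rewrite al0 ge_min lexx.
  have := Hal al k al1; rewrite MlamE.
  suff : \sum_i \sum_j lam j 0 * integ (- h i) 0 (fun th => sA S i th k j * expR (- al * th)) <=
      (1 + 2 * (al * H)) * Ab k by rewrite /cc; nra.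
  rewrite exchange_big /Ab mulr_sumr; apply: ler_sum => j _ /=.
  rewrite mulr_sumr; apply: ler_sum => i _.
  rewrite [leLHS]mulrC [leRHS]mulrA; apply: ler_wpM2r; first exact: ltW.
  have ce : {within `[- h i, 0], continuous (fun th : R => 1 * expR (- al * th))}.
    exact/continuous_subspaceT/continuous_Zexp.
  rewrite -integZ //; apply: le_integ.
  - have [C CP] := continuous_bounded ce.
    apply: (@intbleMb _ _ _ _ _ C) => // [|s sh].
      apply: (intble_measurable (eq_intble _ (intble_Zexp 1 (- al) _ _))) => s _.
      by rewrite mul1r.
    by have := CP s sh; rewrite mul1r.
  - exact: intbleZ.
  - move=> th hth; rewrite mulrC; apply: ler_wpM2r; first exact: A_ge0.
    by apply: expb; have := delay_le_max h i; rewrite /hmax; lra.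
have [kap kap0 Hkap] : exists2 kap, 0 <= kap &
    forall s k, - H <= s <= 0 -> `|coords x s k| <= kap * lam k 0.
  have /fin_all_exists[B HB] : forall k, exists B : R, forall s, - H <= s <= 0 -> `|coords x s k| <= B.
    move=> k; have [[tx _] _] := rx; have [_ [B BP]] := tx 0 k.
    by exists B.
  have B0 k : 0 <= B k.
    by apply: le_trans (normr_ge0 (coords x 0 k)) _; apply: HB; rewrite lexx oppr_le0 andbT; exact: H0.
  exists (\sum_k B k / lam k 0).
    by apply: sumr_ge0 => k _; rewrite divr_ge0 // ltW.
  move=> s k sH; apply: le_trans (HB k s sH) _; rewrite -ler_pdivrMr //.
  by rewrite (bigD1 k) //= lerDl sumr_ge0 // => j _; rewrite divr_ge0 // ltW.
pose z (t : R) (k : 'I_n) : R := (kap * lam k 0) * expR (- al * t).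
have tz : tame h z by exact: (@tame_exp R N h n (- al) (fun k => kap * lam k 0)).
(* [Gz] is defined as the forcing that makes [z] a trajectory; [GzE] and [ccal] show that it is
   nondecreasing. *)
pose Gz t k := z t k - z 0 k - integ 0 t (fun s => lin h (sA0 S) (sA S) z s k).
have trz : traj h (sA0 S) (sA S) Gz z.
  by split=> // t k t0; rewrite /Gz; ring.
have GzE t k : 0 <= t -> Gz t k = (kap * (- al * lam k 0 - cc k)) * integ 0 t (fun s => 1 * expR (- al * s)).
  move=> t0; rewrite /Gz.
  have -> : integ 0 t (fun s => lin h (sA0 S) (sA S) z s k) =
      integ 0 t (fun s => (kap * cc k) * (1 * expR (- al * s))).
    apply: eq_integ => s _; rewrite lin_exp_cst //; last by rewrite oppr_le0 ltW.
    rewrite mul1r mulrC; congr (_ * _); rewrite /cc mulrDr !mulr_sumr; congr (_ + _).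
      by apply: eq_bigr => j _; rewrite mulrCA.
    apply: eq_bigr => i _; rewrite mulr_sumr; apply: eq_bigr => j _; ring.
  rewrite (@integZ _ 0 t (kap * cc k) (fun s => 1 * expR (- al * s))); last exact: intble_Zexp.
  have := exp_integ (- al) t0; rewrite mulr0 expR0.
  rewrite (@eq_integ _ _ _ _ (fun s => - al * (1 * expR (- al * s)))); last first.
    by move=> s _; rewrite mul1r.
  rewrite (@integZ _ 0 t (- al) (fun s => 1 * expR (- al * s))); last exact: intble_Zexp.
  rewrite /z mulr0 expR0 mulr1 => E.
  have -> : expR (- al * t) = - al * integ 0 t (fun s => 1 * expR (- al * s)) + 1 by rewrite E subrK.
  by ring.
have xz t k : - H <= t -> `|coords x t k| <= z t k.
  apply: (response0_le rx trz).
  - by move=> j; exact/continuous_subspaceT/continuous_Zexp.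
  - move=> i a b a0 ab; rewrite !GzE //; last exact: le_trans ab.
    apply: ler_wpM2l; first by rewrite mulr_ge0 // subr_ge0.
    rewrite (@integ_cat _ 0 a b) //; last exact: intble_Zexp.
    by rewrite lerDl integ_ge0 // => s _; rewrite mul1r expR_ge0.
  - move=> s j sH; apply: le_trans (Hkap s j sH) _; rewrite /z ler_peMr //.
      by rewrite mulr_ge0 // ltW.
    by case/andP: sH => _ s0; rewrite -expR0 ler_expR mulNr oppr_ge0 pmulr_rle0.
pose sl := \sum_k lam k 0.
have lsl k : lam k 0 <= sl by rewrite /sl (bigD1 k) //= lerDl sumr_ge0 // => j _; exact: ltW.
have sl0 : 0 <= sl by apply: sumr_ge0 => k _; exact: ltW.
(* From this time on exp(al t) >= 1 + al t > kap sl / eps. *)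
exists (kap * sl / (eps * al)) => t tT.
have ea : 0 < eps * al by rewrite mulr_gt0.
have t0 : 0 <= t by apply: le_trans tT; rewrite divr_ge0 ?mulr_ge0 // ltW.
apply: vnorminf_lt => // k; apply: le_lt_trans (xz t k _) _.
  by apply: le_trans t0; rewrite oppr_le0.
rewrite /z mulNr expRN ltr_pdivrMr ?expR_gt0 //.
have : kap * lam k 0 <= kap * sl by rewrite ler_wpM2l.
move: tT; rewrite ler_pdivrMr // => tT ksl.
have e1 := expR_ge1Dx (al * t).
apply: (@lt_le_trans _ _ (eps * (1 + al * t))); last by rewrite ler_wpM2l // ltW.
by rewrite mulrDr mulr1 mulrA [eps * al * t]mulrC; lra.
Qed.

(* The witness is X, the integral over [0, T] of the solution with initial value
   1: up to an error which vanishes as T grows, M X = x(T) - x(0) -> -1. *)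
Lemma asymp_stable_hurwitz : asymp_stable S -> hurwitz M.
Proof.
move=> [_ attr].
have [x rx x1] := response_exists (fun=> 1) loc_intble0.
have sx := solution_of_response (v := const_mx 1) loc_intble0 rx.
have {}sx : solution S (fun=> const_mx 1) (fun=> 0) (fun t => \col_k x t k).
  by apply: sx => s k s0; rewrite mxE x1.
have iphi : init_ok S (fun=> const_mx 1).
  by move=> k; apply: continuous_subspaceT => s; exact: cvg_cst.
pose mass := \sum_k delay_mass h (sA S) k.
have mass0 : 0 <= mass by apply: sumr_ge0 => k _; exact: delay_mass_ge0.
have lmass k : delay_mass h (sA S) k <= mass.
  by rewrite /mass (bigD1 k) //= lerDl sumr_ge0 // => j _; exact: delay_mass_ge0.
(* The final state, below [eps], and the window loss, at most [mass * eps], then add up to less than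
   the initial value 1. *)
pose eps := 1 / (1 + mass).
have m1 : 0 < 1 + mass by lra.
have eps0 : 0 < eps by rewrite divr_gt0.
have [T0 HT0] := attr _ _ iphi sx eps eps0.
(* The shift by [H] puts the whole last window [T - H, T] after [T0], where the state is below
   [eps]. *)
pose T := Num.max T0 0 + H.
have Tge0 : 0 <= T by rewrite addr_ge0 // le_max lexx orbT.
have x_ge0 : forall s j, - H <= s -> 0 <= x s j.
  apply: (response_ge0 loc_intble0 rx) => [j a b a0 ab|s j /andP[_ s0]]; last by rewrite x1.
  by apply: integ_ge0 => s _; rewrite /coords mxE.
have [[tx xE] cx] := rx.
have cxT j := @continuous_past x T j cx.
have x_ge0' s j : - H <= s <= T -> 0 <= x s j by move=> /andP[Hs _]; exact: x_ge0.
have xlt s j : T - H <= s -> x s j < eps.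
  move=> Ts; have := HT0 s; rewrite (le_trans _ Ts) ?addrK ?le_max ?lexx // => /(_ erefl).
  apply: le_lt_trans; apply: le_trans (ler_norm _) _.
  by have := le_vnorminf (\col_k x s k) j; rewrite mxE.
have xd s j : T - H <= s <= T -> x s j <= eps by move=> /andP[Ts _]; exact/ltW/xlt.
pose X : 'cV[R]_n := \col_j integ 0 T (x^~ j).
have MX k : (M *m X) k 0 < 0.
  have := lin_integ_ge h_gt0 (sA0 S) Ai' A_ge0' k tx Tge0 (ltW eps0) cxT x_ge0' xd.
  rewrite colE_mulmx -/X.
  have := xE T k Tge0; have := forcing0 T k; have := x1 0 k (lexx 0).
  have : x T k < eps by apply: xlt; have := H0; lra.
  have : delay_mass h (sA S) k * eps <= mass * eps by rewrite ler_wpM2r // ltW.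
  have : eps * (1 + mass) = 1 by rewrite /eps divfK // gt_eqF.
  by lra.
exists X; split=> //; apply: (metzler_lt0_gt0 static_metzler) => // k.
by rewrite mxE; apply: integ_ge0 => s /andP[s0 _]; apply: x_ge0; apply: le_trans s0; rewrite oppr_le0.
Qed.

(** * Gain bounds and their sharpness *)

Section Gains.
Hypothesis hur : hurwitz M.

Lemma out_dominated u x a xa : loc_intble u -> loc_intble a ->
  (forall t j, 0 <= t -> `|u t j| <= a t j) ->
  response u x -> (forall s k, - H <= s <= 0 -> x s k = 0) ->
  response a xa -> (forall s k, - H <= s <= 0 -> xa s k = 0) ->
  forall t k, 0 <= t -> `|out u x t k| <= out a xa t k.
Proof.
move=> lu la ua rx xz rxa xaz t k t0.
have side c : c = 1 \/ c = -1 -> 0 <= out a xa t k + c * out u x t k.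
  move=> c1.
  have lc : loc_intble (fun t j => c * u t j) by move=> T j; exact: intbleZ.
  have lac : loc_intble (fun t j => a t j + c * u t j) by move=> T j; exact: intbleD.
  have rc := responseZ c lu rx.
  have rac := responseD la lc rxa rc.
  rewrite -outZ // -outD //; apply: out_ge0 => //.
    by move=> j; have := ua t j t0; rewrite ler_norml => /andP[]; case: c1 => ->; lra.
  apply: (response_ge0 lac rac) => [j p q p0 pq|s j sH].
    apply: integ_ge0 => s /andP[ps _]; have s0 := le_trans p0 ps.
    by have := ua s j s0; rewrite ler_norml => /andP[]; case: c1 => ->; lra.
  by rewrite xz // xaz // mulr0 addr0.
have := side 1 (or_introl erefl); have := side (-1) (or_intror erefl).
by rewrite ler_norml; lra.
Qed.

Lemma out_le_static u x (l : 'cV[R]_n) t k : response u x -> 0 <= t ->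
  (forall s j, - H <= s -> x s j <= l j 0) ->
  out u x t k <= (G *m l) k 0 + \sum_j sFu S k j * u t j.
Proof.
move=> [[tx _] _] t0 xl; rewrite lerD2r.
have tc : tame h (fun _ j => l j 0) by exact: tame_cst.
have tm : tame h (fun s j => -1 * x s j) by exact: tameZ.
have := @lin_ge0 _ _ h _ _ (sC0 S) (sC S) C_ge0' (fun s j => l j 0 + -1 * x s j) t k C0_ge0 t0.
rewrite linD // linZ // lin_cst // colE_mulmx.
have -> : \col_j l j 0 = l by apply/colP => j; rewrite mxE.
have l1 s j : - H <= s <= t -> 0 <= l j 0 + -1 * x s j.
  by move=> /andP[Hs _]; have := xl s j Hs; lra.
by move=> /(_ l1); lra.
Qed.

Lemma L1_gain (gamma : R) : 0 < gamma -> (forall j, \sum_k DC k j < gamma) ->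
  gain_lt S (@L1norm R nu) (@L1norm R ny) gamma.
Proof.
move=> gamma0 Hg; have [g [g0 gg DCg]] := exists_lt_max gamma0 Hg.
exists g => // u x [mu_ ufin] sx.
have mv : measurable_fun (@Rplus_set R) (fun t => vnorm1 (u t)).
  by apply: measurable_sum => j; exact: measurableT_comp.
have lu : loc_intble (coords u).
  move=> T j; apply: (halfline_intble (g := fun t => vnorm1 (u t)) (mu_ j) mv _ ufin) => t t0.
  by rewrite /vnorm1 (bigD1 j) //= lerDl sumr_ge0.
have iphi : init_ok S (fun=> 0).
  by move=> k; apply: continuous_subspaceT => s; exact: cvg_cst.
have rx := response_of_solution iphi lu sx.
have [xphi _ _] := sx.
have xz s k : - H <= s <= 0 -> coords x s k = 0 by move=> sH; rewrite /coords xphi // mxE.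
pose a t j := `|coords u t j|.
have la : loc_intble a by move=> T j; exact: intble_norm.
have [xa rxa xaz] := response_exists (fun=> 0) la.
have xaz' s k : - H <= s <= 0 -> xa s k = 0 by move=> /andP[_ s0]; exact: xaz.
have vi T : intble 0 T (fun t => vnorm1 (u t)) by apply: intble_sum => j; exact: la.
have [I I0 IE] : exists2 I : R, 0 <= I & L1norm u = I%:E.
  have L0 : (0 <= L1norm u)%E.
    by apply: integral_ge0 => t _; rewrite lee_fin sumr_ge0.
  exists (fine (L1norm u)); first exact: fine_ge0.
  by rewrite fineK // ge0_fin_numE.
have uI T : 0 <= T -> integ 0 T (fun t => vnorm1 (u t)) <= I.
  move=> T0; rewrite -lee_fin -IE; apply: ge_halfline => // t t0.
  by rewrite sumr_ge0.
rewrite IE -EFinM; apply: le_halfline.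
- move=> T T0; apply: intble_sum => k; apply: intble_norm.
  apply: (@eq_intble _ _ _ (fun s => out (coords u) (coords x) s k)) => [s _|].
      by rewrite outputE.
    exact: out_intble.
- by move=> t _; rewrite sumr_ge0.
move=> T T0; apply: (@le_trans _ _ (integ 0 T (fun t => \sum_k out a xa t k))).
  apply: le_integ.
  - apply: intble_sum => k; apply: intble_norm.
    apply: (@eq_intble _ _ _ (fun s => out (coords u) (coords x) s k)) => [s _|].
      by rewrite outputE.
    exact: out_intble.
  - by apply: intble_sum => k; exact: out_intble.
  move=> t /andP[t0 _]; apply: ler_sum => k _; rewrite outputE.
  exact: (out_dominated lu la _ rx xz rxa xaz').
rewrite integ_sum; last by move=> k; exact: out_intble.
apply: (@le_trans _ _ (\sum_k \sum_j DC k j * integ 0 T (a^~ j))).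
  by apply: ler_sum => k _; apply: out_integ_le => // j t _; exact: normr_ge0.
rewrite exchange_big /=; apply: (@le_trans _ _ (g * integ 0 T (fun t => vnorm1 (u t)))); last first.
  by apply: ler_wpM2l; [exact: ltW|exact: uI].
have -> : integ 0 T (fun t => vnorm1 (u t)) = \sum_j integ 0 T (a^~ j) by rewrite -integ_sum.
rewrite mulr_sumr; apply: ler_sum => j _; rewrite -mulr_suml.
by apply: ler_wpM2r; [apply: integ_ge0 => s _; exact: normr_ge0|exact: DCg].
Qed.

Lemma L2_gain (g gamma : R) (u0 : 'cV[R]_nu) (y0 : 'cV[R]_ny) : 0 < g -> g < gamma ->
  (forall j, 0 < u0 j 0) -> (forall k, 0 < y0 k 0) ->
  (forall k, (DC *m u0) k 0 <= g * y0 k 0) ->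
  (forall j, (DC^T *m y0) j 0 <= g * u0 j 0) ->
  gain_lt S (@L2norm R nu) (@L2norm R ny) gamma.
Proof.
move=> g0 gg u0_gt0 y0_gt0 DCu DCy.
exists g => // u x [mu_ ufin] sx.
have sq m (v : 'cV[R]_m) : vnorm2 v ^+ 2 = \sum_j v j 0 ^+ 2.
  by rewrite /vnorm2 sqr_sqrtr // sumr_ge0 // => j _; exact: sqr_ge0.
have mv : measurable_fun (@Rplus_set R) (fun t => \sum_j u t j 0 ^+ 2).
  by apply: measurable_sum => j; exact: measurable_funX.
have ufin' : (\int[mu]_(t in @Rplus_set R) (\sum_j u t j 0 ^+ 2)%:E < +oo)%E.
  under eq_integral do rewrite -sq.
  exact: (lty_poweRy _ ufin).
have lu2 : loc_intble (fun t j => coords u t j ^+ 2).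
  move=> T j; apply: (halfline_intble (g := fun t => \sum_j u t j 0 ^+ 2) _ mv _ ufin') => [|t t0].
    by apply: measurable_funX; exact: mu_.
  rewrite ger0_norm ?sqr_ge0 // (bigD1 j) //= lerDl sumr_ge0 // => i _; exact: sqr_ge0.
have lu : loc_intble (coords u).
  move=> T j; apply: (@le_intble _ _ _ _ (fun t => 1 + coords u t j ^+ 2)).
  - apply: measurable_funS (mu_ j) => //; first exact: measurable_halfline.
    by move=> t; rewrite /Rplus_set /= !in_itv /= => /andP[->].
  - move=> s _; rewrite ler_norml; have := sqr_ge0 (coords u s j - 1).
    have := sqr_ge0 (coords u s j + 1); nra.
  - by apply: intbleD => //; exact: intble_cst.
have iphi : init_ok S (fun=> 0).
  by move=> k; apply: continuous_subspaceT => s; exact: cvg_cst.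
have rx := response_of_solution iphi lu sx.
have [xphi _ _] := sx.
have xz s k : - H <= s <= 0 -> coords x s k = 0 by move=> sH; rewrite /coords xphi // mxE.
pose w (t : R) j := u0 j 0.
pose b t j := (u0 j 0)^-1 * coords u t j ^+ 2.
have lw : loc_intble w by move=> T j; exact: intble_cst.
have lb : loc_intble b by move=> T j; apply: intbleZ.
have [xw rw xwz] := response_exists (fun=> 0) lw.
have [xb rb xbz] := response_exists (fun=> 0) lb.
have xwz' s k : - H <= s <= 0 -> xw s k = 0 by move=> /andP[_ s0]; exact: xwz.
have xbz' s k : - H <= s <= 0 -> xb s k = 0 by move=> /andP[_ s0]; exact: xbz.
have b0 t j : 0 <= b t j by rewrite /b mulr_ge0 ?sqr_ge0 // invr_ge0 ltW.
have outw t k : 0 <= t -> out w xw t k <= g * y0 k 0.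
  move=> t0; apply: le_trans (DCu k); rewrite dc_gain_mulmx addrC.
  have -> : (sFu S *m u0) k 0 = \sum_j sFu S k j * w t j by rewrite mxE.
  apply: out_le_static => //; apply: (response_le hur lw _ _ rw xwz').
    by move=> i j; rewrite [j]ord1 ltW.
  by move=> j p q p0 pq; rewrite integ_cst // mulrC.
(* Cauchy-Schwarz for the positive functional [u |-> out u]. *)
have CS t k : 0 <= t -> out (coords u) (coords x) t k ^+ 2 <= g * y0 k 0 * out b xb t k.
  move=> t0; set yk := out (coords u) (coords x) t k; set c := g * y0 k 0.
  have c0 : 0 < c by rewrite mulr_gt0.
  (* The input s^2 u0 - 2 s u + u^2 / u0 = (s u0 - u)^2 / u0 is nonnegative, hence so is its output,
     a quadratic polynomial in [s]. *)
  have quad s : 0 <= s ^+ 2 * out w xw t k + (- 2 * s * yk + out b xb t k).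
    have l1 : loc_intble (fun t j => s ^+ 2 * w t j) by move=> T j; exact: intbleZ.
    have l2 : loc_intble (fun t j => - 2 * s * coords u t j) by move=> T j; exact: intbleZ.
    have l3 : loc_intble (fun t j => - 2 * s * coords u t j + b t j) by move=> T j; exact: intbleD.
    have l4 : loc_intble (fun t j => s ^+ 2 * w t j + (- 2 * s * coords u t j + b t j)).
      by move=> T j; exact: intbleD.
    have r1 := responseZ (s ^+ 2) lw rw.
    have r2 := responseZ (- 2 * s) lu rx.
    have r3 := responseD l2 lb r2 rb.
    have r4 := responseD l1 l3 r1 r3.
    have pos r j : 0 <= s ^+ 2 * w r j + (- 2 * s * coords u r j + b r j).
      have -> : s ^+ 2 * w r j + (- 2 * s * coords u r j + b r j) =
          (u0 j 0)^-1 * (s * u0 j 0 - coords u r j) ^+ 2.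
        by rewrite /w /b; field; rewrite gt_eqF.
      by rewrite mulr_ge0 ?sqr_ge0 // invr_ge0 ltW.
    rewrite /yk -outZ // -outZ // -outD // -outD //; apply: out_ge0 => //.
    apply: (response_ge0 l4 r4) => [j p q p0 pq|r j rH].
      by apply: integ_ge0 => r _; exact: pos.
    by rewrite xwz' // xz // xbz' // !mulr0 !addr0.
  (* The minimizer after the leading coefficient [out w xw t k], which may be 0, has been replaced
     by its positive bound [c]. *)
  have := quad (yk / c); have := outw t k t0; rewrite -/c => wc.
  have : (yk / c) ^+ 2 * out w xw t k <= (yk / c) ^+ 2 * c.
    by rewrite ler_wpM2l // sqr_ge0.
  have -> : (yk / c) ^+ 2 * c = yk ^+ 2 / c by field; rewrite gt_eqF.
  have -> : - 2 * (yk / c) * yk = - 2 * (yk ^+ 2 / c) by field; rewrite gt_eqF.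
  move=> q1 q2; have : yk ^+ 2 / c <= out b xb t k by lra.
  by rewrite ler_pdivrMr // mulrC.
pose I := fine (\int[mu]_(t in @Rplus_set R) (\sum_j u t j 0 ^+ 2)%:E).
have Iint_ge0 : (0 <= \int[mu]_(t in @Rplus_set R) (\sum_j u t j 0 ^+ 2)%:E)%E.
  by apply: integral_ge0 => t _; rewrite lee_fin sumr_ge0 // => j _; exact: sqr_ge0.
have IE : (\int[mu]_(t in @Rplus_set R) (\sum_j u t j 0 ^+ 2)%:E = I%:E)%E.
  by rewrite fineK // ge0_fin_numE.
have I0 : 0 <= I by exact: fine_ge0.
have uI T : 0 <= T -> integ 0 T (fun t => \sum_j coords u t j ^+ 2) <= I.
  move=> T0; rewrite -lee_fin -IE; apply: ge_halfline => //.
    by move=> T' _; apply: intble_sum => j; exact: lu2.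
  by move=> t t0; rewrite sumr_ge0 // => j _; exact: sqr_ge0.
have iy2 T k : 0 <= T -> intble 0 T (fun t => out (coords u) (coords x) t k ^+ 2).
  move=> T0; apply: (@le_intble _ _ _ _ (fun t => g * y0 k 0 * out b xb t k)).
  - by apply: measurable_funX; apply: intble_measurable; exact: out_intble.
  - by move=> t /andP[t0 _]; rewrite ger0_norm ?sqr_ge0 // CS.
  - by apply: intbleZ; exact: out_intble.
have yI : (\int[mu]_(t in @Rplus_set R) (vnorm2 (output S x u t) ^+ 2)%:E <= (g ^+ 2 * I)%:E)%E.
  have -> : (\int[mu]_(t in @Rplus_set R) (vnorm2 (output S x u t) ^+ 2)%:E =
      \int[mu]_(t in @Rplus_set R) (\sum_k out (coords u) (coords x) t k ^+ 2)%:E)%E.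
    by apply: eq_integral => t _; rewrite sq; congr EFin; apply: eq_bigr => k _; rewrite outputE.
  apply: le_halfline.
  - by move=> T T0; apply: intble_sum => k; exact: iy2.
  - by move=> t _; rewrite sumr_ge0 // => k _; exact: sqr_ge0.
  move=> T T0; rewrite integ_sum; last by move=> k; exact: iy2.
  apply: (@le_trans _ _ (\sum_k g * y0 k 0 * \sum_j DC k j * integ 0 T (b^~ j))).
    apply: ler_sum => k _.
    apply: (@le_trans _ _ (integ 0 T (fun t => g * y0 k 0 * out b xb t k))).
      apply: le_integ; [exact: iy2|by apply: intbleZ; exact: out_intble|].
      by move=> t /andP[t0 _]; exact: CS.
    rewrite integZ; last exact: out_intble.
    apply: ler_wpM2l; first by rewrite mulr_ge0 // ltW.
    exact: out_integ_le.
  apply: (@le_trans _ _ (g ^+ 2 * integ 0 T (fun t => \sum_j coords u t j ^+ 2))); last first.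
    by rewrite ler_wpM2l ?sqr_ge0 // uI.
  rewrite integ_sum // mulr_sumr.
  under eq_bigr do rewrite mulr_sumr.
  rewrite exchange_big /=; apply: ler_sum => j _.
  have -> : integ 0 T (b^~ j) = (u0 j 0)^-1 * integ 0 T (fun t => coords u t j ^+ 2).
    by rewrite -integZ.
  (* Summed against [y0], the columns of H form H^T y0 <= g u0, and u0 cancels the weight 1 / u0 in
     [b]. *)
  have -> : \sum_k g * y0 k 0 * (DC k j * ((u0 j 0)^-1 * integ 0 T (fun t => coords u t j ^+ 2))) =
     g * (DC^T *m y0) j 0 / u0 j 0 * integ 0 T (fun t => coords u t j ^+ 2).
    rewrite [X in g * X]mxE mulr_sumr !mulr_suml; apply: eq_bigr => k _; rewrite [DC^T j k]mxE; ring.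
  apply: ler_wpM2r; first by apply: integ_ge0 => s _; exact: sqr_ge0.
  by rewrite ler_pdivrMr // expr2 -mulrA; apply: ler_wpM2l; [exact: ltW|exact: DCy].
have e2 (X : \bar R) : (0 <= X)%E -> (X `^ 2^-1 = sqrte X)%E by move=> X0; rewrite poweR12_sqrt.
rewrite /L2norm e2; last by apply: integral_ge0 => t _; rewrite lee_fin sqr_ge0.
rewrite e2; last by apply: integral_ge0 => t _; rewrite lee_fin sqr_ge0.
have -> : (\int[mu]_(t in @Rplus_set R) (vnorm2 (u t) ^+ 2)%:E = I%:E)%E.
  by rewrite -IE; apply: eq_integral => t _; rewrite sq.
have -> : (g%:E * sqrte I%:E = sqrte (g ^+ 2 * I)%:E)%E.
  by rewrite /= -EFinM [in RHS]sqrtrM ?sqr_ge0 // sqrtr_sqr ger0_norm // ltW.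
by rewrite lee_sqrt // lee_fin mulr_ge0 // sqr_ge0.
Qed.

Lemma Linf_gain (gamma : R) : 0 < gamma -> (forall k, \sum_j DC k j < gamma) ->
  gain_lt S (@Linfnorm R nu) (@Linfnorm R ny) gamma.
Proof.
move=> gamma0 Hg; have [g [g0 gg DCg]] := exists_lt_max gamma0 Hg.
exists g => // u x [mu_ ufin] sx.
(* A real essential bound of the input first; the norm is an infimum, so it is then approached by
   bounds [M < L + e / g]. *)
have core m : 0 <= m -> (\forall t \ae mu, (0 <= t)%R -> ((vnorminf (u t))%:E <= m%:E)%E) ->
    (Linfnorm (output S x u) <= (g * m)%:E)%E.
  move=> m0 um.
  have uj j : \forall t \ae mu, 0 <= t -> `|coords u t j| <= m.
    apply: ae_mono um => t ut t0; apply: le_trans (le_vnorminf _ j) _.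
    by have := ut t0; rewrite lee_fin.
  have lu : loc_intble (coords u).
    move=> T j; have mj : measurable_fun (@Rplus_set R) (fun t => coords u t j) := mu_ j.
    exact: (ae_bounded_intble T mj (uj j)).
  have iphi : init_ok S (fun=> 0).
    by move=> k; apply: continuous_subspaceT => s; exact: cvg_cst.
  have rx := response_of_solution iphi lu sx.
  have [xphi _ _] := sx.
  have xz s k : - H <= s <= 0 -> coords x s k = 0 by move=> sH; rewrite /coords xphi // mxE.
  pose w : 'cV[R]_nu := const_mx m.
  have w0 : nonneg_mx w by move=> i j; rewrite mxE.
  pose l := Nm *m (sEu S *m w).
  have ub := fun j a b (a0 : 0 <= a) (ab : a <= b) =>
    ae_bounded_integ a0 ab (@lu b j) (uj j).
  have x1 s k : - H <= s -> coords x s k <= l k 0.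
    apply: (response_le hur lu w0 _ rx xz) => j a b a0 ab.
    by have := ub j a b a0 ab; rewrite ler_norml mxE => /andP[].
  have lm : loc_intble (fun t j => -1 * coords u t j) by move=> T j; exact: intbleZ.
  have rm := responseZ (-1) lu rx.
  have x2 s k : - H <= s -> -1 * coords x s k <= l k 0.
    apply: (response_le hur lm w0 _ rm) => [j a b a0 ab|r j rH]; last by rewrite xz // mulr0.
    rewrite integZ; last exact: intble_sub (@lu b j).
    by have := ub j a b a0 ab; rewrite ler_norml mxE mulN1r => /andP[]; lra.
  have Glm k : (G *m l) k 0 + (sFu S *m w) k 0 <= g * m.
    rewrite addrC -dc_gain_mulmx.
    have -> : (DC *m w) k 0 = (\sum_j DC k j) * m.
      by rewrite [LHS]mxE mulr_suml; apply: eq_bigr => j _; rewrite [w _ _]mxE.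
    by rewrite ler_wpM2r.
  apply: ge_ereal_inf; exists (g * m)%:E => //=.
  apply: ae_mono um => t ut t0; rewrite lee_fin.
  have {}ut j : `|coords u t j| <= m.
    by apply: le_trans (le_vnorminf _ j) _; have := ut t0; rewrite lee_fin.
  apply: bigmax_le => [|k _]; first by rewrite mulr_ge0 // ltW.
  rewrite outputE.
  have Fw c : c = 1 \/ c = -1 -> \sum_j sFu S k j * (c * coords u t j) <= (sFu S *m w) k 0.
    move=> c1; rewrite mxE; apply: ler_sum => j _; apply: ler_wpM2l; first exact: F_ge0.
    by rewrite mxE; have := ut j; rewrite ler_norml => /andP[]; case: c1 => ->; lra.
  have o1 := out_le_static k rx t0 x1.
  have o2 := out_le_static k rm t0 x2.
  have := outZ (-1) k t0 rx => oE; rewrite oE in o2.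
  have f2 := Fw (-1) (or_intror erefl).
  have f1 : \sum_j sFu S k j * coords u t j <= (sFu S *m w) k 0.
    by have := Fw 1 (or_introl erefl); under eq_bigr do rewrite mul1r.
  have := Glm k; rewrite ler_norml; lra.
have [L0 | ] := boolP (0 <= Linfnorm u)%E; last first.
  move=> /negP[]; apply: le_ereal_inf_tmp => M /= uM.
  exact: (ae_halfline_ge0 uM (fun t => bigmax_ge_id _ _ _ _)).
have Lfin : Linfnorm u \is a fin_num by rewrite ge0_fin_numE.
rewrite -(fineK Lfin); set L := fine _; rewrite -EFinM.
apply/lee_addgt0Pr => e e0.
have [M /= uM ML] : exists2 M, [set M : \bar R | \forall t \ae mu, (0 <= t)%R ->
    ((vnorminf (u t))%:E <= M)%E] M & (M < (L + e / g)%:E)%E.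
  by apply: ereal_inf_lt; rewrite -/(Linfnorm u) -(fineK Lfin) lte_fin ltrDl divr_gt0.
have M0 : (0 <= M)%E by exact: (ae_halfline_ge0 uM (fun t => bigmax_ge_id _ _ _ _)).
have Mfin : M \is a fin_num by rewrite ge0_fin_numE // (lt_trans ML) // ltry.
rewrite -(fineK Mfin) in uM M0 ML.
apply: le_trans (core (fine M) _ uM) _; first by rewrite -lee_fin.
rewrite -EFinD lee_fin; move: ML; rewrite lte_fin => /ltW ML.
have -> : g * L + e = g * (L + e / g) by field; rewrite gt_eqF.
by rewrite ler_wpM2l // ltW.
Qed.

Definition pulse_in (w : 'cV[R]_nu) (T : R) : R -> 'cV[R]_nu :=
  fun t => \col_j pulse w T t j.

Lemma pulse_inE w T t : pulse_in w T t = if t <= T then w else 0.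
Proof. by apply/colP => j; rewrite mxE /pulse; case: ifP; rewrite ?mxE. Qed.

Lemma pulse_measurable w T k : measurable_fun (@Rplus_set R) (fun t => pulse_in w T t k 0).
Proof.
apply: halfline_measurable => T' _; apply: eq_intble (pulse_loc_intble w T T' k) => s _.
by rewrite mxE.
Qed.

Lemma pulse_solution (w : 'cV[R]_nu) : nonneg_mx w -> exists K : 'I_ny -> R,
  forall T, 0 < T -> exists x, [/\ solution S (fun=> 0) (pulse_in w T) x,
    (forall t k, 0 <= t -> 0 <= output S x (pulse_in w T) t k 0),
    (forall T' k, 0 <= T' -> intble 0 T' (fun t => output S x (pulse_in w T) t k 0)) &
    forall k, T * (DC *m w) k 0 - K k <= integ 0 T (fun t => output S x (pulse_in w T) t k 0)].
Proof.
move=> w0; have [K HK] := pulse_out_ge hur w0; exists K => T T0.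
have [y [ry yz y0 yK]] := HK T T0.
have cE : coords (pulse_in w T) = pulse w T.
  by apply/funext => t; apply/funext => j; rewrite /coords mxE.
have cy : coords (fun t => \col_k y t k) = y.
  by apply/funext => t; apply/funext => k; rewrite /coords mxE.
have lp : loc_intble (coords (pulse_in w T)) by rewrite cE; exact: pulse_loc_intble.
have oE t k : output S (fun t => \col_k y t k) (pulse_in w T) t k 0 = out (pulse w T) y t k.
  by rewrite outputE cE cy.
exists (fun t => \col_k y t k); split.
- have rc : response (coords (pulse_in w T)) y by rewrite cE.
  by apply: (solution_of_response (v := 0) lp rc) => s k s0; rewrite yz // mxE.
- by move=> t k t0; rewrite oE; exact: y0.
- move=> T' k T'0; apply: (@eq_intble _ _ _ (fun t => out (pulse w T) y t k)) => [s _|].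
    by rewrite oE.
  apply: out_intble => //; exact: pulse_loc_intble.
- move=> k; apply: le_trans (yK k) _; rewrite le_eqVlt; apply/orP; left; apply/eqP.
  by apply: eq_integ => s _; rewrite oE.
Qed.

(** The constant in [gain_lt] may be negative; raising it to at least [gamma / 2] is harmless
    because the input norm is nonnegative. *)
Lemma gain_lt_ge0 Nin Nout (gamma : R) : 0 < gamma ->
  (forall u, (0 <= Nin u)%E) -> gain_lt S Nin Nout gamma ->
  exists g, [/\ 0 < g, g < gamma & forall u x, input_ok Nin u ->
     solution S (fun=> 0) u x -> (Nout (output S x u) <= g%:E * Nin u)%E].
Proof.
move=> gamma0 Nin0 [g gg Hg]; exists (Num.max g (gamma / 2)); split.
- by rewrite lt_max; apply/orP; right; lra.
- by rewrite gt_max gg; lra.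
- move=> u x iu sx; apply: le_trans (Hg u x iu sx) _; apply: lee_wpmul2r => //.
  by rewrite lee_fin le_max lexx.
Qed.

Lemma L1_gain_conv (gamma : R) : 0 < gamma ->
  gain_lt S (@L1norm R nu) (@L1norm R ny) gamma -> forall j, \sum_k DC k j < gamma.
Proof.
move=> gamma0 /gain_lt_ge0 [] // => [u|g [g0 gg Hg] j].
  by apply: integral_ge0 => t _; rewrite lee_fin sumr_ge0.
apply: le_lt_trans gg.
(* A pulse in the single channel [j] measures column [j] of H. *)
pose w : 'cV[R]_nu := delta_mx j 0.
have w0 : nonneg_mx w by move=> i i'; rewrite mxE ler0n.
have [K HK] := pulse_solution w0.
apply: (@le_of_linear _ _ _ (\sum_k K k)) => T T0.
have [x [sx y0 yi yK]] := HK T T0.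
have vw : vnorm1 w = 1.
  rewrite /vnorm1 (bigD1 j) //= big1 => [|i ij]; rewrite !mxE ?eqxx ?normr1 ?addr0 //.
  by rewrite (negbTE ij) normr0.
have uE : L1norm (pulse_in w T) = T%:E.
  rewrite -[T in RHS]mulr1 -pulse_halfline; last exact: ltW.
  apply: eq_integral => t _; rewrite pulse_inE -vw; case: ifP => // _.
  by rewrite /vnorm1 big1 // => i _; rewrite mxE normr0.
have iu : input_ok (@L1norm R nu) (pulse_in w T).
  by split; [exact: pulse_measurable|rewrite uE ltry].
have := Hg _ _ iu sx; rewrite uE -EFinM => yg.
rewrite -lee_fin [T * g]mulrC; apply: le_trans yg.
have vi T' : 0 <= T' -> intble 0 T' (fun t => vnorm1 (output S x (pulse_in w T) t)).
  by move=> T'0; apply: intble_sum => k; apply: intble_norm; exact: yi.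
apply: le_trans (ge_halfline (ltW T0) vi _); last by move=> t _; rewrite sumr_ge0.
rewrite lee_fin integ_sum; last by move=> k; apply: intble_norm; apply: yi; exact: ltW.
rewrite mulr_sumr -sumrB; apply: ler_sum => k _.
have -> : DC k j = (DC *m w) k 0.
  by rewrite /w -colE [RHS]mxE.
apply: le_trans (yK k) _; apply: le_integ.
- by apply: yi; exact: ltW.
- by apply: intble_norm; apply: yi; exact: ltW.
- by move=> s _; exact: ler_norm.
Qed.

(** The conclusion expresses that the spectral norm of H is at most [g], tested on nonnegative
    vectors, to which [gain_form_negdef] reduces the general case. It comes from the energy bound of
    the response to a pulse of height [w], paired with the constant vector [q]. *)
Lemma L2_gain_conv (gamma : R) : 0 < gamma ->
  gain_lt S (@L2norm R nu) (@L2norm R ny) gamma ->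
  exists2 g, 0 < g < gamma & forall (q : 'cV[R]_ny) (w : 'cV[R]_nu), nonneg_mx q -> nonneg_mx w ->
    2 * \sum_k q k 0 * (DC *m w) k 0 <= g * (\sum_k q k 0 ^+ 2 + \sum_j w j 0 ^+ 2).
Proof.
move=> gamma0 /gain_lt_ge0 [] // => [u|g [g0 gg Hg]]; first exact: poweR_ge0.
exists g; first by rewrite g0.
move=> q w q0 w0.
have sq m (v : 'cV[R]_m) : vnorm2 v ^+ 2 = \sum_j v j 0 ^+ 2.
  by rewrite /vnorm2 sqr_sqrtr // sumr_ge0 // => j _; exact: sqr_ge0.
pose W := \sum_j w j 0 ^+ 2; pose Q := \sum_k q k 0 ^+ 2.
have W0 : 0 <= W by apply: sumr_ge0 => j _; exact: sqr_ge0.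
have [K HK] := pulse_solution w0.
suff : \sum_k q k 0 * (DC *m w) k 0 <= g * (Q + W) / 2 by rewrite -/W -/Q; lra.
apply: (@le_of_linear _ _ _ (\sum_k q k 0 * K k)) => T T0; have T0' := ltW T0.
have [x [sx y0 yi yK]] := HK T T0.
have uE : L2norm (pulse_in w T) = sqrte (T * W)%:E.
  rewrite /L2norm poweR12_sqrt; last by apply: integral_ge0 => t _; rewrite lee_fin sqr_ge0.
  congr sqrte; rewrite -pulse_halfline //.
  apply: eq_integral => t _; rewrite pulse_inE sq; case: ifP => // _.
  by rewrite big1 // => i _; rewrite mxE expr0n.
have iu : input_ok (@L2norm R nu) (pulse_in w T).
  by split; [exact: pulse_measurable|rewrite uE /= ltry].
have := Hg _ _ iu sx; rewrite uE.
have -> : (g%:E * sqrte (T * W)%:E = sqrte (g ^+ 2 * (T * W))%:E)%E.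
  by rewrite /= -EFinM [in RHS]sqrtrM ?sqr_ge0 // sqrtr_sqr ger0_norm // ltW.
rewrite /L2norm poweR12_sqrt; last by apply: integral_ge0 => t _; rewrite lee_fin sqr_ge0.
rewrite lee_sqrt; last by rewrite lee_fin mulr_ge0 ?sqr_ge0 // mulr_ge0.
move=> yg; pose y (t : R) (k : 'I_ny) : R := output S x (pulse_in w T) t k 0.
(* The square of the output is integrable because its integral is finite. *)
have mh : measurable_fun (@Rplus_set R) (fun t => \sum_k y t k ^+ 2).
  by apply: measurable_sum => k; apply: measurable_funX; apply: halfline_measurable => T' T'0; exact: yi.
have yg' : (\int[mu]_(t in @Rplus_set R) (\sum_k y t k ^+ 2)%:E <= (g ^+ 2 * (T * W))%:E)%E.
  by apply: le_trans yg; rewrite le_eqVlt; apply/orP; left; apply/eqP; apply: eq_integral => t _; rewrite sq.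
have yi2 T' k : intble 0 T' (fun t => y t k ^+ 2).
  apply: (halfline_intble (g := fun t => \sum_k y t k ^+ 2) _ mh) => [|t t0|].
  - by apply: measurable_funX; apply: halfline_measurable => T'' T''0; exact: yi.
  - rewrite ger0_norm ?sqr_ge0 // (bigD1 k) //= lerDl sumr_ge0 // => i _; exact: sqr_ge0.
  - by apply: le_lt_trans yg' _; rewrite ltry.
have ysum : integ 0 T (fun t => \sum_k y t k ^+ 2) <= g ^+ 2 * (T * W).
  rewrite -lee_fin; apply: le_trans yg'; apply: ge_halfline => //.
    by move=> T' _; exact: intble_sum.
  by move=> t _; rewrite sumr_ge0 // => k _; exact: sqr_ge0.
rewrite integ_sum // in ysum.
rewrite mulr_sumr -sumrB.
(* Young's inequality q y <= (g / 2) q^2 + y^2 / (2 g), integrated over [0, T]; with this weight the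
   energy bound g^2 T W contributes (g / 2) T W. *)
apply: (@le_trans _ _ (\sum_k (g / 2 * T * q k 0 ^+ 2 + (2 * g)^-1 * integ 0 T (fun t => y t k ^+ 2)))).
  apply: ler_sum => k _.
  have -> : T * (q k 0 * (DC *m w) k 0) - q k 0 * K k = q k 0 * (T * (DC *m w) k 0 - K k) by ring.
  apply: (@le_trans _ _ (q k 0 * integ 0 T (fun t => y t k))); first by rewrite ler_wpM2l // yK.
  rewrite -integZ; last exact: yi.
  have -> : g / 2 * T * q k 0 ^+ 2 = integ 0 T (fun=> g / 2 * q k 0 ^+ 2).
    by rewrite integ_cst // subr0; ring.
  rewrite -integZ // -integD; [|exact: intble_cst|exact: intbleZ].
  apply: le_integ.
  - by apply: intbleZ; exact: yi.
  - by apply: intbleD; [exact: intble_cst|exact: intbleZ].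
  move=> t _; rewrite -subr_ge0.
  have -> : g / 2 * q k 0 ^+ 2 + (2 * g)^-1 * y t k ^+ 2 - q k 0 * y t k =
     (2 * g)^-1 * (g * q k 0 - y t k) ^+ 2 by field; rewrite gt_eqF.
  by rewrite mulr_ge0 ?sqr_ge0 // invr_ge0 mulr_ge0 // ltW.
rewrite big_split /= -!mulr_sumr -/Q.
have : (2 * g)^-1 * (\sum_k integ 0 T (fun t => y t k ^+ 2)) <= (2 * g)^-1 * (g ^+ 2 * (T * W)).
  by rewrite ler_wpM2l // invr_ge0 mulr_ge0 // ltW.
have -> : (2 * g)^-1 * (g ^+ 2 * (T * W)) = g / 2 * (T * W) by field; rewrite gt_eqF.
by lra.
Qed.

(** The mean of the output over [0, T] is at most its essential supremum, and for the all-ones pulse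
    it is at least the row sum of H up to K / T. *)
Lemma Linf_gain_conv (gamma : R) : 0 < gamma ->
  gain_lt S (@Linfnorm R nu) (@Linfnorm R ny) gamma -> forall k, \sum_j DC k j < gamma.
Proof.
move=> gamma0 /gain_lt_ge0 [] // => [u|g [g0 gg Hg] k].
  apply: le_ereal_inf_tmp => M /= uM.
  exact: (ae_halfline_ge0 uM (fun t => bigmax_ge_id _ _ _ _)).
apply: le_lt_trans gg.
pose w : 'cV[R]_nu := const_mx 1.
have w0 : nonneg_mx w by move=> i i'; rewrite mxE.
have [K HK] := pulse_solution w0.
(* The slack [e] provides an essential bound of the output below [g + e], although the infimum
   defining the norm need not be known to be attained. *)
apply/ler_addgt0Pr => e e0.
apply: (@le_of_linear _ _ _ (K k)) => T T0; have T0' := ltW T0.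
have [x [sx y0 yi yK]] := HK T T0.
have uE : (Linfnorm (pulse_in w T) <= 1%:E)%E.
  apply: ge_ereal_inf; exists 1%:E => //=; apply: nearW => t _; rewrite lee_fin.
  by apply: bigmax_le => // j _; rewrite mxE /pulse; case: ifP; rewrite ?mxE ?normr1 ?normr0.
have iu : input_ok (@Linfnorm R nu) (pulse_in w T).
  by split; [exact: pulse_measurable|apply: le_lt_trans uE _; rewrite ltry].
have yg : (Linfnorm (output S x (pulse_in w T)) < (g + e)%:E)%E.
  apply: (@le_lt_trans _ _ g%:E); last by rewrite lte_fin ltrDl.
  apply: le_trans (Hg _ _ iu sx) _; rewrite -[leRHS]mule1; apply: lee_wpmul2l => //.
  by rewrite lee_fin ltW.
have [M /= yM Mg] := ereal_inf_lt yg.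
have -> : \sum_j DC k j = (DC *m w) k 0.
  by rewrite [RHS]mxE; apply: eq_bigr => j _; rewrite [w _ _]mxE mulr1.
apply: le_trans (yK k) _; rewrite -[T in leRHS]subr0.
have yae : \forall t \ae mu, 0 <= t -> `|output S x (pulse_in w T) t k 0| <= g + e.
  apply: ae_mono yM => t yt t0; rewrite -lee_fin; apply: le_trans (ltW Mg).
  apply: le_trans (yt t0); rewrite lee_fin; exact: le_vnorminf.
apply: le_trans (ler_norm _) _.
exact: (ae_bounded_integ (lexx 0) T0' (yi T k T0') yae).
Qed.

End Gains.
End Responses.

(** * The linear matrix inequality *)

Section BlockSigns.
Variable R : realType.

Lemma all_col_mx (p : R -> Prop) m1 m2 (a : 'cV[R]_m1) (b : 'cV[R]_m2) :
  (forall k, p (a k 0)) -> (forall k, p (b k 0)) -> forall k, p (col_mx a b k 0).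
Proof. by move=> pa pb k; rewrite mxE; case: splitP => j _. Qed.

Lemma all_mxcol (p : R -> Prop) N (d : 'I_N -> nat) (a : forall i, 'cV[R]_(d i)) :
  (forall i k, p (a i k 0)) -> forall k, p ((\mxcol_i a i) k 0).
Proof. by move=> pa k; rewrite mxE. Qed.

Lemma nonneg_row_mx m n1 n2 (a : 'M[R]_(m, n1)) (b : 'M[R]_(m, n2)) :
  nonneg_mx a -> nonneg_mx b -> nonneg_mx (row_mx a b).
Proof. by move=> a0 b0 i j; rewrite mxE; case: splitP => k _. Qed.

Lemma nonneg_mx_tr m n (a : 'M[R]_(m, n)) : nonneg_mx a -> nonneg_mx a^T.
Proof. by move=> a0 i j; rewrite mxE. Qed.

Lemma nonneg_mx0 m n : nonneg_mx (0 : 'M[R]_(m, n)).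
Proof. by move=> i j; rewrite mxE. Qed.

Lemma nonneg_mxD m n (a b : 'M[R]_(m, n)) : nonneg_mx a -> nonneg_mx b -> nonneg_mx (a + b).
Proof. by move=> a0 b0 i j; rewrite mxE addr_ge0. Qed.

Lemma nonneg_mx_sum m n N (a : 'I_N -> 'M[R]_(m, n)) :
  (forall i, nonneg_mx (a i)) -> nonneg_mx (\sum_i a i).
Proof. by move=> a0 k j; rewrite summxE sumr_ge0 // => i _; exact: a0. Qed.

Lemma metzler_block n1 n2 (a : 'M[R]_n1) b c (d : 'M[R]_n2) : metzler a -> metzler d ->
  nonneg_mx b -> nonneg_mx c -> metzler (block_mx a b c d).
Proof.
move=> ma md b0 c0 i j ij; rewrite mxE.
case: (splitP i) => i' Ei; rewrite mxE; case: (splitP j) => j' Ej //.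
- by apply: ma; apply: contraNneq ij => E; apply/eqP/val_inj; rewrite /= Ei Ej E.
- by apply: md; apply: contraNneq ij => E; apply/eqP/val_inj; rewrite /= Ei Ej E.
Qed.

Lemma metzler_diag n (d : 'M[R]_n) : is_diag_mx d -> metzler (- d).
Proof. by move=> /is_diag_mxP dd i j ij; rewrite mxE dd // oppr0. Qed.

Lemma metzlerD n (a b : 'M[R]_n) : metzler a -> metzler b -> metzler (a + b).
Proof. by move=> ma mb i j ij; rewrite mxE addr_ge0 ?ma ?mb. Qed.

Lemma nonneg_metzler n (a : 'M[R]_n) : nonneg_mx a -> metzler a.
Proof. by move=> a0 i j _; exact: a0. Qed.

Lemma diag_mxdiag N n (Q : 'I_N -> 'M[R]_n) : (forall i, is_diag_mx (Q i)) ->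
  is_diag_mx (\mxdiag_i Q i).
Proof.
move=> dQ; apply/is_diag_mxblockP; split=> [i j /negbTE ->//|i].
by rewrite eqxx conform_mx_id.
Qed.

Lemma is_diag_tr n (Q : 'M[R]_n) : is_diag_mx Q -> Q^T = Q.
Proof.
move=> /is_diag_mxP dQ; apply/matrixP => i j; rewrite mxE.
by have [->//|ij] := eqVneq i j; rewrite !dQ // eq_sym.
Qed.

Lemma diag_posdef_gt0 n (P : 'M[R]_n) i : diag_posdef P -> 0 < P i i.
Proof.
move=> [_ pP]; have d0 : delta_mx i 0 != 0 :> 'cV[R]_n.
  by apply/cV0Pn; exists i; rewrite mxE !eqxx oner_eq0.
by have := pP _ d0; rewrite trmx_delta -rowE -colE !mxE.
Qed.

Lemma diag_mx_posdef n (d : 'rV[R]_n) : (forall k, 0 < d 0 k) -> diag_posdef (diag_mx d).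
Proof.
move=> d0; split; first exact: diag_mx_is_diag.
move=> v /cV0Pn[k vk].
rewrite -mulmxA mul_diag_mx mxE.
have -> : \sum_j v^T 0 j * (\matrix_(i, j0) (d 0 i * v i j0)) j 0 = \sum_j d 0 j * v j 0 ^+ 2.
  by apply: eq_bigr => j _; rewrite !mxE; ring.
rewrite (bigD1 k) //=; apply: ltr_wpDr; last by rewrite mulr_gt0 // exprn_even_gt0.
by apply: sumr_ge0 => i _; rewrite mulr_ge0 ?sqr_ge0 // ltW.
Qed.

Lemma mul_diag_col n (d : 'rV[R]_n) (v : 'cV[R]_n) k : (diag_mx d *m v) k 0 = d 0 k * v k 0.
Proof. by rewrite mul_diag_mx mxE. Qed.

Lemma col_row_mx m1 m2 n1 n2 (a : 'M[R]_(m1, n1)) (b : 'M[R]_(m1, n2)) (c : 'M[R]_(m2, n1)) (d : 'M[R]_(m2, n2)) :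
  col_mx (row_mx a b) (row_mx c d) = row_mx (col_mx a c) (col_mx b d).
Proof. by rewrite -block_mxEv block_mxEh. Qed.

Definition dot n (a b : 'cV[R]_n) : R := (a^T *m b) 0 0.

Lemma dotE n (a b : 'cV[R]_n) : dot a b = \sum_k a k 0 * b k 0.
Proof. by rewrite /dot mxE; apply: eq_bigr => k _; rewrite mxE. Qed.

Lemma dotC n (a b : 'cV[R]_n) : dot a b = dot b a.
Proof. by rewrite !dotE; apply: eq_bigr => k _; rewrite mulrC. Qed.

Lemma dotDr n (a b c : 'cV[R]_n) : dot a (b + c) = dot a b + dot a c.
Proof. by rewrite /dot mulmxDr mxE. Qed.

Lemma dot0l n (a : 'cV[R]_n) : dot 0 a = 0.
Proof. by rewrite /dot trmx0 mul0mx mxE. Qed.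

Lemma dotNr n (a b : 'cV[R]_n) : dot a (- b) = - dot a b.
Proof. by rewrite /dot mulmxN mxE. Qed.

Lemma dotZr n k (a b : 'cV[R]_n) : dot a (k *: b) = k * dot a b.
Proof. by rewrite /dot -scalemxAr mxE. Qed.

Lemma dot_sumr n N (a : 'cV[R]_n) (b : 'I_N -> 'cV[R]_n) : dot a (\sum_i b i) = \sum_i dot a (b i).
Proof. by rewrite /dot mulmx_sumr summxE. Qed.

Lemma dot_mulr m n (a : 'cV[R]_m) (A : 'M[R]_(m, n)) (b : 'cV[R]_n) : dot a (A *m b) = dot (A^T *m a) b.
Proof. by rewrite /dot trmx_mul trmxK mulmxA. Qed.

Lemma dot_col_mx m1 m2 (a c : 'cV[R]_m1) (b d : 'cV[R]_m2) :
  dot (col_mx a b) (col_mx c d) = dot a c + dot b d.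
Proof. by rewrite /dot tr_col_mx mul_row_col mxE. Qed.

Lemma dot_mxcol N n (a b : 'I_N -> 'cV[R]_n) :
  dot (\mxcol_i a i) (\mxcol_i b i) = \sum_i dot (a i) (b i).
Proof. by rewrite /dot tr_mxcol mul_mxrow_mxcol summxE. Qed.

Lemma dot_gt0 n (a : 'cV[R]_n) : a != 0 -> 0 < dot a a.
Proof.
move=> /cV0Pn[k ak]; rewrite dotE (bigD1 k) //= ltr_wpDr //.
  by rewrite sumr_ge0 // => i _; rewrite -expr2 sqr_ge0.
by rewrite -expr2 exprn_even_gt0.
Qed.

End BlockSigns.

Section LMI.
Variables (R : realType) (n ny nu N : nat) (S : system R n ny nu N).
Hypotheses (mA0 : metzler (sA0 S)) (E_ge0 : nonneg_mx (sEu S)).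
Hypotheses (F_ge0 : nonneg_mx (sFu S)) (C0_ge0 : nonneg_mx (sC0 S)).
Hypotheses (Ab_ge0 : forall i, nonneg_mx (Abar S i)) (Cb_ge0 : forall i, nonneg_mx (Cbar S i)).
Let M := sA0 S + \sum_i Abar S i.
Let G := sC0 S + \sum_i Cbar S i.
Let DC := dc_gain M (sEu S) G (sFu S).

Let mM : metzler M.
Proof. by apply: metzlerD => //; apply/nonneg_metzler/nonneg_mx_sum. Qed.

Let G_ge0 : nonneg_mx G.
Proof. by apply: nonneg_mxD => //; exact: nonneg_mx_sum. Qed.

(** By a Schur complement, for g > 0 it is negative definite exactly when the spectral norm of H is
    less than [g]. *)
Definition gain_form (g : R) : 'M[R]_(nu + ny) := block_mx (- g%:M) DC^T DC (- g%:M).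

Lemma gain_formE g u y : dot (col_mx u y) (gain_form g *m col_mx u y) =
  2 * dot y (DC *m u) - g * (dot u u + dot y y).
Proof.
rewrite mul_block_col dot_col_mx !dotDr !mulNmx !dotNr !mul_scalar_mx !dotZr.
by rewrite dot_mulr trmxK [dot (DC *m u) y]dotC; ring.
Qed.

(** H is nonnegative, so [gain_form g] is Metzler; the two halves of its positive vector are the
    Perron pair. *)
Lemma gain_form_perron g : hurwitz M -> negdef (gain_form g) ->
  exists u0 : 'cV[R]_nu, exists y0 : 'cV[R]_ny,
   [/\ forall j, 0 < u0 j 0, forall k, 0 < y0 k 0,
    forall k, (DC *m u0) k 0 < g * y0 k 0 & forall j, (DC^T *m y0) j 0 < g * u0 j 0].
Proof.
move=> hur nd; have DC0 := dc_gain_ge0 mM E_ge0 G_ge0 F_ge0 hur.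
have md k : metzler (- g%:M : 'M[R]_k) by apply: metzler_diag; exact: scalar_mx_is_diag.
have [v [v0 Sv]] := metzler_negdef_lt0
  (metzler_block (md nu) (md ny) (nonneg_mx_tr DC0) DC0) nd.
exists (usubmx v), (dsubmx v).
rewrite -[v]vsubmxK mul_block_col in Sv.
split=> [j|k|k|j]; [by rewrite mxE|by rewrite mxE| |].
- have := Sv (rshift _ k); rewrite col_mxEd mulNmx mul_scalar_mx mxE [X in _ + X]mxE.
  by rewrite [X in _ - X]mxE subr_lt0.
- have := Sv (lshift _ j); rewrite col_mxEu mulNmx mul_scalar_mx mxE [X in X + _]mxE.
  by rewrite [X in - X + _]mxE addrC subr_lt0.
Qed.

(** Replacing the entries of u and y by their absolute values keeps the norms and can only increase
    y^T H u; the gap [gamma - g] gives strictness. *)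
Lemma gain_form_negdef g gamma : hurwitz M -> 0 < g < gamma ->
  (forall (q : 'cV[R]_ny) (w : 'cV[R]_nu), nonneg_mx q -> nonneg_mx w ->
    2 * \sum_k q k 0 * (DC *m w) k 0 <= g * (\sum_k q k 0 ^+ 2 + \sum_j w j 0 ^+ 2)) ->
  negdef (gain_form gamma).
Proof.
move=> hur /andP[g0 gg] Hg v v0; have DC0 := dc_gain_ge0 mM E_ge0 G_ge0 F_ge0 hur.
rewrite -mulmxA -/(dot v _) -[v]vsubmxK gain_formE.
set u := usubmx v; set y := dsubmx v.
have uy : 0 < dot u u + dot y y.
  by rewrite -dot_col_mx vsubmxK dot_gt0.
pose q : 'cV[R]_ny := \col_k `|y k 0|; pose w : 'cV[R]_nu := \col_j `|u j 0|.
have q0 : nonneg_mx q by move=> i j; rewrite mxE.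
have w0 : nonneg_mx w by move=> i j; rewrite mxE.
have := Hg q w q0 w0.
have -> : \sum_k q k 0 ^+ 2 = dot y y.
  by rewrite dotE; apply: eq_bigr => k _; rewrite mxE -normrX ger0_norm ?sqr_ge0 // expr2.
have -> : \sum_k w k 0 ^+ 2 = dot u u.
  by rewrite dotE; apply: eq_bigr => k _; rewrite mxE -normrX ger0_norm ?sqr_ge0 // expr2.
have : dot y (DC *m u) <= \sum_k q k 0 * (DC *m w) k 0.
  rewrite dotE; apply: ler_sum => k _; apply: le_trans (ler_norm _) _.
  rewrite normrM [q k 0]mxE ler_wpM2l // mxE [leRHS]mxE.
  apply: le_trans (ler_norm_sum _ _ _) _; apply: ler_sum => j _.
  by rewrite normrM [w j 0]mxE ler_wpM2r // ger0_norm.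
have : (gamma - g) * (dot u u + dot y y) > 0 by rewrite mulr_gt0 // subr_gt0.
by lra.
Qed.

Section Form.
Variables (P : 'M[R]_n) (Q : 'I_N -> 'M[R]_n) (Rm : 'I_N -> 'M[R]_ny) (g : R).
Hypothesis PT : P^T = P.

Lemma L2_mx_mul x (w : 'I_N -> 'cV[R]_n) (r : 'I_N -> 'cV[R]_ny) u y :
  L2_mx S P Q Rm g *m col_mx x (col_mx (\mxcol_i w i) (col_mx (\mxcol_i r i) (col_mx u y))) =
  col_mx ((sA0 S)^T *m (P *m x) + P *m (sA0 S *m x)
      + \sum_i ((Abar S i)^T *m (Q i *m (Abar S i *m x)))
      + \sum_i ((Cbar S i)^T *m (Rm i *m (Cbar S i *m x)))
      + (\sum_i P *m w i + (P *m (sEu S *m u) + (sC0 S)^T *m y)))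
  (col_mx (\mxcol_i (P *m x - Q i *m w i))
  (col_mx (\mxcol_i (y - Rm i *m r i))
  (col_mx ((sEu S)^T *m (P *m x) + (- (g *: u) + (sFu S)^T *m y))
          (sC0 S *m x + (\sum_i r i + (sFu S *m u - g *: y)))))).
Proof.
rewrite /L2_mx !mul_col_mx !mul_row_col !mul0mx !add0r !addr0.
congr col_mx.
  rewrite mul_mxrow_mxcol -!mulmxA; congr (_ + _); rewrite !mulmxDl -!mulmxA; congr (_ + _ + _);
  by rewrite mulmx_suml; apply: eq_bigr => i _; rewrite -!mulmxA.
congr col_mx.
  rewrite tr_mxrow PT mxcol_mul mulNmx mul_mxdiag_mxcol -mxcolN -mxcolD.
  by [].
congr col_mx.
  rewrite mulNmx mul_mxdiag_mxcol mxcol_mul -mxcolN -mxcolD.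
  by apply/eq_mxcol => i; rewrite mul1mx addrC.
congr col_mx.
  by rewrite trmx_mul PT -mulmxA mulNmx mul_scalar_mx.
rewrite tr_mxcol mul_mxrow_mxcol mulNmx mul_scalar_mx; congr (_ + (_ + _)).
by apply: eq_bigr => i _; rewrite trmx1 mul1mx.
Qed.

(* Along w_i = Abar_i x and r_i = Cbar_i x the terms in Q and Rm cancel. *)
Lemma L2_mx_static_form x u y :
  let v := col_mx x (col_mx (\mxcol_i (Abar S i *m x))
     (col_mx (\mxcol_i (Cbar S i *m x)) (col_mx u y))) in
  dot v (L2_mx S P Q Rm g *m v) =
  2 * dot (P *m x) (M *m x + sEu S *m u) + 2 * dot y (G *m x + sFu S *m u)
  - g * (dot u u + dot y y).
Proof.
move=> v; rewrite /v L2_mx_mul !dot_col_mx !dot_mxcol.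
rewrite !(dotDr, dotNr, dotZr, dot_sumr) /M /G !mulmxDl !mulmx_suml !(dotDr, dot_sumr).
have dA (A : 'M[R]_n) z : dot x (A^T *m z) = dot (A *m x) z by rewrite dot_mulr trmxK.
have dC (A : 'M[R]_(ny, n)) z : dot x (A^T *m z) = dot (A *m x) z by rewrite dot_mulr trmxK.
have dP z : dot x (P *m z) = dot (P *m x) z by rewrite dot_mulr PT.
rewrite dA dP dC dP.
have dE z : dot u ((sEu S)^T *m z) = dot (sEu S *m u) z by rewrite dot_mulr trmxK.
have dF z : dot u ((sFu S)^T *m z) = dot (sFu S *m u) z by rewrite dot_mulr trmxK.
rewrite dE dF.
have -> : \sum_i dot x ((Abar S i)^T *m (Q i *m (Abar S i *m x))) =
   \sum_i dot (Abar S i *m x) (Q i *m (Abar S i *m x)) by apply: eq_bigr => i _; rewrite dA.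
have -> : \sum_i dot x ((Cbar S i)^T *m (Rm i *m (Cbar S i *m x))) =
   \sum_i dot (Cbar S i *m x) (Rm i *m (Cbar S i *m x)) by apply: eq_bigr => i _; rewrite dC.
have -> : \sum_i dot x (P *m (Abar S i *m x)) = \sum_i dot (P *m x) (Abar S i *m x).
  by apply: eq_bigr => i _; rewrite dP.
have -> : \sum_i dot (Abar S i *m x) (P *m x - Q i *m (Abar S i *m x)) =
   \sum_i dot (P *m x) (Abar S i *m x) - \sum_i dot (Abar S i *m x) (Q i *m (Abar S i *m x)).
  by rewrite -sumrB; apply: eq_bigr => i _; rewrite dotDr dotNr [X in X - _]dotC.
have -> : \sum_i dot (Cbar S i *m x) (y - Rm i *m (Cbar S i *m x)) =
   \sum_i dot y (Cbar S i *m x) - \sum_i dot (Cbar S i *m x) (Rm i *m (Cbar S i *m x)).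
  by rewrite -sumrB; apply: eq_bigr => i _; rewrite dotDr dotNr [X in X - _]dotC.
rewrite [dot (sA0 S *m x) _]dotC [dot (sC0 S *m x) _]dotC [dot (sEu S *m u) _]dotC [dot (sFu S *m u) _]dotC.
ring.
Qed.

(** Nested two-by-two blocks, so that the Metzler property and symmetry can be checked one level at
    a time. *)
Lemma L2_mx_block : (forall i, (Q i)^T = Q i) -> (forall i, (Rm i)^T = Rm i) ->
  L2_mx S P Q Rm g =
  block_mx ((sA0 S)^T *m P + P *m sA0 S
             + \sum_i ((Abar S i)^T *m Q i *m Abar S i)
             + \sum_i ((Cbar S i)^T *m Rm i *m Cbar S i))
    (row_mx (\mxrow_(i < N) P) (row_mx 0 (row_mx (P *m sEu S) (sC0 S)^T)))
    (row_mx (\mxrow_(i < N) P) (row_mx 0 (row_mx (P *m sEu S) (sC0 S)^T)))^T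
    (block_mx (- \mxdiag_i Q i) (row_mx 0 (row_mx 0 0)) (row_mx 0 (row_mx 0 0))^T
      (block_mx (- \mxdiag_i Rm i) (row_mx 0 (\mxcol_(i < N) 1%:M))
        (row_mx 0 (\mxcol_(i < N) 1%:M))^T
        (block_mx (- g%:M) (sFu S)^T (sFu S) (- g%:M)))).
Proof.
move=> QT RT.
by rewrite /L2_mx !tr_row_mx !trmx0 trmxK !block_mxEv !col_row_mx.
Qed.

End Form.

(** Two choices in the static form: u = y = 0 shows that the Metzler matrix P M is negative
    definite, hence M lam < 0 for some lam > 0. The equilibrium x = - M^-1 E u then removes the term
    in P and leaves [gain_form]. *)
Lemma L2_lmi_static P Q Rm gamma : diag_posdef P -> negdef (L2_mx S P Q Rm gamma) ->
  hurwitz M /\ negdef (gain_form gamma).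
Proof.
move=> dP nd; have [diagP _] := dP; have PT := is_diag_tr diagP.
have form x u y : col_mx x (col_mx u y) != 0 ->
   2 * dot (P *m x) (M *m x + sEu S *m u) + 2 * dot y (G *m x + sFu S *m u)
  - gamma * (dot u u + dot y y) < 0.
  move=> xuy; rewrite -(L2_mx_static_form Q Rm gamma PT) /dot mulmxA; apply: nd.
  by apply: contraNneq xuy => /eqP; rewrite !col_mx_eq0 => /and5P[-> _ _ -> ->].
have hM : hurwitz M.
  have mPM : metzler (P *m M).
    move=> i j ij; rewrite mxE (bigD1 i) //= big1 ?addr0.
      by rewrite mulr_ge0 ?mM // ltW // diag_posdef_gt0.
    by move=> k ki; have /is_diag_mxP -> := diagP; rewrite ?mul0r // eq_sym.
  have ndPM : negdef (P *m M).
    move=> x x0; have xu : col_mx x (col_mx 0 0) != 0 :> 'cV[R]_(n + (nu + ny)).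
      by rewrite col_mx_eq0 negb_and x0.
    have := form _ _ _ xu; rewrite !mulmx0 !addr0 !dot0l !addr0 !mulr0 subr0 addr0.
    by rewrite pmulr_rlt0 // /dot trmx_mul PT !mulmxA.
  have [v [v0 PMv]] := metzler_negdef_lt0 mPM ndPM.
  exists v; split=> // k; have := PMv k; rewrite -mulmxA mxE (bigD1 k) //= big1 ?addr0.
    by rewrite pmulr_rlt0 // diag_posdef_gt0.
  by move=> j jk; have /is_diag_mxP -> := diagP; rewrite ?mul0r // eq_sym.
split=> // v v0; have [lam [lam0 Mlam]] := hM; have uM := metzler_unit mM lam0 Mlam.
rewrite -mulmxA -/(dot v _) -[v]vsubmxK gain_formE.
set u := usubmx v; set y := dsubmx v.
have uy : col_mx (- invmx M *m (sEu S *m u)) (col_mx u y) != 0.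
  by rewrite col_mx_eq0 negb_and vsubmxK v0 orbT.
have := form _ _ _ uy.
have -> : M *m (- invmx M *m (sEu S *m u)) + sEu S *m u = 0.
  by rewrite mulmxA mulmxN mulmxV // mulNmx mul1mx addNr.
have -> : G *m (- invmx M *m (sEu S *m u)) + sFu S *m u = DC *m u.
  by apply/colP => k; rewrite dc_gain_mulmx mxE addrC.
by rewrite {1}/dot mulmx0 mxE mulr0 add0r.
Qed.

End LMI.

Section DiagonalScaling.
Variable R : realType.

Definition diag_ratio n (p w : 'cV[R]_n) : 'M[R]_n := diag_mx (\row_k (p k 0 / w k 0)).

Lemma diag_ratio_posdef n (p w : 'cV[R]_n) : (forall k, 0 < p k 0) -> (forall k, 0 < w k 0) ->
  diag_posdef (diag_ratio p w).
Proof. by move=> p0 w0; apply: diag_mx_posdef => k; rewrite mxE divr_gt0. Qed.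

Lemma diag_ratio_mul n (p w : 'cV[R]_n) : (forall k, 0 < w k 0) -> diag_ratio p w *m w = p.
Proof.
by move=> w0; apply/colP => k; rewrite mul_diag_col mxE divfK // gt_eqF.
Qed.

Lemma diag_ratio_le n (p w z : 'cV[R]_n) : (forall k, 0 < p k 0) -> (forall k, 0 < w k 0) ->
  (forall k, z k 0 <= w k 0) -> forall k, (diag_ratio p w *m z) k 0 <= p k 0.
Proof.
move=> p0 w0 zw k; rewrite mul_diag_col mxE mulrAC ler_pdivrMr //.
by rewrite ler_wpM2l // ltW.
Qed.

Lemma mulmx_le m n (A : 'M[R]_(m, n)) (a b : 'cV[R]_n) : nonneg_mx A ->
  (forall k, a k 0 <= b k 0) -> forall k, (A *m a) k 0 <= (A *m b) k 0.
Proof. by move=> A0 ab k; rewrite !mxE; apply: ler_sum => j _; rewrite ler_wpM2l. Qed.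

End DiagonalScaling.

(** * Construction of diagonal solutions of the matrix inequality *)

Section StaticLMI.
Variables (R : realType) (n ny nu N : nat) (S : system R n ny nu N).
Hypotheses (mA0 : metzler (sA0 S)) (E_ge0 : nonneg_mx (sEu S)).
Hypotheses (F_ge0 : nonneg_mx (sFu S)) (C0_ge0 : nonneg_mx (sC0 S)).
Hypotheses (Ab_ge0 : forall i, nonneg_mx (Abar S i)) (Cb_ge0 : forall i, nonneg_mx (Cbar S i)).
Let M := sA0 S + \sum_i Abar S i.
Let G := sC0 S + \sum_i Cbar S i.

Lemma L2_mx_metzler P Q Rm g : diag_posdef P ->
  (forall i, diag_posdef (Q i)) -> (forall i, diag_posdef (Rm i)) ->
  metzler (L2_mx S P Q Rm g) /\ (L2_mx S P Q Rm g)^T = L2_mx S P Q Rm g.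
Proof.
have diag_ge0 k (D : 'M[R]_k) : diag_posdef D -> nonneg_mx D.
  move=> dD i j; have [->|ij] := eqVneq i j; first by rewrite ltW // diag_posdef_gt0.
  by have [/is_diag_mxP -> //] := dD.
move=> dP dQ dR; have [diagP _] := dP; have PT := is_diag_tr diagP.
have diagQ i : is_diag_mx (Q i) by have [] := dQ i.
have diagR i : is_diag_mx (Rm i) by have [] := dR i.
have QT i := is_diag_tr (diagQ i); have RT i := is_diag_tr (diagR i).
have P0 := diag_ge0 _ _ dP; have Q0 i := diag_ge0 _ _ (dQ i); have R0 i := diag_ge0 _ _ (dR i).
rewrite L2_mx_block //; split.
  have nrow : nonneg_mx (row_mx (\mxrow_(i < N) P) (row_mx (0 : 'M[R]_(n, \sum_(i < N) ny))
      (row_mx (P *m sEu S) (sC0 S)^T))).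
    apply: nonneg_row_mx; first by move=> i j; rewrite mxE.
    apply: nonneg_row_mx; first exact: nonneg_mx0.
    by apply: nonneg_row_mx; [exact: mulmx_ge0|exact: nonneg_mx_tr].
  have nrow0 : nonneg_mx (row_mx 0 (row_mx 0 0) :
      'M[R]_(\sum_(i < N) n, \sum_(i < N) ny + (nu + ny))).
    by do 2![apply: nonneg_row_mx; first exact: nonneg_mx0]; exact: nonneg_mx0.
  have nrowI : nonneg_mx (row_mx 0 (\mxcol_(i < N) (1%:M : 'M[R]_ny)) :
      'M[R]_(\sum_(i < N) ny, nu + ny)).
    apply: nonneg_row_mx; first exact: nonneg_mx0.
    by move=> i j; rewrite !mxE; case: (_ == _).
  have md k : metzler (- g%:M : 'M[R]_k) by apply: metzler_diag; exact: scalar_mx_is_diag.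
  apply: metzler_block => //; last exact: nonneg_mx_tr.
    do 2?apply: metzlerD.
    - apply: metzlerD.
        move=> i j ij; rewrite mxE sumr_ge0 // => k _; rewrite [_^T i k]mxE.
        have [->|ki] := eqVneq k i; last by rewrite mulr_ge0 // mA0.
        by have /is_diag_mxP -> := diagP; rewrite ?mulr0.
      move=> i j ij; rewrite mxE sumr_ge0 // => k _.
      have [->|kj] := eqVneq k j; last by rewrite mulr_ge0 // mA0.
      by have /is_diag_mxP -> := diagP; rewrite ?mul0r.
    - apply: nonneg_metzler; apply: nonneg_mx_sum => i.
      by apply: mulmx_ge0 => //; apply: mulmx_ge0 => //; exact: nonneg_mx_tr.
    - apply: nonneg_metzler; apply: nonneg_mx_sum => i.
      by apply: mulmx_ge0 => //; apply: mulmx_ge0 => //; exact: nonneg_mx_tr.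
  apply: metzler_block => //; last exact: nonneg_mx_tr.
    by apply: metzler_diag; exact: diag_mxdiag.
  apply: metzler_block => //; last exact: nonneg_mx_tr.
    by apply: metzler_diag; exact: diag_mxdiag.
  by apply: metzler_block => //; exact: nonneg_mx_tr.
have Nscal k : (- g%:M : 'M[R]_k)^T = - g%:M by rewrite raddfN /= tr_scalar_mx.
have Ndiag k (D : 'I_N -> 'M[R]_k) : (forall i, (D i)^T = D i) ->
    (- \mxdiag_i D i)^T = - \mxdiag_i D i.
  by move=> DT; rewrite raddfN /= tr_mxdiag; congr (- _); apply/eq_mxdiag.
rewrite !tr_block_mx !trmxK !Nscal !Ndiag //; congr block_mx.
rewrite !raddfD /= !trmx_mul PT trmxK !raddf_sum /= [_ *m P + _]addrC.
by congr (_ + _ + _); apply: eq_bigr => i _; rewrite !trmx_mul trmxK ?QT ?RT mulmxA.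
Qed.

(* L2_mx is symmetric and Metzler, so it is negative definite as soon as it maps
   some positive vector to a negative one.  The vector is (l, w, r, u0, y0) with
   w_i = Abar_i l + e, r_i = Cbar_i l + e, and P l = p, Q_i w_i = p + e,
   R_i r_i = y0 + e. *)
Lemma static_L2_lmi gamma (l p : 'cV[R]_n) (u0 : 'cV[R]_nu) (y0 : 'cV[R]_ny) :
  (forall k, 0 < l k 0) -> (forall k, 0 < p k 0) ->
  (forall j, 0 < u0 j 0) -> (forall k, 0 < y0 k 0) ->
  (forall k, (M *m l + sEu S *m u0) k 0 < 0) ->
  (forall k, (G *m l + sFu S *m u0) k 0 < gamma * y0 k 0) ->
  (forall k, (M^T *m p + G^T *m y0) k 0 < 0) ->
  (forall j, ((sEu S)^T *m p + (sFu S)^T *m y0) j 0 < gamma * u0 j 0) ->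
  exists P Q Rm, [/\ diag_posdef P, forall i, diag_posdef (Q i),
    forall i, diag_posdef (Rm i) & negdef (L2_mx S P Q Rm gamma)].
Proof.
move=> l0 p0 u00 y00 Ml Gl Mp Ep.
have addE k (a b : 'cV[R]_k) j : (a + b) j 0 = a j 0 + b j 0 by rewrite mxE.
have oppE k (a : 'cV[R]_k) j : (- a) j 0 = - a j 0 by rewrite mxE.
have scaleE k c (a : 'cV[R]_k) j : (c *: a) j 0 = c * a j 0 by rewrite mxE.
pose one k : 'cV[R]_k := const_mx 1; pose P := diag_ratio p l.
have dP : diag_posdef P by exact: diag_ratio_posdef.
have PT : P^T = P by apply: is_diag_tr; have [] := dP.
have Pl : P *m l = p by exact: diag_ratio_mul.
(* The first block row at the chosen vector for e = 0; the extra term is nonpositive since P is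
   nonnegative. *)
have Hp k : (M^T *m p + G^T *m y0 + P *m (M *m l + sEu S *m u0)) k 0 < 0.
  rewrite mxE ltr_wnDr // mul_diag_col mulr_ge0_le0 ?(ltW (Ml _)) //.
  by rewrite mxE divr_ge0 ?ltW.
(* The perturbations collect the terms that the shifts by [e] add to the first block row ([e1]) and
   to the last one ([e2]); the two middle rows with Q and Rm become exactly - e. *)
have [e1 e10 He1] := strict_perturb
  (fun k => (\sum_i (Abar S i)^T *m one n + \sum_i (Cbar S i)^T *m one ny
             + \sum_(i < N) P *m one n) k 0) Hp.
have [e2 e20 He2] := strict_perturb (fun k => (\sum_(i < N) one ny) k 0) Gl.
pose e := Num.min e1 e2.
have e0 : 0 < e by rewrite lt_min e10.
have ee1 : 0 < e <= e1 by rewrite e0 ge_min lexx.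
have ee2 : 0 < e <= e2 by rewrite e0 ge_min lexx orbT.
have {}He1 k := He1 e k ee1; have {}He2 k := He2 e k ee2.
pose w i := Abar S i *m l + e *: one n; pose r i := Cbar S i *m l + e *: one ny.
pose p' := p + e *: one n; pose y' := y0 + e *: one ny.
have shift_gt k (a : 'cV[R]_k) j : a j 0 < (a + e *: one k) j 0.
  by rewrite [ltRHS]mxE [X in _ + X]mxE [one k _ _]mxE mulr1 ltrDl.
have Al0 i k : 0 <= (Abar S i *m l) k 0 by apply: mulmx_ge0 => // a b; rewrite [b]ord1 ltW.
have Cl0 i k : 0 <= (Cbar S i *m l) k 0 by apply: mulmx_ge0 => // a b; rewrite [b]ord1 ltW.
have w0 i k : 0 < w i k 0 by apply: le_lt_trans (shift_gt _ _ _).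
have r0 i k : 0 < r i k 0 by apply: le_lt_trans (shift_gt _ _ _).
have p'0 k : 0 < p' k 0 by apply: lt_trans (shift_gt _ _ _).
have y'0 k : 0 < y' k 0 by apply: lt_trans (shift_gt _ _ _).
pose Q i := diag_ratio p' (w i); pose Rm i := diag_ratio y' (r i).
have dQ i : diag_posdef (Q i) by exact: diag_ratio_posdef.
have dR i : diag_posdef (Rm i) by exact: diag_ratio_posdef.
exists P, Q, Rm; split=> //.
have [mL sL] := L2_mx_metzler gamma dP dQ dR.
apply: (@metzler_lt0_negdef _ _ _
  (col_mx l (col_mx (\mxcol_i w i) (col_mx (\mxcol_i r i) (col_mx u0 y0)))) mL sL).
  apply: (@all_col_mx R (fun z => 0 < z)) => //.
  apply: (@all_col_mx R (fun z => 0 < z)); first exact: (@all_mxcol R (fun z => 0 < z)).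
  apply: (@all_col_mx R (fun z => 0 < z)); first exact: (@all_mxcol R (fun z => 0 < z)).
  exact: (@all_col_mx R (fun z => 0 < z)).
rewrite L2_mx_mul //.
apply: (@all_col_mx R (fun z => z < 0)).
  move=> k; apply: le_lt_trans (He1 k).
  have HQ i : ((Abar S i)^T *m (Q i *m (Abar S i *m l))) k 0 <= ((Abar S i)^T *m p') k 0.
    apply: mulmx_le; first exact: nonneg_mx_tr.
    by apply: diag_ratio_le => // j; exact: ltW (shift_gt _ _ _).
  have HR i : ((Cbar S i)^T *m (Rm i *m (Cbar S i *m l))) k 0 <= ((Cbar S i)^T *m y') k 0.
    apply: mulmx_le; first exact: nonneg_mx_tr.
    by apply: diag_ratio_le => // j; exact: ltW (shift_gt _ _ _).
  apply: (@le_trans _ _ (((sA0 S)^T *m p + P *m (sA0 S *m l)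
     + \sum_i ((Abar S i)^T *m p') + \sum_i ((Cbar S i)^T *m y')
     + (\sum_i P *m w i + (P *m (sEu S *m u0) + (sC0 S)^T *m y0))) k 0)).
    by rewrite Pl !addE !summxE !lerD // ler_sum.
  rewrite le_eqVlt; apply/orP; left; apply/eqP.
  have eA : \sum_i (Abar S i)^T *m p' = (\sum_i Abar S i)^T *m p + e *: \sum_i (Abar S i)^T *m one n.
    rewrite raddf_sum /= mulmx_suml scaler_sumr -big_split /=; apply: eq_bigr => i _.
    by rewrite /p' mulmxDr -scalemxAr.
  have eC : \sum_i (Cbar S i)^T *m y' = (\sum_i Cbar S i)^T *m y0 + e *: \sum_i (Cbar S i)^T *m one ny.
    rewrite raddf_sum /= mulmx_suml scaler_sumr -big_split /=; apply: eq_bigr => i _.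
    by rewrite /y' mulmxDr -scalemxAr.
  have eP : \sum_i P *m w i = P *m ((\sum_i Abar S i) *m l) + e *: \sum_(i < N) P *m one n.
    rewrite mulmx_suml mulmx_sumr scaler_sumr -big_split /=; apply: eq_bigr => i _.
    by rewrite /w mulmxDr -scalemxAr.
  rewrite eA eC eP /M /G !raddfD /= !mulmxDl !mulmxDr.
  by rewrite !(addE, scaleE); ring.
apply: (@all_col_mx R (fun z => z < 0)).
  apply: (@all_mxcol R (fun z => z < 0)) => i k; rewrite Pl diag_ratio_mul //.
  by rewrite mxE [X in _ + X]mxE subr_lt0.
apply: (@all_col_mx R (fun z => z < 0)).
  apply: (@all_mxcol R (fun z => z < 0)) => i k; rewrite diag_ratio_mul //.
  by rewrite mxE [X in _ + X]mxE subr_lt0.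
apply: (@all_col_mx R (fun z => z < 0)) => k.
  have := Ep k; rewrite Pl -subr_lt0; apply: le_lt_trans; rewrite le_eqVlt; apply/orP; left; apply/eqP.
  by rewrite !(addE, oppE, scaleE); ring.
have := He2 k; rewrite -subr_lt0; apply: le_lt_trans; rewrite le_eqVlt; apply/orP; left; apply/eqP.
have -> : \sum_i r i = (\sum_i Cbar S i) *m l + e *: \sum_(i < N) one ny.
  by rewrite mulmx_suml scaler_sumr -big_split.
by rewrite /G mulmxDl !(addE, oppE, scaleE); ring.
Qed.

End StaticLMI.

(** * The stated vector conditions in coordinates, and the three equivalences *)

Section Conditions.
Variables (R : realType) (n ny nu N : nat) (S : system R n ny nu N).
Let M := sA0 S + \sum_i Abar S i.
Let G := sC0 S + \sum_i Cbar S i.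

Lemma Linf_condE lam g : Linf_cond S lam g <->
  (forall k, (M *m lam) k 0 + \sum_j sEu S k j < 0) /\
  (forall k, (G *m lam) k 0 + \sum_j sFu S k j < g).
Proof.
have sum1 m (A : 'M[R]_(m, nu)) k : (A *m const_mx 1 : 'cV_m) k 0 = \sum_j A k j.
  by rewrite mxE; apply: eq_bigr => j _; rewrite mxE mulr1.
rewrite /Linf_cond /Mbig mul_block_col; split=> [H|[HM HG] k].
  split=> k.
    by have := H (lshift _ k); rewrite !col_mxEu mxE sum1 [ltRHS]mxE.
  by have := H (rshift _ k); rewrite !col_mxEd mxE sum1 [ltRHS]mxE.
case: (split_ordP k) => j ->.
  by rewrite !col_mxEu mxE sum1 [ltRHS]mxE.
by rewrite !col_mxEd mxE sum1 [ltRHS]mxE.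
Qed.

Lemma L1_condE lam g : L1_cond S lam g <->
  (forall k, (M^T *m lam) k 0 + \sum_j (sC0 S + \sum_i Cbar S i)^T k j < 0) /\
  (forall k, ((sEu S)^T *m lam) k 0 + \sum_j (sFu S)^T k j < g).
Proof.
have sum1 m (A : 'M[R]_(ny, m)) k :
    ((const_mx 1 : 'cV_ny)^T *m A) 0 k = \sum_j A^T k j.
  by rewrite mxE; apply: eq_bigr => j _; rewrite !mxE mul1r.
have trE m (A : 'M[R]_(n, m)) k : (lam^T *m A) 0 k = (A^T *m lam) k 0.
  by rewrite -[A in LHS]trmxK -trmx_mul mxE.
rewrite /L1_cond /Mbig tr_col_mx mul_row_block; split=> [H|[HM HG] k].
  split=> k.
    by have := H (lshift _ k); rewrite !row_mxEl mxE sum1 trE [ltRHS]mxE.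
  by have := H (rshift _ k); rewrite !row_mxEr mxE sum1 trE [ltRHS]mxE.
case: (split_ordP k) => j ->.
  by rewrite !row_mxEl mxE sum1 trE [ltRHS]mxE.
by rewrite !row_mxEr mxE sum1 trE [ltRHS]mxE.
Qed.

End Conditions.

Theorem theorem19 (R : realType) (n ny nu N : nat) (S : system R n ny nu N)
  (gamma1 gamma2 gammainf : R) :
  metzler (sA0 S) ->
  nonneg_mx (sEu S) -> nonneg_mx (sFu S) -> nonneg_mx (sC0 S) ->
  (forall i, 0 < sh S i) ->
  (forall i, entrywise_integrable (sh S i) (sA S i)) ->
  (forall i, entrywise_integrable (sh S i) (sC S i)) ->
  (forall i, entrywise_nonneg_on (sh S i) (sA S i)) ->
  (forall i, entrywise_nonneg_on (sh S i) (sC S i)) ->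
  0 < gamma1 -> 0 < gamma2 -> 0 < gammainf ->
  [/\
   (asymp_stable S /\ gain_lt S (@L1norm R nu) (@L1norm R ny) gamma1 <->
    exists2 lambda : 'cV[R]_n, (forall k, 0 < lambda k 0) &
      L1_cond S lambda gamma1),
   (asymp_stable S /\ gain_lt S (@L2norm R nu) (@L2norm R ny) gamma2 <->
    exists P : 'M[R]_n, exists Q : 'I_N -> 'M[R]_n,
    exists Rm : 'I_N -> 'M[R]_ny,
      [/\ diag_posdef P, (forall i, diag_posdef (Q i)),
          (forall i, diag_posdef (Rm i)) &
          negdef (L2_mx S P Q Rm gamma2)]) &
   (asymp_stable S /\ gain_lt S (@Linfnorm R nu) (@Linfnorm R ny) gammainf <->
    exists2 lambda : 'cV[R]_n, (forall k, 0 < lambda k 0) &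
      Linf_cond S lambda gammainf)].
Proof.
move=> mA0 E0 F0 C0 h0 Ai Ci A0 C0' g1 g2 gi.
set M := sA0 S + \sum_i Abar S i; set G := sC0 S + \sum_i Cbar S i.
have Ab0 i : nonneg_mx (Abar S i).
  move=> k j; rewrite mxE; by apply: integ_ge0 => s /A0.
have Cb0 i : nonneg_mx (Cbar S i).
  move=> k j; rewrite mxE; by apply: integ_ge0 => s /C0'.
have mM : metzler M by apply: metzlerD => //; apply/nonneg_metzler/nonneg_mx_sum.
have G0 : nonneg_mx G by apply: nonneg_mxD => //; exact: nonneg_mx_sum.
have stab : asymp_stable S <-> hurwitz M.
  split; first exact: asymp_stable_hurwitz.
  exact: hurwitz_asymp_stable.
split.
(* Column sums of H are row sums of H^T, the static gain of the transposed data; stability is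
   invariant under transposition. *)
- have rc := row_cond_dc_gain (sFu S)^T (metzler_tr mM) (nonneg_mx_tr G0)
    (nonneg_mx_tr E0) gamma1.
  rewrite dc_gain_tr hurwitz_tr // in rc.
  split=> [[/stab hM gl]|[lam lam0 /L1_condE Hl]].
    have [|lam lam0 Hl] := rc.2.
      split=> // j; under eq_bigr do rewrite mxE.
      exact: (L1_gain_conv mA0 E0 F0 C0 h0 Ai Ci A0 C0' hM g1 gl).
    by exists lam => //; exact/L1_condE.
  have [|hM Hg] := rc.1; first by exists lam.
  split; first exact/stab.
  apply: (L1_gain mA0 E0 F0 C0 h0 Ai Ci A0 C0' hM g1) => j.
  by apply: le_lt_trans (Hg j); apply: ler_sum => k _; rewrite [leRHS]mxE.
- split=> [[/stab hM gl]|[P [Q [Rm [dP dQ dR nd]]]]].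
    have [g gg Hg] := L2_gain_conv mA0 E0 F0 C0 h0 Ai Ci A0 C0' hM g2 gl.
    have ndg := gain_form_negdef mA0 E0 F0 C0 Ab0 Cb0 hM gg Hg.
    have [u0 [y0 [u00 y00 Hu Hy]]] := gain_form_perron mA0 E0 F0 C0 Ab0 Cb0 hM ndg.
    have nu0 : nonneg_mx u0 by move=> j i; rewrite [i]ord1 ltW.
    have ny0 : nonneg_mx y0 by move=> j i; rewrite [i]ord1 ltW.
    (* Supersolutions of the system with input [u0] and of the transposed one with input [y0] supply
       the vectors [l] and [p] of the construction. *)
    have [l l0 [Ml Gl]] := dc_gain_supersolution mM E0 hM nu0 Hu.
    rewrite -dc_gain_tr in Hy.
    have [p p0 [Mp Ep]] := dc_gain_supersolution (metzler_tr mM) (nonneg_mx_tr G0)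
      ((hurwitz_tr mM).2 hM) ny0 Hy.
    exact: (static_L2_lmi mA0 E0 F0 C0 Ab0 Cb0 l0 p0 u00 y00 Ml Gl Mp Ep).
  have [hM ndg] := L2_lmi_static mA0 Ab0 dP nd.
  split; first exact/stab.
  have [u0 [y0 [u00 y00 Hu Hy]]] := gain_form_perron mA0 E0 F0 C0 Ab0 Cb0 hM ndg.
  (* The strict Perron inequalities at [gamma2] are finitely many, so both still hold, non-strictly,
     for one constant below [gamma2]. *)
  have [|e1 [e10 e1g He1]] := @exists_lt_max _ _
    (fun k => (dc_gain M (sEu S) G (sFu S) *m u0) k 0 / y0 k 0) gamma2 g2.
    by move=> k; rewrite ltr_pdivrMr.
  have [|e2 [e20 e2g He2]] := @exists_lt_max _ _
    (fun j => ((dc_gain M (sEu S) G (sFu S))^T *m y0) j 0 / u0 j 0) gamma2 g2.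
    by move=> k; rewrite ltr_pdivrMr.
  apply: (L2_gain mA0 E0 F0 C0 h0 Ai Ci A0 C0' hM (g := Num.max e1 e2) _ _ u00 y00).
  + by rewrite lt_max e10.
  + by rewrite gt_max e1g.
  + move=> k; rewrite -ler_pdivrMr // le_max; apply/orP; left; exact: He1.
  + move=> k; rewrite -ler_pdivrMr // le_max; apply/orP; right; exact: He2.
- have rc := row_cond_dc_gain (sFu S) mM E0 G0 gammainf.
  split=> [[/stab hM gl]|[lam lam0 /Linf_condE Hl]].
    have [|lam lam0 Hl] := rc.2.
      split=> //; exact: (Linf_gain_conv mA0 E0 F0 C0 h0 Ai Ci A0 C0' hM gi gl).
    by exists lam => //; exact/Linf_condE.
  have [|hM Hg] := rc.1; first by exists lam.
  split; first exact/stab.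
  exact: (Linf_gain mA0 E0 F0 C0 h0 Ai Ci A0 C0' hM gi).
Qed.
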